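(* Let $M(S)$ be an Artin monoid. Then there is a chain complex $C_*$ which computes the homology of $M(S)$, consisting of free $\mathbb{Z}$-modules $C_k$ with a basis given by the $k$-element subsets of $S$ which lie in $S^f$.
   Context: Given a set $S$ and a Coxeter matrix $m_{s,s}=1$, $m_{s,t}=m_{t,s}\in\{2,3,\dots\}\cup\{\infty\}$ for $s\neq t$, the Artin monoid $M(S)$ is the monoid generated by $S$ with relations $\underbrace{sts\ldots}_{m_{s,t}}=\underbrace{tst\ldots}_{m_{s,t}}$ for all $s\ne t$ with $m_{s,t}<\infty$. For $I\subset S$, $W(I)$ is the Coxeter group on $I$ defined by the restricted matrix, i.e. the group generated by $I$ with the same braid relations for $s\neq t$ in $I$ and additionally $s^2=1$ for $s\in I$. $S^f$ denotes the set of all subsets $I\subset S$ (including $\varnothing$) such that $W(I)$ is finite. The homology of a monoid $M$ is $H_*(BM;\mathbb{Z})$, where $BM$ is the geometric realization of the nerve of $M$ regarded as a one-object category. *)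

(* Defs.v *)
From Stdlib Require Import Relation_Operators.
From HB Require Import structures.
From mathcomp Require Import all_boot all_order all_algebra.
From mathcomp Require Import all_classical reals topology normedtype.
From mathcomp Require Import freeg.
From mathcomp Require Import zify.
Set Implicit Arguments.
Unset Strict Implicit.
Unset Printing Implicit Defensive.
Import GRing.Theory Num.Theory numFieldNormedType.Exports.
Local Open Scope classical_set_scope.
Local Open Scope quotient_scope.
Local Open Scope ring_scope.

Section GeneratedEquivalence.
Variables (T : choiceType) (r : T -> T -> Prop).

Definition equiv_closure : rel T := fun x y => `[< clos_refl_sym_trans T r x y >].

Lemma equiv_closureP x y :
  reflect (clos_refl_sym_trans T r x y) (equiv_closure x y).
Proof. exact: asboolP. Qed.

Lemma equiv_closure_refl : reflexive equiv_closure.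
Proof. by move=> x; apply/equiv_closureP/rst_refl. Qed.

Lemma equiv_closure_sym : symmetric equiv_closure.
Proof.
by move=> x y; apply/equiv_closureP/equiv_closureP => h; exact: rst_sym.
Qed.

Lemma equiv_closure_trans : transitive equiv_closure.
Proof.
move=> y x z /equiv_closureP h1 /equiv_closureP h2.
by apply/equiv_closureP; apply: rst_trans h1 h2.
Qed.

Canonical equiv_closure_equiv :=
  EquivRel equiv_closure equiv_closure_refl equiv_closure_sym
    equiv_closure_trans.

End GeneratedEquivalence.

Section MonoidPresentation.
Variables (X : choiceType) (R : seq X -> seq X -> Prop).

Variant rewrite_step : seq X -> seq X -> Prop :=
  RewriteStep (u v l r : seq X) of R l r :
    rewrite_step (u ++ l ++ v) (u ++ r ++ v).

Definition pres_monoid := {eq_quot (equiv_closure rewrite_step)}.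

HB.instance Definition _ := Choice.on pres_monoid.
HB.instance Definition _ := EqQuotient.on pres_monoid.

Implicit Types u v w : seq X.

Lemma pres_eqP u v :
  \pi_pres_monoid u = \pi_pres_monoid v <->
  clos_refl_sym_trans _ rewrite_step u v.
Proof.
by split=> [/eqquotP/equiv_closureP//|h]; apply/eqquotP/equiv_closureP.
Qed.

Lemma pres_eq_cat u u' v v' :
  \pi_pres_monoid u = \pi_pres_monoid u' ->
  \pi_pres_monoid v = \pi_pres_monoid v' ->
  \pi_pres_monoid (u ++ v) = \pi_pres_monoid (u' ++ v').
Proof.
move=> /pres_eqP hu /pres_eqP hv; apply/pres_eqP.
apply: (@rst_trans _ _ _ (u' ++ v)).
  elim: hu => {u u'} [_ _ [a b l r Rlr]|u|u u' _|u1 u2 u3 _ h1 _ h2].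
  - by rewrite -!catA; apply/rst_step/RewriteStep.
  - exact: rst_refl.
  - exact: rst_sym.
  - exact: rst_trans h1 h2.
elim: hv => {v v'} [_ _ [a b l r Rlr]|v|v v' _|v1 v2 v3 _ h1 _ h2].
- by rewrite !(catA u'); apply/rst_step/RewriteStep.
- exact: rst_refl.
- exact: rst_sym.
- exact: rst_trans h1 h2.
Qed.

Definition pres_one : pres_monoid := \pi_pres_monoid [::].
Definition pres_mul (x y : pres_monoid) : pres_monoid :=
  \pi_pres_monoid (repr x ++ repr y).

Lemma pres_mulE u v :
  pres_mul (\pi_pres_monoid u) (\pi_pres_monoid v) = \pi_pres_monoid (u ++ v).
Proof. by apply: pres_eq_cat; rewrite reprK. Qed.

Lemma pres_mulA : associative pres_mul.
Proof.
move=> x y z; rewrite -[x]reprK -[y]reprK -[z]reprK.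
rewrite (pres_mulE (repr y) (repr z)) (pres_mulE (repr x) (repr y)).
by rewrite (pres_mulE (repr x)) (pres_mulE _ (repr z)) catA.
Qed.

Lemma pres_mul1 : left_id pres_one pres_mul.
Proof. by move=> x; rewrite -[x in LHS]reprK pres_mulE reprK. Qed.

Lemma pres_mulr1 : right_id pres_one pres_mul.
Proof. by move=> x; rewrite -[x in LHS]reprK pres_mulE cats0 reprK. Qed.

HB.instance Definition _ :=
  isMonoid.Build pres_monoid pres_mulA pres_mul1 pres_mulr1.

Lemma pres_pi_cat u v :
  (\pi_pres_monoid (u ++ v) = \pi_pres_monoid u * \pi_pres_monoid v)%g.
Proof. by rewrite -pres_mulE. Qed.

Lemma pres_relE l r : R l r -> \pi_pres_monoid l = \pi_pres_monoid r.
Proof.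
move=> Rlr; apply/pres_eqP/rst_step.
by rewrite -[l]cats0 -[r]cats0; exact: (RewriteStep [::] [::]).
Qed.

End MonoidPresentation.

Section GroupPresentation.
Variables (X : choiceType) (R : seq X -> seq X -> Prop).

(* The letter (x, false) stands for x and (x, true) for its formal inverse. *)
Variant group_relation : seq (X * bool) -> seq (X * bool) -> Prop :=
| GroupCancel x b : group_relation [:: (x, b); (x, ~~ b)] [::]
| GroupRel l r of R l r :
    group_relation [seq (x, false) | x <- l] [seq (x, false) | x <- r].

Definition pres_group := pres_monoid group_relation.

HB.instance Definition _ := Monoid.on pres_group.

Definition word_inv (w : seq (X * bool)) : seq (X * bool) :=
  rev [seq (x.1, ~~ x.2) | x <- w].

Lemma word_invK : involutive word_inv.
Proof.
move=> w; rewrite /word_inv map_rev revK -map_comp map_id_in // => -[x b] _ /=.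
by rewrite negbK.
Qed.

Definition pres_inv (g : pres_group) : pres_group :=
  \pi_(pres_monoid group_relation) (word_inv (repr g)).

Lemma word_mulV w :
  \pi_(pres_monoid group_relation) (w ++ word_inv w) = 1%g.
Proof.
elim: w => [//|[x b] w IHw].
have -> : ((x, b) :: w) ++ word_inv ((x, b) :: w) =
    [:: (x, b)] ++ (w ++ word_inv w) ++ [:: (x, ~~ b)].
  by rewrite /word_inv /= rev_cons -cats1 -!catA.
rewrite pres_pi_cat [X in (_ * X)%g]pres_pi_cat IHw mul1g.
rewrite -(pres_pi_cat _ [:: (x, b)]).
by apply: pres_relE; exact: GroupCancel.
Qed.

Lemma pres_mulV : right_inverse (1%g : pres_group) pres_inv *%g.
Proof.
suff mulV (x : pres_monoid group_relation) : (x * pres_inv x = 1)%g by [].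
by rewrite -[X in (X * _)%g]reprK -pres_pi_cat word_mulV.
Qed.

Lemma pres_Vmul : left_inverse (1%g : pres_group) pres_inv *%g.
Proof.
suff Vmul (x : pres_monoid group_relation) : (pres_inv x * x = 1)%g by [].
rewrite -[X in (_ * X)%g]reprK -pres_pi_cat.
by rewrite -{2}[repr x]word_invK word_mulV.
Qed.

HB.instance Definition _ := hasInv.Build pres_group pres_inv.
HB.instance Definition _ := Monoid_isGroup.Build pres_group pres_Vmul pres_mulV.

End GroupPresentation.

(* [None] encodes the entry infinity. *)
Record coxeter_matrix (S : Type) := CoxeterMatrix {
  cox_entry :> S -> S -> option nat;
  cox_diag : forall s, cox_entry s s = Some 1%N;
  cox_sym : forall s t, cox_entry s t = cox_entry t s;
  cox_offdiag : forall s t n, s <> t -> cox_entry s t = Some n -> (2 <= n)%N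
}.

(* The word s t s t ... with n letters. *)
Fixpoint alternating (S : Type) (s t : S) (n : nat) : seq S :=
  if n is n'.+1 then s :: alternating t s n' else [::].

Variant braid_relation (S : Type) (m : coxeter_matrix S) :
    seq S -> seq S -> Prop :=
  BraidRelation s t n of s <> t & m s t = Some n :
    braid_relation m (alternating s t n) (alternating t s n).

Definition artin_monoid (S : choiceType) (m : coxeter_matrix S) : monoidType :=
  pres_monoid (braid_relation m).

Variant coxeter_relation (S : Type) (m : coxeter_matrix S) :
    seq S -> seq S -> Prop :=
| CoxeterBraid l r of braid_relation m l r : coxeter_relation m l r
| CoxeterSquare s : coxeter_relation m [:: s; s] [::].

Definition coxeter_group (S : choiceType) (m : coxeter_matrix S) : groupType :=
  pres_group (coxeter_relation m).

Section ParabolicSubsets.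
Variables (S : choiceType) (m : coxeter_matrix S).

Lemma restrict_diag (I : set S) (s : I) : m (val s) (val s) = Some 1%N.
Proof. exact: cox_diag. Qed.

Lemma restrict_sym (I : set S) (s t : I) :
  m (val s) (val t) = m (val t) (val s).
Proof. exact: cox_sym. Qed.

Lemma restrict_offdiag (I : set S) (s t : I) n :
  s <> t -> m (val s) (val t) = Some n -> (2 <= n)%N.
Proof. by move=> nst; apply: cox_offdiag => /val_inj. Qed.

Definition cox_restrict (I : set S) : coxeter_matrix I :=
  CoxeterMatrix (@restrict_diag I) (@restrict_sym I) (@restrict_offdiag I).

(* The collection S^f. *)
Definition finite_type_subsets : set (set S) :=
  [set I | finite_set [set: coxeter_group (cox_restrict I)]].

Definition finite_type_ksubsets (k : nat) : set (set S) :=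
  [set I | (I #= `I_k)%card] `&` finite_type_subsets.

End ParabolicSubsets.

(* [zmodule V] is V seen as a module over [int]. *)
Definition zlin (B : choiceType) (V : zmodType) (b : B -> V) :
    {freeg B / int} -> V :=
  fglift (b : B -> zmodule V).

Section ZLin.
Variables (B : choiceType) (V : zmodType) (b : B -> V).

Lemma zlin_is_zmod_morphism : zmod_morphism (zlin b).
Proof. exact: (lift_is_additive (b : B -> zmodule V)). Qed.

HB.instance Definition _ :=
  GRing.isZmodMorphism.Build {freeg B / int} V (zlin b) zlin_is_zmod_morphism.

Lemma zlinU x : zlin b << x >> = b x.
Proof. by rewrite /zlin liftU scale1r. Qed.

Lemma zlin_ext (f g : {additive {freeg B / int} -> V}) :
  (forall x, f << x >> = g << x >>) -> f =1 g.
Proof.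
move=> fg D; rewrite -(freeg_sumE D) !raddf_sum; apply: eq_bigr => x _.
have -> : << coeff x D *g x >> = << x >> *~ coeff x D :> {freeg B / int}.
  by rewrite freegU_mulz intz.
by rewrite !raddfMz fg.
Qed.

End ZLin.

(* Every element of V is a unique finite integral combination of the b x. *)
Definition is_Zbasis (B : choiceType) (V : zmodType) (b : B -> V) : Prop :=
  bijective (zlin b).

Record chain_complex := ChainComplex {
  chain_obj :> nat -> zmodType;
  chain_diff : forall n, {additive chain_obj n.+1 -> chain_obj n};
  chain_diffK : forall n x, chain_diff n (chain_diff n.+1 x) = 0
}.

(* The differential leaving degree 0 is zero. *)
Section Homology.
Variables (C : chain_complex) (n : nat).

Definition is_cycle : {pred C n} :=
  match n return pred (C n) with
  | 0 => xpredT
  | n'.+1 => fun x => chain_diff C n' x == 0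
  end.

Lemma is_cycle_zmod_closed : zmod_closed is_cycle.
Proof.
rewrite /is_cycle; case: (n) => [//|n'].
split=> [|x y /eqP dx /eqP dy]; apply/eqP; first exact: raddf0.
by rewrite raddfB dx dy subrr.
Qed.

HB.instance Definition _ := GRing.isZmodClosed.Build _ is_cycle
  is_cycle_zmod_closed.

Record cycles := Cycle { cycle_val : C n; _ : cycle_val \in is_cycle }.

HB.instance Definition _ := [isSub for cycle_val].
HB.instance Definition _ := [Choice of cycles by <:].
HB.instance Definition _ := [SubChoice_isSubZmodule of cycles by <:].

Definition is_boundary : {pred cycles} :=
  fun z => `[< exists y, chain_diff C n y = val z >].

Lemma is_boundary_zmod_closed : zmod_closed is_boundary.
Proof.
split=> [|x y /asboolP[u du] /asboolP[v dv]]; apply/asboolP.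
  by exists 0; rewrite !raddf0.
by exists (u - v); rewrite !raddfB du dv.
Qed.

HB.instance Definition _ := GRing.isZmodClosed.Build _ is_boundary
  is_boundary_zmod_closed.

Definition homology : zmodType := {ideal_quot is_boundary}.

End Homology.

Definition zmod_iso (V W : zmodType) : Prop :=
  exists f : {additive V -> W}, bijective f.

(* Monotone maps [k] -> [n], where [n] = {0 < ... < n} is ['I_n.+1]. *)
Record delta_map (k n : nat) := DeltaMap {
  delta_fun :> 'I_k.+1 -> 'I_n.+1;
  delta_homo : {homo delta_fun : i j / (i <= j)%N}
}.

Definition delta_id n : delta_map n n :=
  @DeltaMap n n id (fun _ _ le_ij => le_ij).

Definition delta_comp k l n (f : delta_map l n) (g : delta_map k l) :
    delta_map k n :=
  @DeltaMap k n (f \o g) (fun i j le_ij => delta_homo f (delta_homo g le_ij)).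

Lemma coface_homo n (i : 'I_n.+2) :
  {homo (fintype.lift i : 'I_n.+1 -> 'I_n.+2) : j k / (j <= k)%N}.
Proof. by move=> j k; rewrite /= leq_bump2. Qed.

Definition coface n (i : 'I_n.+2) : delta_map n n.+1 :=
  DeltaMap (@coface_homo n i).

Record simplicial_set := SimplicialSet {
  simplices :> nat -> choiceType;
  sact : forall k n, delta_map k n -> simplices n -> simplices k;
  sact_id : forall n x, sact (delta_id n) x = x;
  sact_comp : forall k l n (f : delta_map l n) (g : delta_map k l) x,
    sact (delta_comp f g) x = sact g (sact f x)
}.

Lemma delta_mapP k n (f g : delta_map k n) : f =1 g -> f = g.
Proof.
case: f g => [f hf] [g hg] /= /funext fg; subst g; congr DeltaMap.
exact: Prop_irrelevance.
Qed.

(* Unnormalized chains, with differential the alternating sum of the faces;  *)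
(* applied to the singular simplicial set of a space, this is the singular   *)
(* chain complex.                                                            *)
Section SimplicialChains.
Variable X : simplicial_set.

Definition face_sum n (x : X n.+1) : {freeg (X n) / int} :=
  \sum_(i < n.+2) << sact (coface i) x >> *~ ((-1) ^+ i).

Lemma coface_comp n (i i' : 'I_n.+3) (j j' : 'I_n.+2) :
  (j < i)%N -> i' = j :> nat -> j' = i.-1 :> nat ->
  delta_comp (coface i) (coface j) = delta_comp (coface i') (coface j').
Proof.
by move=> ji Ei Ej; apply: delta_mapP => l; apply/val_inj; rewrite /= /bump; lia.
Qed.

Definition simplicial_diff n : {freeg (X n.+1) / int} -> {freeg (X n) / int} :=
  zlin (@face_sum n).

HB.instance Definition _ n := GRing.Additive.on (@simplicial_diff n).

Lemma face_sum_cancel n (x : X n.+2) : simplicial_diff (face_sum x) = 0.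
Proof.
have dU (y : X n.+1) : simplicial_diff << y >> = face_sum y by exact: zlinU.
rewrite {1}/face_sum raddf_sum.
under eq_bigr => i _ do rewrite raddfMz /= dU.
pose F (p : 'I_n.+3 * 'I_n.+2) : {freeg (X n) / int} :=
  << sact (delta_comp (coface p.1) (coface p.2)) x >> *~ ((-1) ^+ (p.1 + p.2)).
have -> : \sum_(i < n.+3) face_sum (sact (coface i) x) *~ (-1) ^+ i
        = \sum_p F p.
  rewrite -(pair_bigA _ (fun i j => F (i, j))) /=; apply: eq_bigr => i _.
  rewrite /face_sum mulrz_suml; apply: eq_bigr => j _.
  by rewrite /F /= sact_comp -mulrzA addnC exprD.
pose h (p : 'I_n.+3 * 'I_n.+2) : 'I_n.+3 * 'I_n.+2 :=
  if (p.2 < p.1)%N then (inord p.2, inord p.1.-1) else (inord p.2.+1, inord p.1).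
have hE p : nat_of_ord (h p).1 = (if (p.2 < p.1)%N then p.2 : nat else p.2.+1)
         /\ nat_of_ord (h p).2 = (if (p.2 < p.1)%N then p.1.-1 else p.1).
  have := ltn_ord p.1; have := ltn_ord p.2.
  by rewrite /h; case: ifP => /= *; rewrite !inordK; lia.
have pairE (p q : 'I_n.+3 * 'I_n.+2) :
    p.1 = q.1 :> nat -> p.2 = q.2 :> nat -> p = q.
  by case: p q => [i j] [k l] /= /val_inj-> /val_inj->.
have hK : involutive h.
  move=> p; have [e1 e2] := hE p; have [e3 e4] := hE (h p).
  by apply: pairE; rewrite ?e3 ?e4 e1 e2; case: (ltnP p.2 p.1) => ?; case: ifP; lia.
have hF p : F (h p) = - F p.
  have [e1 e2] := hE p; have lt1 := ltn_ord p.1; have lt2 := ltn_ord p.2.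
  rewrite /F -mulrNz; congr (_ *~ _).
    congr (<< sact _ x >>); case: (ltnP p.2 p.1) e1 e2 => lt_p e1 e2.
      by symmetry; apply: coface_comp.
    by apply: coface_comp; rewrite ?e1 ?e2.
  rewrite e1 e2; case: ltnP => lt_p; last by rewrite addSn exprS mulN1r addnC.
  rewrite -[in RHS](prednK (leq_ltn_trans (leq0n _) lt_p)) addSn exprS mulN1r.
  by rewrite opprK addnC.
rewrite (bigID (fun p : 'I_n.+3 * 'I_n.+2 => (p.2 < p.1)%N)) /= [X in _ + X](reindex_inj (inv_inj hK)) /=.
have hlt p : ~~ ((h p).2 < (h p).1)%N = (p.2 < p.1)%N.
  by have [-> ->] := hE p; case: (ltnP p.2 p.1); lia.
under [X in _ + X]eq_bigl => p do rewrite hlt.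
by under [X in _ + X]eq_bigr => p _ do rewrite hF; rewrite sumrN subrr.
Qed.

Lemma simplicial_diffK n (D : {freeg (X n.+2) / int}) :
  simplicial_diff (simplicial_diff D) = 0.
Proof.
rewrite -(freeg_sumE D) !raddf_sum big1 // => x _.
rewrite -[coeff x D]intz -freegU_mulz !raddfMz /=.
by rewrite [simplicial_diff << x >>]zlinU face_sum_cancel mul0rz.
Qed.

Definition simplicial_chains : chain_complex :=
  @ChainComplex (fun n => {freeg (X n) / int})
    (fun n => @simplicial_diff n) simplicial_diffK.

End SimplicialChains.

Section StandardSimplex.
Variable R : realType.

Definition std_simplex (n : nat) : set 'rV[R]_n.+1 :=
  [set t | (forall i, 0 <= t 0 i) /\ \sum_i t 0 i = 1].
Arguments std_simplex : clear implicits.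

Definition simplex_push k n (f : delta_map k n) (t : 'rV[R]_k.+1) :
    'rV[R]_n.+1 :=
  \row_j \sum_(i | f i == j) t 0 i.

Lemma simplex_push_std k n (f : delta_map k n) (t : std_simplex k) :
  simplex_push f (val t) \in std_simplex n.
Proof.
have [t_ge0 t_sum] := set_mem (valP t); apply/mem_set; split=> [j|].
  by rewrite mxE sumr_ge0.
rewrite -[RHS]t_sum (partition_big f xpredT) //=.
by apply: eq_bigr => j _; rewrite mxE.
Qed.

Definition simplex_map k n (f : delta_map k n) (t : std_simplex k) :
    std_simplex n :=
  exist _ (simplex_push f (val t)) (simplex_push_std f t).

Lemma simplex_push_continuous k n (f : delta_map k n) :
  continuous (simplex_push f).
Proof.
have sum_cont j : continuous (fun u : 'rV[R]_k.+1 => \sum_(i | f i == j) u 0 i).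
  apply: (continuous_big (op := fun x y : R => x + y)) => [|i _].
    exact: add_continuous.
  exact: coord_continuous.
move=> t A [P tP sPA]; suff : \forall u \near t, forall i j,
    P i j (simplex_push f u i j).
  by apply: filterS => u Pu; apply: sPA.
apply: (filter_forall (F := nbhs t)
  (f := fun i u => forall j, P i j (simplex_push f u i j))) => i.
apply: (filter_forall (F := nbhs t)
  (f := fun j u => P i j (simplex_push f u i j))) => j.
have Pt : nbhs t [set u : 'rV[R]_k.+1 | P i j (\sum_(l | f l == j) u 0 l)].
  by have := tP i j; rewrite mxE => /(sum_cont j t).
by apply: (filterS _ Pt) => u; rewrite /= mxE.
Qed.

Lemma simplex_map_continuous k n (f : delta_map k n) :
  continuous (simplex_map f).
Proof.
apply: continuous_comp_initial => t.
have -> : set_val \o simplex_map f = simplex_push f \o (@set_val _ (std_simplex k)).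
  by apply/funext => u; rewrite /= !set_valE.
apply: continuous_comp; last exact: simplex_push_continuous.
exact: initial_continuous.
Qed.

HB.instance Definition _ k n (f : delta_map k n) :=
  @isContinuous.Build (std_simplex k) (std_simplex n) (simplex_map f)
    (@simplex_map_continuous k n f).

Lemma simplex_map_id n (t : std_simplex n) : simplex_map (delta_id n) t = t.
Proof.
apply/val_inj/rowP => j; rewrite /= mxE (bigD1 j) //= big1 ?addr0 //.
by move=> i /andP[/eqP-> /eqP].
Qed.

Lemma simplex_map_comp k l n (f : delta_map l n) (g : delta_map k l)
    (t : std_simplex k) :
  simplex_map (delta_comp f g) t = simplex_map f (simplex_map g t).
Proof.
apply/val_inj/rowP => j; rewrite /= !mxE.
rewrite (partition_big g (fun i => f i == j)) //=; apply: eq_bigr => i fi.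
rewrite mxE; apply: eq_bigl => a.
by case: (g a =P i) => [->|_]; rewrite ?fi ?andbF.
Qed.

End StandardSimplex.

Arguments std_simplex : clear implicits.

Section SingularSet.
Variables (R : realType) (Y : topologicalType).

Definition singular_simplex n : choiceType := continuousType (std_simplex R n) Y.

Definition singular_act k n (f : delta_map k n) (s : singular_simplex n) :
    singular_simplex k :=
  (s : continuousType _ _) \o simplex_map f.

Lemma singular_act_id n s : singular_act (delta_id n) s = s.
Proof. by apply/continuousEP => t /=; rewrite simplex_map_id. Qed.

Lemma singular_act_comp k l n (f : delta_map l n) (g : delta_map k l) s :
  singular_act (delta_comp f g) s = singular_act g (singular_act f s).
Proof. by apply/continuousEP => t /=; rewrite simplex_map_comp. Qed.

Definition singular_set : simplicial_set :=
  SimplicialSet singular_act_id singular_act_comp.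

Definition singular_complex : chain_complex := simplicial_chains singular_set.

End SingularSet.

Section GeometricRealization.
Variables (R : realType) (X : simplicial_set).

Definition realization_cells : topologicalType :=
  {n : nat & (discrete_topology (X n) * std_simplex R n)%type}.

Definition cell n (x : X n) (t : std_simplex R n) : realization_cells :=
  existT _ n (x, t).

Variant glue : realization_cells -> realization_cells -> Prop :=
  Glue k n (f : delta_map k n) (x : X n) (t : std_simplex R k) :
    glue (cell x (simplex_map f t)) (cell (sact f x) t).

Definition realization : topologicalType :=
  quotient_topology {eq_quot (equiv_closure glue)}.

End GeometricRealization.

Section Nerve.
Variable M : monoidType.
Local Open Scope group_scope.

(* An n-simplex is a chain of composable arrows x_0, ..., x_(n-1), where     *)
(* x_i goes from i to i+1; f^* x sends the arrow j -> j+1 to the composite   *)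
(* of the arrows from f j to f (j+1).                                        *)
Definition nerve_act k n (f : delta_map k n) (x : n.-tuple M) : k.-tuple M :=
  [tuple \prod_(f (inord j) <= i < f (inord j.+1)) nth 1 x i | j < k].

Lemma nerve_act_id n (x : n.-tuple M) : nerve_act (delta_id n) x = x.
Proof.
apply: eq_from_tnth => j; rewrite tnth_mktuple /= !inordK ?ltnS // 1?ltnW //.
by rewrite big_nat1 -tnth_nth.
Qed.

Lemma prod_telescope (h : nat -> nat) (F : nat -> M) a b :
  (a <= b)%N -> (forall l, (a <= l < b)%N -> (h l <= h l.+1)%N) ->
  \prod_(a <= l < b) \prod_(h l <= i < h l.+1) F i = \prod_(h a <= i < h b) F i.
Proof.
move=> /subnK <-; elim: (b - a)%N => [|d IHd] hh; first by rewrite !big_geq.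
have h_mono : (h a <= h (d + a))%N.
  elim: d hh {IHd} => // d IHd hh.
  have le_d : (h (d + a) <= h (d + a).+1)%N by apply: hh; lia.
  by apply: leq_trans le_d; apply: IHd => l ?; apply: hh; lia.
rewrite addSn big_nat_recr ?leq_addl //= IHd => [|l ?]; last by apply: hh; lia.
by rewrite -big_cat_nat //; apply: hh; lia.
Qed.

Lemma nerve_act_comp k l n (f : delta_map l n) (g : delta_map k l)
    (x : n.-tuple M) :
  nerve_act (delta_comp f g) x = nerve_act g (nerve_act f x).
Proof.
apply: eq_from_tnth => j; rewrite !tnth_mktuple /=.
have le_g : (g (inord j) <= g (inord j.+1))%N.
  by apply: delta_homo; rewrite !inordK ?ltnS // ltnW.
have nth_act i : (g (inord j) <= i < g (inord j.+1))%N ->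
    nth 1 (nerve_act f x) i =
    \prod_(f (inord i) <= i0 < f (inord i.+1)) nth 1 x i0.
  move=> /andP[_ lt_i]; have lt_il : (i < l)%N.
    by apply: leq_trans lt_i _; rewrite -ltnS.
  by rewrite -(tnth_nth 1 _ (Ordinal lt_il)) tnth_mktuple.
rewrite [RHS](eq_big_nat _ _ nth_act).
rewrite (prod_telescope (h := fun i => f (inord i))) ?inord_val // => i ?.
have ? := ltn_ord (g (inord j.+1)).
by apply: delta_homo; rewrite !inordK; lia.
Qed.

Definition nerve : simplicial_set :=
  @SimplicialSet (fun n => n.-tuple M) nerve_act nerve_act_id nerve_act_comp.

End Nerve.

Definition classifying_space (R : realType) (M : monoidType) : topologicalType :=
  realization R (nerve M).

Definition monoid_homology (R : realType) (M : monoidType) (n : nat) : zmodType :=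
  homology (singular_complex R (classifying_space R M)) n.

(* Main.v *)
(* Write M for the Artin monoid.                                              *)
(*                                                                            *)
(* Algebra: a family A of generators with a common right multiple has an lcm  *)
(* Delta_A in M, and such a multiple exists exactly when W(A) is finite.      *)
(* Cancellation, lcms and this criterion all come from the numbers game: a    *)
(* state is a function on S, firing s negates the value at s and adds to the  *)
(* value at t that value times 2 cos(pi / m_st).  The pairs (A, x) with x a   *)
(* common multiple of A, with the Koszul differential dropping elements of A, *)
(* form a complex contracted weight by weight (the weight being the length of *)
(* x); it is the graded part of a resolution of Z whose k-th term is M-free   *)
(* on the pairs (A, Delta_A), #|A| = k, so that its coinvariants C_k are free *)
(* on the k-element subsets of finite type.                                   *)
(*                                                                            *)
(* Topology: a point of BM is a configuration of particles on [0, 1] labelled *)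
(* in M.  As M has no invertible element, the configurations without particle *)
(* in an interval J_k form an open set V_k, and the V_k cover BM when J_k     *)
(* tends to 0.  On the intersection of V_(k_0), ..., V_(k_p) the product      *)
(* labels between successive intervals are locally constant, and the set      *)
(* where they take given values is contracted by moving all the particles     *)
(* lying between two intervals to a single point.  Comparing through the      *)
(* double complex of singular simplices subordinate to such intersections     *)
(* (small simplices suffice, by subdivision) identifies the singular homology *)
(* of BM with that of chains of levels k_0 >= ... >= k_p with labels in M;    *)
(* a second double complex compares the latter with C.                        *)

From HB Require Import structures.
Require Import Defs.
From Stdlib Require Import Relation_Operators.
From mathcomp Require Import all_boot all_order all_algebra.
From mathcomp Require Import all_classical reals topology normedtype sequences.
From mathcomp Require Import trigo wochoice finmap freeg zify ring lra.
Set Implicit Arguments.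
Unset Strict Implicit.
Unset Printing Implicit Defensive.
Import Order.TTheory GRing.Theory Num.Theory numFieldNormedType.Exports.
Local Open Scope classical_set_scope.
Local Open Scope quotient_scope.
Local Open Scope ring_scope.
(* [trigo] also exports a constant of this name. *)
Local Notation alternating := Defs.alternating.

(** The monoid M is left cancellative, and letters with a common right multiple have an lcm
    ([artin_garside_like]); a set A of letters has such a multiple exactly when it is of finite type
    ([has_multiple_finite_type]). These facts rest on the numbers game. A legal game from [ones]
    spells a reduced word, and its position determines that word up to braid moves ([matsumoto]).
    Comparing the longest legal prefixes of two words for one element reduces cancellation and the
    lcm of two letters in M to the case of legal words ([reduction_all]). A terminal position is a
    longest element of W, which links finiteness of W with common multiples.

    For fixed x, the finite sets A of letters dividing x form a full simplex, so the Koszul complex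
    on the pairs (A, x) is acyclic away from x = 1. Right multiplication on x makes it free over M
    on the pairs (A, lcm A), because lcm A divides x with a unique quotient. It does not resolve the
    trivial module Z: its homology in degree 0 only sees x = 1. [next_exists] corrects the
    differential by terms of smaller length, one degree at a time, into an exact equivariant one.
    [resolution_exists] is the outcome and [gen_complex] its coinvariants, with basis the sets A
    that have a common multiple.

    To reach the topological BM, both sides are compared with the chains of an auxiliary simplicial
    set, the [layered_nerve], whose vertices carry a level and whose edges between equal levels
    carry the label 1. Each comparison is an instance of [double_complex_iso]: the two augmentations
    of a double complex with exact rows and columns have isomorphic homology. On the algebraic side
    ([gen_complex_homology]) the double complex is the resolution tensored with layered chains. On
    the topological side ([classifying_space_homology]) it consists of singular simplices inside
    intersections of the open sets [avoid]. Exactness in the singular direction comes from an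
    explicit deformation, [squeezing], of such an intersection onto one point for each sequence of
    labels; barycentric subdivision ([small_onto]) shows that small simplices suffice. *)

Lemma inj_surj_bijective (T U : Type) (f : T -> U) :
  injective f -> (forall y, exists x, f x = y) -> bijective f.
Proof.
move=> f_inj f_surj; pose g y := sval (cid (f_surj y)).
have gK : cancel g f by move=> y; rewrite /g; case: cid.
by exists g => // x; apply: f_inj; rewrite gK.
Qed.

Section ZmodIso.

Lemma zmod_iso_sym (V W : zmodType) : zmod_iso V W -> zmod_iso W V.
Proof.
move=> [f [g fK gK]].
have gB : zmod_morphism g.
  by move=> x y; apply: (can_inj fK); rewrite raddfB !gK.
pose G : {additive W -> V} := HB.pack g (GRing.isZmodMorphism.Build W V g gB).
by exists G; exists f.
Qed.

Lemma zmod_iso_trans (U V W : zmodType) :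
  zmod_iso U V -> zmod_iso V W -> zmod_iso U W.
Proof. by move=> [f bf] [g bg]; exists (g \o f); exact: bij_comp. Qed.

End ZmodIso.

(** * Double complexes *)

Section HomologyCorrespondence.
Variables (A B : chain_complex) (n k : nat).
Variable r : cycles A n -> cycles B k -> Prop.
Hypothesis rB : forall x x' y y', r x y -> r x' y' -> r (x - x') (y - y').
Hypothesis r_total : forall x, exists y, r x y.
Hypothesis r_onto : forall y, exists x, r x y.
Hypothesis r_bound : forall x y, r x y ->
  (x \in @is_boundary A n) = (y \in @is_boundary B k).

(** The zigzag between two complexes is many-valued, so cycles are compared by an additive relation.
    Once it matches boundaries with boundaries, any choice of values descends to a bijective
    additive map on homology. *)
Lemma corr_homology_iso : zmod_iso (homology A n) (homology B k).
Proof.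
pose g x := sval (cid (r_total x)).
have rg x : r x (g x) by rewrite /g; case: cid.
pose f (h : homology A n) : homology B k :=
  \pi_(homology B k) (g (repr h)).
have fE x y : r x y -> f (\pi_(homology A n) x) = \pi_(homology B k) y.
  move=> rxy; apply/eqP; rewrite -Quotient.idealrBE.
  rewrite -(r_bound (rB (rg _) rxy)) Quotient.idealrBE.
  by rewrite reprK.
have fB : zmod_morphism f.
  move=> h h'; rewrite -[h]reprK -[h']reprK.
  rewrite (fE _ _ (rg _)) (fE _ _ (rg _)) -!raddfB.
  exact: (fE _ _ (rB (rg _) (rg _))).
pose F : {additive homology A n -> homology B k} :=
  HB.pack f (GRing.isZmodMorphism.Build _ _ f fB).
exists F; apply: inj_surj_bijective.
- move=> h h' /= ffh; apply/eqP; rewrite -[h]reprK -[h']reprK.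
  rewrite -Quotient.idealrBE (r_bound (rB (rg _) (rg _))).
  by rewrite Quotient.idealrBE; apply/eqP.
- move=> h /=; have [x rx] := r_onto (repr h).
  by exists (\pi_(homology A n) x); rewrite (fE _ _ rx) reprK.
Qed.

End HomologyCorrespondence.

(** The squares commute, without signs: the zigzag argument works in the array itself and never
    forms a total complex. *)
Record double_complex := DoubleComplex {
  dc_obj :> nat -> nat -> zmodType;
  dc_h : forall p q, {additive dc_obj p.+1 q -> dc_obj p q};
  dc_v : forall p q, {additive dc_obj p q.+1 -> dc_obj p q};
  dc_hh : forall p q x, dc_h p q (dc_h p.+1 q x) = 0;
  dc_vv : forall p q x, dc_v p q (dc_v p q.+1 x) = 0;
  dc_hv : forall p q x, dc_h p q (dc_v p.+1 q x) = dc_v p q (dc_h p q.+1 x)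
}.

Definition dc_transpose (D : double_complex) : double_complex :=
  @DoubleComplex (fun p q => D q p) (fun p q => dc_v D q p)
    (fun p q => dc_h D q p) (fun p q => @dc_vv D q p) (fun p q => @dc_hh D q p)
    (fun p q x => esym (@dc_hv D q p x)).

Record row_augmentation (D : double_complex) (A : chain_complex) := RowAug {
  aug :> forall q, {additive D 0 q -> A q};
  aug_h : forall q x, aug q (dc_h D 0 q x) = 0;
  aug_v : forall q x, aug q (dc_v D 0 q x) = chain_diff A q (aug q.+1 x)
}.

Record rows_exact D A (e : row_augmentation D A) : Prop := RowsExact {
  rows_exact0 : forall q x, e q x = 0 -> exists y, dc_h D 0 q y = x;
  rows_exactS : forall p q x, dc_h D p q x = 0 -> exists y, dc_h D p.+1 q y = x
}.

(* Surjectivity up to boundaries, relative to the image of the augmentation. *)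
Record aug_onto D A (e : row_augmentation D A) : Prop := AugOnto {
  aug_onto0 : forall a, exists b x, a = e 0 x + chain_diff A 0 b;
  aug_ontoS : forall q (a : A q.+1),
    (exists x, chain_diff A q a = e q x) ->
    exists b x, a = e q.+1 x + chain_diff A q.+1 b
}.

(* Tail recursion makes [tail_add p q.+1] convertible to [tail_add p.+1 q]. *)
Fixpoint tail_add (p q : nat) : nat :=
  if q is q'.+1 then tail_add p.+1 q' else p.

Lemma tail_addE p q : tail_add p q = (p + q)%N.
Proof. by elim: q p => [|q IHq] p /=; rewrite ?addn0 // IHq addSnnS. Qed.

Section Zigzag.
Variables (D : double_complex) (A B : chain_complex).
Variables (eA : row_augmentation D A)
          (eB : row_augmentation (dc_transpose D) B).

(** The staircase from D p q down to row 0: each stair lifts a vertical boundary through the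
    horizontal differential, and the last element is augmented into B. *)
Fixpoint zigzag q : forall p, D p q -> B (tail_add p q) -> Prop :=
  if q is q'.+1 return forall p, D p q -> B (tail_add p q) -> Prop
  then fun p x b => exists2 x' : D p.+1 q', dc_v D p q' x = dc_h D p q' x'
                                          & zigzag x' b
  else fun p x b => b = eB p x.

Lemma zigzagB q p (x x' : D p q) b b' :
  zigzag x b -> zigzag x' b' -> zigzag (x - x') (b - b').
Proof.
elim: q p x x' b b' => [|q IHq] p x x' b b' /=; first by move=> -> ->; rewrite raddfB.
move=> [y xy yb] [y' xy' yb']; exists (y - y'); last exact: IHq.
by rewrite !raddfB xy xy'.
Qed.

Hypothesis (exA : rows_exact eA) (ontoA : aug_onto eA).
Hypothesis exB : rows_exact eB.
Hypothesis ontoB : forall p b, exists x, eB p x = b.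

(** In column 0 the augmentation stands in for the horizontal differential. *)
Definition h_closed p q : D p q -> Prop :=
  if p is p'.+1 return D p q -> Prop then fun x => dc_h D p' q x = 0
  else fun x => eA q x = 0.

Lemma h_closed_ex p q (x : D p q) : h_closed x -> exists y, dc_h D p q y = x.
Proof. by case: p x => [|p] x; [exact: (rows_exact0 exA)|exact: (rows_exactS exA)]. Qed.

Lemma zigzag_ex q p (x : D p q) :
  (if q is q'.+1 return D p q -> Prop then fun x => h_closed (dc_v D p q' x)
   else fun=> True) x ->
  exists b, zigzag x b.
Proof.
elim: q p x => [|q IHq] p x /=; first by exists (eB p x).
move=> /h_closed_ex[x' xx']; have [|b x'b] := IHq p.+1 x'.
  by case: q IHq x' x xx' => [//|q] _ x' x xx' /=; rewrite dc_hv xx' dc_vv.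
by exists b, x'.
Qed.

Lemma zigzag_cycle q p (x : D p q) b :
  (if p is p'.+1 return D p q -> Prop
   then fun x => exists y, dc_h D p' q x = dc_v D p' q y else fun=> True) x ->
  zigzag x b -> b \in @is_cycle B (tail_add p q).
Proof.
elim: q p x b => [|q IHq] p x b /=.
  case: p x b => [//|p] x b [y xy] ->; rewrite unfold_in /=.
  by rewrite -(aug_v eB x) /= xy (aug_h eB).
by move=> _ [x' xx' x'b]; apply: IHq x'b; exists x.
Qed.

Lemma zigzag_onto q p (b : B (tail_add p q)) :
  b \in @is_cycle B (tail_add p q) -> exists2 x : D p q, zigzag x b &
  (if p is p'.+1 return D p q -> Prop then fun x =>
    (if q is q'.+1 return D p' q -> Prop then fun z => dc_v D p' q' z = 0
     else fun z => eB p' z = 0) (dc_h D p' q x)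
   else fun=> True) x.
Proof.
elim: q p b => [|q IHq] p b b_cycle.
  have [x xb] := ontoB b; exists x => //.
  case: p b b_cycle x xb => [//|p] b b_cycle x xb.
  by rewrite (aug_v eB x) xb; apply/eqP; exact: b_cycle.
have [x' x'b] := IHq p.+1 b b_cycle => x'_closed.
have [x xx'] : exists x, dc_v D p q x = dc_h D p q x'.
  case: q {IHq b b_cycle x'b} x' x'_closed => [|q] x'.
    exact: (rows_exact0 exB).
  exact: (rows_exactS exB).
exists x => /=; first by exists x'.
case: p b b_cycle x' x'b x'_closed x xx' => [//|p] b _ x' _ _ x xx' /=.
by rewrite -dc_hv xx' dc_hh.
Qed.

(** The primitive descends the staircase: if x minus the vertical boundary of y is the horizontal
    boundary of y', then x' minus the vertical boundary of y' is again closed. *)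
Lemma zigzag_boundary_r q p (x : D p q) (y : D p q.+1) b :
  h_closed (x - dc_v D p q y) -> zigzag x b ->
  exists c, chain_diff B (tail_add p q) c = b.
Proof.
elim: q p x y b => [|q IHq] p x y b /h_closed_ex[y' yy'] /=.
  move=> ->; exists (eB p.+1 y'); rewrite -(aug_v eB y') /= yy' raddfB.
  by rewrite (aug_h eB) subr0.
move=> [x' xx' x'b]; apply: (IHq _ x' y') x'b => /=.
by rewrite raddfB dc_hv yy' raddfB dc_vv subr0 xx' subrr.
Qed.

(** The converse climbs back: a primitive in B is lifted through the augmentation, and exactness of
    the columns raises it one stair at a time. *)
Lemma zigzag_boundary_l q p (x : D p q) c :
  zigzag x (chain_diff B (tail_add p q) c) ->
  exists y y', x = dc_v D p q y + dc_h D p q y'.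
Proof.
elim: q p x c => [|q IHq] p x c /=.
  have [y' <-] := ontoB c; rewrite -(aug_v eB y') /= => xy'.
  have [|y yx] := rows_exact0 exB (x := x - dc_h D p 0 y').
    by rewrite raddfB -xy' subrr.
  by exists y, y'; rewrite [dc_v _ _ _ _]yx subrK.
move=> [x' xx' /IHq[y1 [y1' x'E]]].
have [|y yx] := rows_exactS exB (x := x - dc_h D p q.+1 y1).
  by rewrite /= raddfB -dc_hv xx' x'E raddfD dc_hh addr0 subrr.
by exists y, y1; rewrite [dc_v _ _ _ _]yx subrK.
Qed.

Lemma cycle_valB (C : chain_complex) k (x y : cycles C k) :
  cycle_val (x - y) = cycle_val x - cycle_val y.
Proof. exact: (raddfB (val : cycles C k -> C k)). Qed.

Theorem double_complex_iso n : zmod_iso (homology A n) (homology B n).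
Proof.
suff : zmod_iso (homology A n) (homology B (tail_add 0 n)) by rewrite tail_addE.
(* A cycle of A is only required to come from the edge p = 0 up to a boundary, which is all that
   [aug_onto] grants. *)
pose r (a : cycles A n) (b : cycles B (tail_add 0 n)) := exists x c,
  cycle_val a = eA n x + chain_diff A n c /\ zigzag x (cycle_val b).
apply: (@corr_homology_iso _ _ _ _ r).
- move=> a a' b b' [x [c [ax xb]]] [x' [c' [ax' xb']]].
  exists (x - x'), (c - c'); split; last by rewrite cycle_valB; exact: zigzagB.
  by rewrite cycle_valB !raddfB ax ax' /= opprD addrACA.
- move=> a; have [c [x ax]] : exists c x, cycle_val a = eA n x + chain_diff A n c.
    case: n r a => [|k] _ a; first exact: (aug_onto0 ontoA).
    by apply: (aug_ontoS ontoA); exists 0; rewrite raddf0; apply/eqP; exact: (valP a).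
  have [|b xb] := @zigzag_ex n 0 x.
    case: n r a c x ax => [//|k] _ a c x ax /=; rewrite aug_v.
    have := valP a; rewrite unfold_in /= => /eqP; rewrite ax raddfD chain_diffK.
    by rewrite addr0.
  have bZ : b \in @is_cycle B (tail_add 0 n) by apply: zigzag_cycle xb.
  by exists (Cycle bZ), x, c.
- move=> b; have [x xb _] := zigzag_onto (valP b).
  have aZ : eA n x \in @is_cycle A n.
    case: n r b x xb => [//|k] _ b x /= [x' xx' _]; rewrite unfold_in /=.
    by rewrite -aug_v xx' aug_h.
  by exists (Cycle aZ), x, 0; split=> //=; rewrite raddf0 addr0.
- move=> a b [x [c [ax xb]]]; apply/asboolP/asboolP => -[d /= dE].
    have [e [y yE]] : exists e y, d - c = eA n.+1 y + chain_diff A n.+1 e.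
      apply: (aug_ontoS ontoA); exists x.
      by rewrite raddfB dE ax addrK.
    apply: (zigzag_boundary_r (y := y)) xb => /=.
    have := congr1 (chain_diff A n) yE.
    by rewrite raddfB raddfD chain_diffK addr0 raddfB aug_v dE ax addrK => ->; rewrite subrr.
  move: xb; rewrite -dE => /zigzag_boundary_l[y [y' xE]].
  exists (eA n.+1 y + c); rewrite /= ax xE !raddfD aug_h addr0.
  by rewrite -aug_v.
Qed.

End Zigzag.

(** * The numbers game *)

Section SineQuotients.
Variable R : realType.

(* [sinq q k] is [sin (k a) / sin a] when [q = 2 cos a]. *)
Fixpoint sinq (q : R) (k : nat) : R :=
  match k with
  | 0 => 0
  | 1 => 1
  | (k'.+1 as k1).+1 => q * sinq q k1 - sinq q k'
  end.

Lemma sinq0 q : sinq q 0 = 0. Proof. by []. Qed.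

Lemma sinq1 q : sinq q 1 = 1. Proof. by []. Qed.

Lemma sinqS q k : sinq q k.+2 = q * sinq q k.+1 - sinq q k.
Proof. by []. Qed.

(** The limit a = 0, which is the case of an infinite matrix entry. *)
Lemma sinq2E k : sinq 2 k = k%:R.
Proof.
suff: sinq 2 k = k%:R /\ sinq 2 k.+1 = k.+1%:R by case.
elim: k => [|k [IH1 IH2]]; first by [].
split=> //; rewrite sinqS IH1 IH2 -!natr1; ring.
Qed.

Definition coxeter_cos (n : option nat) : R :=
  if n is Some n' then 2 * cos (pi / n'%:R) else 2.

Lemma sinq_sin a k : sin a * sinq (2 * cos a) k = sin (k%:R * a).
Proof.
suff: sin a * sinq (2 * cos a) k = sin (k%:R * a) /\
  sin a * sinq (2 * cos a) k.+1 = sin (k.+1%:R * a) by case.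
elim: k => [|k [IH1 IH2]]; first by rewrite mulr0 mul0r sin0 mulr1 mul1r.
split=> //; rewrite sinqS mulrBr IH1 mulrCA IH2.
have -> : k.+2%:R * a = k.+1%:R * a + a by rewrite -[k.+2%:R]natr1; ring.
have -> : k%:R * a = k.+1%:R * a - a by rewrite -[k.+1%:R]natr1; ring.
rewrite sinB sinD; ring.
Qed.

Lemma sin_coxeter n k : (0 < k < n)%N -> 0 < sin (k%:R * (pi / n%:R) : R).
Proof.
move=> /andP[k0 kn]; have n0 : 0 < n%:R :> R by rewrite ltr0n; lia.
apply: sin_gt0_pi; apply/andP; split.
  by rewrite mulr_gt0 ?divr_gt0 ?pi_gt0 // ltr0n.
by rewrite mulrCA gtr_pMr ?pi_gt0 // ltr_pdivrMr // mul1r ltr_nat.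
Qed.

Lemma sinq_gt0 (o : option nat) k : (0 < k)%N ->
  (if o is Some n then (1 < n) && (k < n) else true)%N ->
  0 < sinq (coxeter_cos o) k.
Proof.
case: o => [n|] k0 /=; last by rewrite sinq2E ltr0n.
move=> /andP[n1 kn]; have s0 : 0 < sin (pi / n%:R : R).
  by rewrite -[X in sin X]mul1r; apply: (@sin_coxeter n 1); lia.
by rewrite -(pmulr_rgt0 _ s0) sinq_sin sin_coxeter // k0.
Qed.

Lemma sinq_eq0 n : (1 < n)%N -> sinq (coxeter_cos (Some n)) n = 0.
Proof.
move=> n1; have s0 : 0 < sin (pi / n%:R : R).
  by rewrite -[X in sin X]mul1r; apply: (@sin_coxeter n 1); lia.
apply/eqP; have := sinq_sin (pi / n%:R) n.
rewrite [n%:R * _]mulrC divfK ?pnatr_eq0; last by lia.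
by rewrite sinpi => /eqP; rewrite mulf_eq0 gt_eqF.
Qed.

End SineQuotients.
Arguments sinq : simpl never.

(** * Words up to braid moves *)

Section ArtinWords.
Variables (S : choiceType) (m : coxeter_matrix S).
Local Notation M := (artin_monoid m).
Implicit Types (u v w : seq S) (s t : S).

Definition acls w : M := \pi_(pres_monoid (braid_relation m)) w.

Lemma acls_cat u v : acls (u ++ v) = (acls u * acls v)%g.
Proof. exact: pres_pi_cat. Qed.

Lemma acls_cat_congr u u' v v' :
  acls u = acls u' -> acls v = acls v' -> acls (u ++ v) = acls (u' ++ v').
Proof. by rewrite !acls_cat => -> ->. Qed.

Lemma acls_catr u v v' : acls v = acls v' -> acls (u ++ v) = acls (u ++ v').
Proof. exact: acls_cat_congr. Qed.

Lemma acls_catl u u' v : acls u = acls u' -> acls (u ++ v) = acls (u' ++ v).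
Proof. by move=> uu'; exact: acls_cat_congr. Qed.

Lemma acls_repr (x : M) : acls (repr x) = x.
Proof. exact: reprK. Qed.

Lemma acls_alternating s t n : s <> t -> m s t = Some n ->
  acls (alternating s t n) = acls (alternating t s n).
Proof. by move=> st mst; apply: pres_relE; exact: BraidRelation. Qed.

(* Braid moves being reversible, it is enough to check invariance one way. *)
Lemma acls_ind (P : seq S -> Prop) :
  (forall u v s t n, s <> t -> m s t = Some n ->
     P (u ++ alternating s t n ++ v) -> P (u ++ alternating t s n ++ v)) ->
  forall u v, acls u = acls v -> P u -> P v.
Proof.
move=> step u v /pres_eqP uv; suff : P u <-> P v by case.
elim: uv => {u v} [_ _ [u v _ _ [s t n st mst]]|//|u v _ [] //|u v w _ uv _ vw].
  split; first exact: step.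
  by apply: step => [/esym//|]; rewrite cox_sym.
by rewrite uv.
Qed.

Lemma size_alternating s t n : size (alternating s t n : seq S) = n.
Proof. by elim: n s t => //= n IHn s t; rewrite IHn. Qed.

Lemma acls_size u v : acls u = acls v -> size u = size v.
Proof.
move=> uv; apply/esym; apply: (acls_ind (P := fun w => size w = size u)) uv _ => //.
by move=> {v} v w s t n _ _; rewrite !size_cat !size_alternating.
Qed.

Lemma alternating_rcons s t n :
  rcons (alternating s t n) (if odd n then t else s) = alternating s t n.+1.
Proof.
by elim: n s t => //= n IHn s t; rewrite -(IHn t s); case: (odd n).
Qed.

Lemma alternating_cat s t j l : alternating s t (j + l) =
  alternating s t j ++ (if odd j then alternating t s l else alternating s t l).
Proof. by elim: j s t => //= j IHj s t; rewrite IHj if_neg. Qed.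

Lemma rev_alternating s t n : rev (alternating s t n) =
  if odd n then alternating s t n else alternating t s n.
Proof.
elim: n s t => // n IHn s t; rewrite /= rev_cons IHn.
case: (boolP (odd n)) => nn /=; last first.
  by have := alternating_rcons s t n; rewrite (negbTE nn).
by have := alternating_rcons t s n; rewrite nn.
Qed.

Lemma acls_rev u v : acls u = acls v -> acls (rev u) = acls (rev v).
Proof.
move=> uv; apply/esym.
apply: (acls_ind (P := fun w => acls (rev w) = acls (rev u))) uv _ => //.
move=> {v} v w s t n st mst <-; rewrite !rev_cat; apply: acls_catl.
apply: acls_catr; rewrite !rev_alternating.
by have e := acls_alternating st mst; case: odd.
Qed.

(** Each side of a braid relation has at least two letters, so both of its letters occur on both
    sides. *)
Lemma acls_all (J : pred S) u v : acls u = acls v -> all J u = all J v.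
Proof.
move=> uv; apply/esym; apply: (acls_ind (P := fun w => all J w = all J u)) uv _ => //.
move=> {v} v w s t n st mst <-; rewrite !all_cat; congr (_ && (_ && _)).
have n_ge2 := cox_offdiag st mst; case: n mst n_ge2 => [|[|n]] // mst _.
suff altE x y : all J (alternating x y n.+2) = J x && J y.
  by rewrite !altE andbC.
elim: n x y {mst} => [|n IHn] x y; first by rewrite /= andbT.
have -> : alternating x y n.+3 = x :: alternating y x n.+2 by [].
have -> : all J (x :: alternating y x n.+2) = J x && all J (alternating y x n.+2) by [].
by rewrite IHn; case: (J x) (J y) => -[].
Qed.

End ArtinWords.

(** * Reduced words through the numbers game *)

Section NumbersGame.
Variables (R : realType) (S : choiceType) (m : coxeter_matrix S).
Local Notation M := (artin_monoid m).
Local Notation acls := (acls m).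
Implicit Types (u v w : seq S) (s t : S) (f : S -> R).

(* The diagonal entry 1 gives 2 cos pi = -2, so the value at [s] changes sign. *)
Definition fire s f : S -> R := fun t => f t + coxeter_cos R (m s t) * f s.

Lemma fire_self s f : fire s f s = - f s.
Proof. by rewrite /fire cox_diag /= divr1 cospi; ring. Qed.

Lemma fireK s : involutive (fire s).
Proof.
move=> f; apply/funext => t; rewrite {1}/fire fire_self /fire; ring.
Qed.

Fixpoint play f w : S -> R := if w is s :: w' then play (fire s f) w' else f.

Lemma play_cat f u v : play f (u ++ v) = play (play f u) v.
Proof. by elim: u f => //= s u IHu f. Qed.

Lemma play_rcons f u s : play f (rcons u s) = fire s (play f u).
Proof. by rewrite -cats1 play_cat. Qed.

(** Only positive values may be fired. For games started at [ones] the legal words are the reduced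
    words of the Coxeter group. *)
Fixpoint legal f w : bool :=
  if w is s :: w' then (0 < f s) && legal (fire s f) w' else true.

Lemma legal_cat f u v : legal f (u ++ v) = legal f u && legal (play f u) v.
Proof. by elim: u f => //= s u IHu f; rewrite IHu andbA. Qed.

Lemma legal_rcons f u s : legal f (rcons u s) = legal f u && (0 < play f u s).
Proof. by rewrite -cats1 legal_cat /= andbT. Qed.

(** In an alternating game the j-th fired value is a combination of f s and f t with two consecutive
    sine quotients as coefficients, as for the roots of a dihedral group. *)
Lemma play_alternating s t k f r :
  let q := coxeter_cos R (m s t) in
  play f (alternating s t k) r = f r + \sum_(j < k)
    coxeter_cos R (m (if odd j then t else s) r) *
      (sinq q j.+1 * f s + sinq q j * f t).
Proof.
elim: k s t f => [|k IHk] s t f q /=; first by rewrite big_ord0 addr0.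
rewrite IHk big_ord_recl /= sinq1 sinq0 mul1r mul0r addr0 addrA.
rewrite {1}/fire; congr (_ + _).
rewrite (cox_sym m t s) -/q; apply: eq_bigr => j _; rewrite /= add0n if_neg.
by rewrite sinqS fire_self /fire -/q; ring.
Qed.

Lemma play_alternating_next s t k f :
  let q := coxeter_cos R (m s t) in
  play f (alternating s t k) (if odd k then t else s) =
    sinq q k.+1 * f s + sinq q k * f t.
Proof.
elim: k s t f => [|k IHk] s t f q /=; first by rewrite sinq1 sinq0 mul1r mul0r addr0.
rewrite if_neg IHk (cox_sym m t s) -/q fire_self /fire -/q.
by rewrite sinqS; ring.
Qed.

Lemma legal_alternating s t k f :
  (forall j, (j < k)%N -> 0 < sinq (coxeter_cos R (m s t)) j.+1 * f s +
                              sinq (coxeter_cos R (m s t)) j * f t) ->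
  legal f (alternating s t k).
Proof.
elim: k s t f => //= k IHk s t f pos; apply/andP; split.
  by have := pos 0%N isT; rewrite sinq1 sinq0 mul1r mul0r addr0.
apply: IHk => j jk; have := pos j.+1; rewrite ltnS => /(_ jk).
by rewrite (cox_sym m t s) fire_self /fire sinqS; lra.
Qed.

Lemma play_polygon s t n f : s <> t -> m s t = Some n ->
  play f (alternating s t n) = play f (alternating t s n).
Proof.
move=> st mst; apply/funext => r; rewrite !play_alternating (cox_sym m t s).
set U := sinq _; congr (_ + _).
pose Q j := coxeter_cos R (m (if odd j then t else s) r).
(* The two closed forms are compared term by term; the discrepancy after k terms is a multiple of
   [U k], which vanishes at k = n. *)
have diff k : \sum_(j < k) Q j * (U j.+1 * f s + U j * f t) =
    \sum_(j < k) Q j.+1 * (U j.+1 * f t + U j * f s) +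
    U k * (Q k.+1 * f s - Q k * f t).
  elim: k => [|k IHk]; first by rewrite !big_ord0 /U sinq0 mul0r addr0.
  rewrite !big_ord_recr /= IHk; have -> : Q k.+2 = Q k by rewrite /Q /= negbK.
  ring.
have Un : U n = 0 by rewrite /U mst sinq_eq0 ?(cox_offdiag st mst).
have := diff n; rewrite Un mul0r addr0.
by rewrite /Q /= => ->; apply: eq_bigr => j _; rewrite if_neg.
Qed.

Definition braid_bounded s t k := if m s t is Some n then (k <= n)%N else true.

Lemma alternating_value_gt0 s t k f : s <> t -> 0 < f s -> 0 < f t ->
  braid_bounded s t k.+1 ->
  0 < sinq (coxeter_cos R (m s t)) k.+1 * f s +
      sinq (coxeter_cos R (m s t)) k * f t.
Proof.
move=> st fs ft; rewrite /braid_bounded; case mst: (m s t) => [n|] kn; last first.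
  apply: ltr_wpDr; last by apply: mulr_gt0 => //; exact: sinq_gt0.
  apply: mulr_ge0; last exact: ltW.
  by case: k {kn} => [|k]; [rewrite sinq0|apply/ltW/sinq_gt0].
have n2 := cox_offdiag st mst.
have Uk : 0 <= sinq (coxeter_cos R (Some n)) k.
  case: k kn => [|k] kn; first by rewrite sinq0.
  by apply/ltW/sinq_gt0 => //; rewrite n2.
move: kn; rewrite leq_eqVlt => /predU1P[kn|kn].
  rewrite kn sinq_eq0 // mul0r add0r; apply: mulr_gt0 => //.
  by apply: sinq_gt0; [lia|rewrite n2 -kn /=].
apply: ltr_wpDr; first by apply: mulr_ge0 => //; exact: ltW.
by apply: mulr_gt0 => //; apply: sinq_gt0 => //; rewrite n2.
Qed.

(** The first m fired values are positive; the next one would be a negative multiple of f s. *)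
Lemma legal_alternatingE s t k f : s <> t -> 0 < f s -> 0 < f t ->
  legal f (alternating s t k) = braid_bounded s t k.
Proof.
move=> st fs ft; apply/idP/idP => [lk|kn]; last first.
  apply: legal_alternating => j jk; apply: alternating_value_gt0 => //.
  by move: kn; rewrite /braid_bounded; case: (m s t) => // n; apply: leq_trans.
rewrite /braid_bounded; case mst: (m s t) => [n|//]; rewrite leqNgt; apply/negP.
move=> nk; have n2 := cox_offdiag st mst.
move: lk; rewrite -(subnKC nk) alternating_cat legal_cat => /andP[+ _].
rewrite -alternating_rcons legal_rcons play_alternating_next => /andP[_].
rewrite mst sinq_eq0 // mul0r addr0; case: n {nk} n2 mst => [|n] // n2 mst.
rewrite sinqS sinq_eq0 // mulr0 sub0r.
have := sinq_gt0 R (o := Some n.+1) (k := n); rewrite n2 ltnSn -ltnS => /(_ n2 isT).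
by move=> U0; rewrite mulNr oppr_gt0 ltNge ltW // mulr_gt0.
Qed.

Lemma play_alternating_next_gt0 s t k f : s <> t -> 0 < f s -> 0 < f t ->
  braid_bounded s t k.+1 ->
  0 < play f (alternating s t k) (if odd k then t else s).
Proof. by move=> *; rewrite play_alternating_next alternating_value_gt0. Qed.

Lemma legal_polygon s t n f : s <> t -> m s t = Some n ->
  legal f (alternating s t n) -> legal f (alternating t s n).
Proof.
move=> st mst; have n2 := cox_offdiag st mst => lst.
have [fs ft] : 0 < f s /\ 0 < f t.
  case: n n2 mst lst => [//|n] n2 mst lst; split; first by case/andP: lst.
  move: lst; rewrite -alternating_rcons legal_rcons play_alternating_next mst.
  rewrite sinq_eq0 // mul0r add0r => /andP[_]; rewrite pmulr_rgt0 //.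
  by rewrite sinq_gt0 ?n2 /=; lia.
by rewrite legal_alternatingE //; [rewrite /braid_bounded cox_sym mst|exact/nesym].
Qed.

Lemma play_acls f u v : acls u = acls v -> play f u = play f v.
Proof.
move=> uv; apply/esym; apply: (acls_ind (P := fun w => play f w = play f u)) uv _ => //.
by move=> {v} v w s t n st mst; rewrite !play_cat (play_polygon _ st mst).
Qed.

Lemma legal_acls f u v : acls u = acls v -> legal f u = legal f v.
Proof.
move=> uv; suff half u' v' : acls u' = acls v' -> legal f u' -> legal f v'.
  by apply/idP/idP; apply: half.
apply: (acls_ind (P := fun w => legal f w)) => {u v uv u' v'} u v s t n st mst.
rewrite !legal_cat => /and3P[-> + +] /=.
by rewrite (play_polygon _ st mst) => /(legal_polygon st mst) -> ->.
Qed.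

Definition ones : S -> R := fun=> 1.

Lemma legal_descent_lt0 u s : legal ones (rcons u s) -> play ones (rcons u s) s < 0.
Proof. by rewrite legal_rcons play_rcons fire_self oppr_lt0 => /andP[_]. Qed.

(* A position is reached from one with nothing to retract at [s] and [t] by *)
(* firing [s] and [t] alternately. *)
Definition descends u s t := exists p k x y,
  [/\ acls u = acls (p ++ alternating x y k), legal ones p,
      0 < play ones p x, 0 < play ones p y &
      (x = s /\ y = t) \/ (x = t /\ y = s)].

(** The letter z either continues the alternation or repeats its last letter. In the second case its
    value has just become negative and it cannot be fired, unless the alternation is empty. *)
Lemma descends_rcons u s t z : s <> t -> z = s \/ z = t ->
  legal ones (rcons u z) -> descends u s t -> descends (rcons u z) s t.
Proof.
move=> st zst luz [p [k [x [y [uE lp px py xyE]]]]].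
have zxy : z = x \/ z = y by case: zst xyE => -> [] [-> ->]; tauto.
have xy : x <> y by case: xyE => -[-> ->] //; apply/nesym.
have [zE|zE] : z = (if odd k then y else x) \/ z = (if odd k then x else y).
  by case: zxy => ->; case: odd; auto.
  exists p, k.+1, x, y; split=> //.
  rewrite -cats1 -alternating_rcons -zE -[rcons (alternating _ _ _) _]cats1 catA.
  exact: acls_catl.
case: k uE zE => [|k] uE zE.
  exists p, 1%N, y, x; split=> //; last by case: xyE => -[-> ->]; auto.
  by rewrite -cats1 zE; apply: acls_catl; rewrite uE cats0.
have zE' : z = if odd k then y else x by rewrite zE /=; case: odd.
move: luz; rewrite legal_rcons (play_acls _ uE) -alternating_rcons -rcons_cat.
rewrite -zE' play_rcons fire_self => /andP[+ zpos].
rewrite (legal_acls _ uE) -alternating_rcons -rcons_cat -zE' legal_rcons.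
by move=> /andP[_]; rewrite ltNge -oppr_ge0 ltW.
Qed.

Lemma descends_bounded u p k x y : legal ones u -> x <> y ->
  0 < play ones p x -> 0 < play ones p y ->
  acls u = acls (p ++ alternating x y k) -> braid_bounded x y k.
Proof.
move=> lu xy px py uE; move: lu; rewrite (legal_acls _ uE) legal_cat => /andP[_].
by rewrite legal_alternatingE.
Qed.

(** The exchange condition and the decomposition along rank-two parabolic subgroups, which feed each
    other. The value at s fails to be positive only if the dihedral tail of the word ends in s, or
    is a whole polygon and can be rewritten to end in s; stripping such letters in turn exposes the
    dihedral tail. *)
Lemma game_structure n u : (size u <= n)%N -> legal ones u ->
  (forall s, 0 < play ones u s \/ exists u', acls u = acls (rcons u' s)) /\
  (forall s t, s <> t -> descends u s t).
Proof.
elim: n u => [|n IHn] u un lu.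
  move: un; rewrite leqn0 size_eq0 => /eqP ->; split=> [s|s t st].
    by left; exact: ltr01.
  by exists [::], 0%N, s, t; split; rewrite ?cats0 ?ltr01 //=; auto.
have dich s : 0 < play ones u s \/ exists u', acls u = acls (rcons u' s).
  case/lastP: u un lu => [_ _|u t]; first by left; exact: ltr01.
  rewrite size_rcons ltnS => un lut.
  have lu : legal ones u by move: lut; rewrite legal_rcons => /andP[].
  have [<-|ts] := pselect (t = s); first by right; exists u.
  have [] := descends_rcons ts (or_introl erefl) lut ((IHn u un lu).2 t s ts).
  move=> p [k [x [y [uE lp px py xyE]]]].
  have xy : x <> y by case: xyE => -[-> ->] //; apply/nesym.
  have kn := descends_bounded lut xy px py uE.
  have sxy : s = x \/ s = y by case: xyE => -[-> ->]; auto.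
  case: k uE kn => [|k] uE kn.
    by left; rewrite (play_acls _ uE) cats0; case: sxy => ->.
  have uE' : acls (rcons u t) =
      acls (rcons (p ++ alternating x y k) (if odd k then y else x)).
    by rewrite uE -alternating_rcons -rcons_cat.
  have [sE|sE] : s = (if odd k then y else x) \/ s = (if odd k then x else y).
    by case: sxy => ->; case: odd; auto.
    by right; eexists; rewrite sE; exact: uE'.
  have [kn2|kn2] := boolP (braid_bounded x y k.+2).
    left; rewrite (play_acls _ uE) play_cat.
    have := play_alternating_next_gt0 xy px py kn2.
    by rewrite [odd k.+1]/=; rewrite if_neg -sE.
  right; exists (p ++ alternating y x k).
  have mxy : m x y = Some k.+1.
    move: kn kn2; rewrite /braid_bounded; case: (m x y) => // n' h1 h2.
    by congr Some; apply/eqP; rewrite eqn_leq h1 leqNgt h2.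
  rewrite uE rcons_cat sE alternating_rcons.
  exact/acls_catr/acls_alternating.
split=> // s t st.
have wlog_neg z : z = s \/ z = t -> 0 < play ones u z \/ descends u s t.
  move=> zst; have [|[u' uE]] := dich z; [by left|right].
  have lu' : legal ones (rcons u' z) by rewrite -(legal_acls _ uE).
  have u'n : (size u' <= n)%N.
    by rewrite -ltnS -(size_rcons u' z) -(acls_size uE).
  have lu1 : legal ones u' by move: lu'; rewrite legal_rcons => /andP[].
  have := descends_rcons st zst lu' ((IHn u' u'n lu1).2 s t st).
  by move=> [p [k [x [y [u'E *]]]]]; exists p, k, x, y; split; rewrite // uE.
have [||//] := wlog_neg s; first by left.
move=> us; have [||//] := wlog_neg t; first by right.
by move=> ut; exists u, 0%N, s, t; split; rewrite ?cats0 //; left.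
Qed.

Lemma dichotomy u s : legal ones u ->
  0 < play ones u s \/ exists u', acls u = acls (rcons u' s).
Proof. by move=> lu; exact: (game_structure (leqnn _) lu).1. Qed.

Lemma descendsP u s t : legal ones u -> s <> t -> descends u s t.
Proof. by move=> lu; exact: (game_structure (leqnn _) lu).2. Qed.

(* Once both [s] and [t] can be retracted, the whole polygon can be. *)
Lemma polygon_suffix u s t : legal ones u -> s <> t ->
  play ones u s < 0 -> play ones u t < 0 ->
  exists n p, m s t = Some n /\ acls u = acls (p ++ alternating s t n).
Proof.
move=> lu st us ut; have [p [k [x [y [uE lp px py xyE]]]]] := descendsP lu st.
have xy : x <> y by case: xyE => -[-> ->] //; apply/nesym.
have kn := descends_bounded lu xy px py uE.
have kn1 : ~~ braid_bounded x y k.+1.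
  apply/negP => /(play_alternating_next_gt0 xy px py).
  rewrite -play_cat -(play_acls _ uE); by case: xyE => -[-> ->]; case: odd; rewrite ltNge ltW.
have mxy : m x y = Some k.
  move: kn kn1; rewrite /braid_bounded; case: (m x y) => // n' h1 h2.
  by congr Some; apply/eqP; rewrite eqn_leq h1 leqNgt h2.
exists k, p; case: xyE => -[xE yE]; rewrite -?xE -?yE; split=> //.
  by rewrite cox_sym.
by rewrite uE; exact/acls_catr/acls_alternating.
Qed.

Lemma fire_inj s : injective (fire s).
Proof. exact: inv_inj (fireK s). Qed.

Lemma legal_rconsW f u s : legal f (rcons u s) -> legal f u.
Proof. by rewrite legal_rcons => /andP[]. Qed.

(** If the last letters s and t differ, the common position is negative at both, so the first word
    ends in the polygon of s and t and can be rewritten to end in t. Firing is injective, so t can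
    then be removed from both words. *)
Theorem matsumoto u v : legal ones u -> legal ones v ->
  play ones u = play ones v -> acls u = acls v.
Proof.
elim: {u}(size u).+1 {-2}u (ltnSn (size u)) v => // n IHn u un v lu lv uv.
have nil_rcons w s : legal ones (rcons w s) -> play ones (rcons w s) <> ones.
  by move=> /legal_descent_lt0 /[swap] ->; rewrite ltNge ler01.
case/lastP: u un lu uv => [|u s] un lu uv.
  by case/lastP: v lv uv => // v t lv /esym /nil_rcons - /(_ lv).
case/lastP: v lv uv => [lv /nil_rcons|v t lv uv]; first by move=> /(_ lu).
move: un; rewrite size_rcons !ltnS => un.
have [lu' lv'] := (legal_rconsW lu, legal_rconsW lv).
have IH z w w' : (size w < n)%N -> legal ones (rcons w z) ->
    legal ones (rcons w' z) -> play ones (rcons w z) = play ones (rcons w' z) ->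
    acls (rcons w z) = acls (rcons w' z).
  move=> wn lw lw'; rewrite !play_rcons => /fire_inj ww'.
  by rewrite -!cats1; apply/acls_catl/IHn => //;
    [exact: legal_rconsW lw|exact: legal_rconsW lw'].
have [st|st] := pselect (s = t); first by rewrite -st in lv uv *; exact: IH.
have us := legal_descent_lt0 lu; have := legal_descent_lt0 lv.
rewrite -uv => vt; have [k [p [mst uE]]] := polygon_suffix lu st us vt.
have [w uw] : exists w, acls (rcons u s) = acls (rcons w t).
  case: k mst uE => [|k] mst uE; first by have := cox_offdiag st mst.
  have [k_odd|k_even] := boolP (odd k).
    exists (p ++ alternating s t k); rewrite uE rcons_cat.
    by rewrite -(alternating_rcons s t k) k_odd.
  exists (p ++ alternating t s k); rewrite uE rcons_cat.
  rewrite (acls_catr p (acls_alternating st mst)).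
  by rewrite -(alternating_rcons t s k) (negbTE k_even).
rewrite uw; apply: IH; rewrite -?(legal_acls _ uw) -?(play_acls _ uw) //.
by have := acls_size uw; rewrite !size_rcons => -[<-].
Qed.

Lemma legal_square f u s v : ~~ legal f (u ++ [:: s; s] ++ v).
Proof.
rewrite legal_cat /= fire_self oppr_gt0; apply/negP => /and4P[_ s1 s2 _].
by rewrite ltNge ltW in s1.
Qed.

Lemma illegal_square w : ~~ legal ones w ->
  exists u s v, acls w = acls (u ++ [:: s; s] ++ v).
Proof.
elim/last_ind: w => // w s IHw; rewrite legal_rcons negb_and.
have [lw /=|nlw _] := boolP (legal ones w); last first.
  have [u [t [v wE]]] := IHw nlw; exists u, t, (rcons v s).
  by rewrite -!cats1 (acls_catl _ wE) -!catA.
have [-> //|[u wE] _] := dichotomy s lw.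
by exists u, s, [::]; rewrite -cats1 (acls_catl _ wE) cats1 -!cats1 -catA.
Qed.

(** A word is legal exactly when no braid-equivalent word contains a square, a condition symmetric
    under reversal. *)
Lemma legal_rev w : legal ones (rev w) = legal ones w.
Proof.
suff half u : legal ones u -> legal ones (rev u).
  by apply/idP/idP => /half; rewrite ?revK.
move=> lu; apply: contraT => /illegal_square[x [s [y]]] /acls_rev.
rewrite revK !rev_cat -catA => uE; have := legal_square ones (rev y) s (rev x).
by rewrite -(legal_acls _ uE) lu.
Qed.

Lemma legal_cancel s u v : legal ones (s :: u) -> legal ones (s :: v) ->
  acls (s :: u) = acls (s :: v) -> acls u = acls v.
Proof.
move=> lu lv /acls_rev uv; rewrite -[u]revK -[v]revK; apply: acls_rev.
move: lu lv uv; rewrite -(legal_rev (s :: u)) -(legal_rev (s :: v)) !rev_cons.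
move=> lu lv /(play_acls ones); rewrite !play_rcons => /fire_inj uv.
by apply: matsumoto => //; [exact: legal_rconsW lu|exact: legal_rconsW lv].
Qed.

(** The mirror image of [polygon_suffix], through [legal_rev]. *)
Lemma legal_polygon_prefix s t u v : s <> t ->
  legal ones (s :: u) -> legal ones (t :: v) -> acls (s :: u) = acls (t :: v) ->
  exists k z, m s t = Some k.+1 /\ acls u = acls (alternating t s k ++ z) /\
              acls v = acls (alternating s t k ++ z).
Proof.
move=> st lu lv uv.
have lru : legal ones (rcons (rev u) s) by rewrite -rev_cons legal_rev.
have lrv : legal ones (rcons (rev v) t) by rewrite -rev_cons legal_rev.
have ruv := acls_rev uv; rewrite !rev_cons in ruv.
have vt := legal_descent_lt0 lrv; rewrite -(play_acls _ ruv) in vt.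
have [[|k] [p [mst uE]]] := polygon_suffix lru st (legal_descent_lt0 lru) vt.
  by have := cox_offdiag st mst.
have alt_rev : acls (rev (alternating s t k.+1)) = acls (alternating s t k.+1).
  by rewrite rev_alternating; case: odd => //; rewrite (acls_alternating st mst).
have sE : acls (s :: u) = acls (s :: alternating t s k ++ rev p).
  rewrite -[s :: u]revK rev_cons (acls_rev uE) rev_cat.
  exact: acls_catl alt_rev.
have tE : acls (t :: v) = acls (t :: alternating s t k ++ rev p).
  by rewrite -uv sE; exact: (acls_catl _ (acls_alternating st mst)).
exists k, (rev p); split=> //; split; apply: legal_cancel; try eassumption.
  by rewrite -(legal_acls _ sE).
by rewrite -(legal_acls _ tE).
Qed.

End NumbersGame.

(** * Cancellation in the Artin monoid *)

Section Cancellation.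
Variables (R : realType) (S : choiceType) (m : coxeter_matrix S).
Local Notation acls := (acls m).
Local Notation legal := (@legal R S m).
Local Notation play := (@play R S m).
Local Notation fire := (@fire R S m).
Local Notation ones := (@ones R S).
Implicit Types (u v w x y z : seq S) (s t : S) (f : S -> R).

(** Garside's key property of two words s x and t y for one element: equal first letters cancel, and
    different ones force both words to begin with their polygon. *)
Definition garside_pair s t x y :=
  (s = t /\ acls x = acls y) \/
  (s <> t /\ exists k z, m s t = Some k.+1 /\
     acls x = acls (alternating t s k ++ z) /\
     acls y = acls (alternating s t k ++ z)).

(** Bounded in length because it is proved by induction together with the theory of longest legal
    prefixes. *)
Definition reduction n := forall s t x y, (size x < n)%N ->
  acls (s :: x) = acls (t :: y) -> garside_pair s t x y.

Lemma acls_cons s u v : acls u = acls v -> acls (s :: u) = acls (s :: v).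
Proof. exact: (@acls_catr _ _ [:: s]). Qed.

(** Here v is the longest legal prefix of x for a game started at f. *)
Record greedy f x v w : Prop := Greedy {
  greedy_fact : acls x = acls (v ++ w);
  greedy_legal : legal f v;
  greedy_max : forall v' w', acls x = acls (v' ++ w') -> legal f v' ->
    exists v'', acls v = acls (v' ++ v'')
}.

Section Step.
Variables (n : nat) (redn : reduction n).

Lemma reduction_cancel u x y : (size (u ++ x) <= n)%N ->
  acls (u ++ x) = acls (u ++ y) -> acls x = acls y.
Proof.
elim: u => //= s u IHu un /redn -/(_ un)[[_]|[//]].
by apply: IHu; rewrite ltnW.
Qed.

Lemma greedy_exists x f : (size x <= n)%N -> exists v w, greedy f x v w.
Proof.
elim: {x}(size x).+1 {-2}x f (ltnSn (size x)) => // j IHj x f xj xn.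
have [[s [x' [xE fs]]]|none] :=
  pselect (exists s x', acls x = acls (s :: x') /\ 0 < f s); last first.
  exists [::], x; split=> // -[|s v'] w' xE; first by exists [::].
  by move=> /= /andP[fs _]; case: none; exists s, (v' ++ w').
have x'j : (size x' < j)%N by move: xj; rewrite (acls_size xE) /=; lia.
have x'n : (size x' < n)%N by move: xn; rewrite (acls_size xE) /=; lia.
have [v0 [w0 g0]] := IHj x' (fire s f) x'j (ltnW x'n).
exists (s :: v0), w0; split; first by rewrite xE; exact/acls_cons/(greedy_fact g0).
  by rewrite /= fs (greedy_legal g0).
move=> [|t v1] w1; first by exists (s :: v0).
rewrite xE => xE1 /= /andP[ft lv1].
have [[st x'E]|[st [k [z [mst [x'E x''E]]]]]] := redn x'n xE1.
  rewrite -{}st in lv1 *; have [v'' vE] := greedy_max g0 x'E lv1.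
  by exists v''; exact: acls_cons.
have mts : m t s = Some k.+1 by rewrite cox_sym.
have x''s : size (v1 ++ w1) = size x' by case: (acls_size xE1).
(* Both v1 and the alternating word divide the longest legal prefix v2 of the other tail, so t v2 is
   the polygon followed by some v4. Rewritten to begin with s, it is a legal prefix of s x' and is
   absorbed by s v0. *)
have [||v2 [w2 g2]] := IHj (v1 ++ w1) (fire t f); rewrite ?x''s // 1?ltnW //.
have [v3 v3E] := greedy_max g2 erefl lv1.
have alt_st : legal f (alternating s t k.+1).
  by rewrite legal_alternatingE // /braid_bounded mst.
have alt_ts : legal f (alternating t s k.+1).
  by rewrite legal_alternatingE /braid_bounded ?mts //; exact/nesym.
have alt_k : legal (fire t f) (alternating s t k) by case/andP: alt_ts.
have [v4 v4E] := greedy_max g2 x''E alt_k.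
have zE : acls z = acls (v4 ++ w2).
  apply: (reduction_cancel (u := alternating s t k)).
    by rewrite -(acls_size x''E) x''s ltnW.
  by rewrite -x''E (greedy_fact g2) catA; exact: acls_catl.
have swap y : acls (s :: alternating t s k ++ y) = acls (t :: alternating s t k ++ y).
  exact: (acls_catl y (acls_alternating st mst)).
have l4 : legal (fire s f) (alternating t s k ++ v4).
  suff : legal f (s :: alternating t s k ++ v4) by case/andP.
  rewrite (legal_acls _ (swap v4)) /= ft -(legal_acls _ v4E).
  exact: greedy_legal g2.
have x'E2 : acls x' = acls ((alternating t s k ++ v4) ++ w2).
  by rewrite x'E -catA; exact: acls_catr.
have [v5 v5E] := greedy_max g0 x'E2 l4.
exists (v3 ++ v5); rewrite (acls_cons _ v5E) -catA swap catA.
rewrite [RHS](_ : _ = acls (t :: (v1 ++ v3) ++ v5)); last by rewrite /= catA.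
by apply: acls_cons; apply: acls_catl; rewrite -v4E.
Qed.

Lemma greedy_uniq f x x' v v' w w' : (size x <= n)%N -> acls x = acls x' ->
  greedy f x v w -> greedy f x' v' w' -> acls v = acls v' /\ acls w = acls w'.
Proof.
move=> xn xx' g g'.
have [a vE] : exists a, acls v = acls (v' ++ a).
  by apply: (greedy_max g) (greedy_legal g'); rewrite xx' (greedy_fact g').
have [b v'E] : exists b, acls v' = acls (v ++ b).
  by apply: (greedy_max g') (greedy_legal g); rewrite -xx' (greedy_fact g).
have a0 : a = [::].
  have := acls_size vE; have := acls_size v'E; rewrite !size_cat => ? ?.
  by apply: size0nil; lia.
rewrite {}a0 cats0 in vE; split=> //.
apply: (reduction_cancel (u := v)); first by rewrite -(acls_size (greedy_fact g)).
by rewrite -(greedy_fact g) xx' (greedy_fact g'); exact: acls_catl.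
Qed.

(** By cancellation, the longest legal prefix of u z is u followed by that of z, the game being
    resumed at [play f u]. *)
Lemma greedy_cat f u z v w : (size (u ++ z) <= n)%N -> legal f u ->
  greedy (play f u) z v w -> greedy f (u ++ z) (u ++ v) w.
Proof.
move=> un lu g; have [v' [w' g']] := greedy_exists f un.
have luv : legal f (u ++ v) by rewrite legal_cat lu (greedy_legal g).
have uvE : acls (u ++ z) = acls ((u ++ v) ++ w).
  by rewrite -catA; exact/acls_catr/(greedy_fact g).
have [c v'E] := greedy_max g' erefl lu.
have [e v'E2] := greedy_max g' uvE luv.
have zE : acls z = acls (c ++ w').
  apply: (reduction_cancel un); rewrite (greedy_fact g') catA.
  exact: acls_catl.
have [|d vE] := greedy_max g zE.
  have := greedy_legal g'; rewrite (legal_acls _ v'E) legal_cat.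
  by case/andP.
have v'E3 : acls v' = acls (u ++ v).
  rewrite v'E2; suff -> : e = [::] by rewrite cats0.
  have := acls_size v'E; have := acls_size v'E2; have := acls_size vE.
  by rewrite !size_cat => ? ? ?; apply: size0nil; lia.
by split=> // v1 w1 h1 h2; rewrite -v'E3; exact: (greedy_max g' h1 h2).
Qed.

(* The pair (s v, w), for the greedy factorization (v, w) of [x] after firing *)
(* [s], depends only on the product s x. *)
Lemma greedy_invariant W W' : (size W <= n.+1)%N -> acls W = acls W' ->
  forall s x s' x' v w v' w', W = s :: x -> W' = s' :: x' ->
  greedy (fire s ones) x v w -> greedy (fire s' ones) x' v' w' ->
  acls (s :: v) = acls (s' :: v') /\ acls w = acls w'.
Proof.
move=> + /pres_eqP; move=> Wn WW'.
have : (size W <= n.+1)%N by [].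
elim: WW' => {Wn W W'} [_ _ [u z _ _ [s0 t0 k st mst]]|W|W W' WW' IH|W W' W'' h1 IH1 h2 IH2] Wn.
(* A braid move away from the head only changes the word for the tail, and uniqueness applies. *)
- case: u Wn => [|a u] Wn; last first.
    move=> s x s' x' v w v' w' [<- <-] [<- <-] g g'.
    have [] := greedy_uniq _ _ g g'; first by move: Wn; rewrite /= ltnS.
      by apply/acls_catr/acls_catl/acls_alternating.
    by move=> *; split=> //; exact: acls_cons.
  have k2 := cox_offdiag st mst; case: k k2 mst Wn => // k _ mst Wn.
  move=> s x s' x' v w v' w' [<- <-] [<- <-] g g'.
  have alt l1 l2 : l1 <> l2 -> m l1 l2 = Some k.+1 -> legal ones (alternating l1 l2 k.+1).
    by move=> l12 ml; rewrite legal_alternatingE ?ltr01 // /braid_bounded ml.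
  have mts : m t0 s0 = Some k.+1 by rewrite cox_sym.
  have sz l1 l2 : (size (alternating l1 l2 k ++ z) <= n)%N.
    by move: Wn; rewrite /= !size_cat !size_alternating.
  (* A move at the head exchanges the two forms of a polygon in front of the same z, and both tails
     are compared with the longest legal prefix of z. *)
  have [|b [c gz]] := @greedy_exists z (play ones (alternating s0 t0 k.+1)).
    by have := sz s0 t0; rewrite size_cat; lia.
  have [|vE wE] := greedy_uniq (sz _ _) erefl g (greedy_cat (sz _ _) _ gz).
    by case/andP: (alt _ _ st mst).
  rewrite (play_polygon _ st mst) in gz.
  have [|v'E w'E] := greedy_uniq (sz _ _) erefl g' (greedy_cat (sz _ _) _ gz).
    by case/andP: (alt _ _ (nesym st) mts).
  split; last by rewrite wE w'E.
  rewrite (acls_cons _ vE) (acls_cons _ v'E).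
  exact: (acls_catl b (acls_alternating st mst)).
- move=> s x s' x' v w v' w' WE; rewrite WE in Wn *; move=> [<- <-] g g'.
  have [] := greedy_uniq Wn erefl g g'.
  by move=> *; split=> //; exact: acls_cons.
- move=> s x s' x' v w v' w' WE W'E g g'.
  have e : size W = size W' by apply: (@acls_size _ m); apply/pres_eqP.
  have [|-> ->] := IH _ _ _ _ _ _ _ _ _ W'E WE g' g; last by [].
  by rewrite e.
- move=> s x s' x' v w v' w' WE W'E g g'.
  have e : size W = size W' by apply: (@acls_size _ m); apply/pres_eqP.
  case: W' e h1 h2 IH1 IH2 => [|a y] e h1 h2 IH1 IH2; first by rewrite WE in e.
  have [|b [c gy]] := @greedy_exists y (fire a ones).
    by move: Wn; rewrite e.
  have [|-> ->] := IH1 _ _ _ _ _ _ _ _ _ WE erefl g gy => //.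
  by apply: (IH2 _ _ _ _ _ _ _ _ _ erefl W'E gy g'); rewrite -e.
Qed.

End Step.

(** Two words for one element have equal longest legal prefixes s v and t v' and equal remainders,
    so the claim follows from its version for legal words. *)
Theorem reduction_all n : reduction n.
Proof.
elim: n => // n redn s t x y xn stE.
have yx : size y = size x by case: (acls_size stE).
have [|v [w g]] := @greedy_exists n redn x (fire s ones); first by [].
have [|v' [w' g']] := @greedy_exists n redn y (fire t ones); first by rewrite yx.
have [|vE wE] := greedy_invariant redn _ stE erefl erefl g g'; first by [].
have lv : legal ones (s :: v) by rewrite /= ltr01 (greedy_legal g).
have lv' : legal ones (t :: v') by rewrite /= ltr01 (greedy_legal g').
have [st|st] := pselect (s = t); [left|right]; split=> //.
  rewrite -st in lv' vE; have vv' := legal_cancel lv lv' vE.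
  by rewrite (greedy_fact g) (greedy_fact g'); exact: acls_cat_congr.
have [k [z [mst [vE1 v'E1]]]] := legal_polygon_prefix st lv lv' vE.
exists k, (z ++ w); split=> //; rewrite !catA; split.
  by rewrite (greedy_fact g); exact: acls_catl.
by rewrite (greedy_fact g'); exact: acls_cat_congr.
Qed.

End Cancellation.

(** * Least common multiples *)

Section LeastCommonMultiples.
Variables (R : realType) (S : choiceType) (m : coxeter_matrix S).
Local Notation acls := (acls m).
Implicit Types (u v w x y z : seq S) (s t : S).

Lemma garside_pairP s t x y : acls (s :: x) = acls (t :: y) ->
  garside_pair m s t x y.
Proof. exact: (@reduction_all R S m (size x).+1). Qed.

Lemma acls_cancel u x y : acls (u ++ x) = acls (u ++ y) -> acls x = acls y.
Proof.
exact: (@reduction_cancel S m (size (u ++ x)) (@reduction_all R S m _)).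
Qed.

Definition wdvd u w := exists z, acls w = acls (u ++ z).

Lemma wdvd_acls u w w' : acls w = acls w' -> wdvd u w -> wdvd u w'.
Proof. by move=> ww' [z uz]; exists z; rewrite -ww'. Qed.

Lemma wdvd_cat2 u v w : wdvd (u ++ v) (u ++ w) <-> wdvd v w.
Proof.
split=> -[z vz]; exists z; last by rewrite -catA; exact: acls_catr.
by apply: (acls_cancel (u := u)); rewrite vz catA.
Qed.

Lemma wdvd_trans u v w : wdvd u v -> wdvd v w -> wdvd u w.
Proof.
move=> [x vE] [y wE]; exists (x ++ y); rewrite wE catA; exact: acls_catl.
Qed.

Lemma wdvd_refl u : wdvd u u.
Proof. by exists [::]; rewrite cats0. Qed.

Lemma wdvd_catr u v : wdvd u (u ++ v).
Proof. by exists v. Qed.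

Record is_lcm u v z : Prop := IsLcm {
  lcm_dvdl : wdvd u z;
  lcm_dvdr : wdvd v z;
  lcm_min : forall y, wdvd u y -> wdvd v y -> wdvd z y;
  lcm_letters : forall J : pred S, all J u -> all J v -> all J z
}.

Lemma all_alternating (J : pred S) s t k : J s -> J t -> all J (alternating s t k).
Proof. by elim: k s t => //= k IHk s t Js Jt; rewrite Js IHk. Qed.

(** Induction on the length of a common multiple. If the first letters differ, every common multiple
    begins with their polygon; p1 and p2 are what the lcm of each tail with the rest of the polygon
    adds to it, and the lcm p of these two completes the polygon. The letter condition later keeps
    lcms inside a parabolic submonoid. *)
Lemma lcm_exists w u v : wdvd u w -> wdvd v w -> exists z, is_lcm u v z.
Proof.
elim: {w}(size w).+1 {-2}w u v (ltnSn (size w)) => // n IHn w u v wn uw vw.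
case: u uw => [|s u] uw.
  by exists v; split=> //; [exists v|exact: wdvd_refl].
case: v vw => [|t v] vw.
  by exists (s :: u); split=> //; [exact: wdvd_refl|exists (s :: u)].
have [a wa] := uw; have [b wb] := vw.
have uan : (size (u ++ a) < n)%N by move: wn; rewrite (acls_size wa).
have vbn : (size (v ++ b) < n)%N by move: wn; rewrite (acls_size wb).
have := garside_pairP (etrans (esym wa) wb).
case=> [[st ab]|[st [k [z0 [mst [aE bE]]]]]].
  rewrite -{}st in uw vw wa wb *.
  have [||z zP] := IHn (u ++ a) u v uan; first exact: wdvd_catr.
    by apply: wdvd_acls (esym ab) _; exact: wdvd_catr.
  exists (s :: z); split=> //.
  - by apply/(@wdvd_cat2 [:: s]); exact: lcm_dvdl zP.
  - by apply/(@wdvd_cat2 [:: s]); exact: lcm_dvdr zP.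
  - move=> y [c yc] sy; apply: (wdvd_acls (esym yc)).
    apply/(@wdvd_cat2 [:: s]); apply: (lcm_min zP); first exact: wdvd_catr.
    by apply/(@wdvd_cat2 [:: s]); apply: wdvd_acls yc sy.
  - by move=> J /= /andP[-> Ju] Jv; exact: (lcm_letters zP).
have [||z1 z1P] := IHn (u ++ a) u (alternating t s k) uan.
- exact: wdvd_catr.
- by exists z0.
have [||z2 z2P] := IHn (v ++ b) v (alternating s t k) vbn.
- exact: wdvd_catr.
- by exists z0.
have [p1 p1E] := lcm_dvdr z1P; have [p2 p2E] := lcm_dvdr z2P.
have p1_dvd y c : acls (u ++ c) = acls (alternating t s k ++ y) -> wdvd p1 y.
  move=> cy; apply/(@wdvd_cat2 (alternating t s k)).
  have [||d dE] := lcm_min z1P (y := u ++ c); [exact: wdvd_catr|by exists y|].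
  by exists d; rewrite -cy dE; exact: acls_catl.
have p2_dvd y c : acls (v ++ c) = acls (alternating s t k ++ y) -> wdvd p2 y.
  move=> cy; apply/(@wdvd_cat2 (alternating s t k)).
  have [||d dE] := lcm_min z2P (y := v ++ c); [exact: wdvd_catr|by exists y|].
  by exists d; rewrite -cy dE; exact: acls_catl.
have z0n : (size z0 < n)%N.
  by move: uan; rewrite (acls_size aE) size_cat; lia.
have [||p pP] := IHn z0 p1 p2 z0n; [exact: p1_dvd aE|exact: p2_dvd bE|].
have swap y : acls (s :: alternating t s k ++ y) = acls (t :: alternating s t k ++ y).
  exact: (acls_catl y (acls_alternating st mst)).
have dvd_lcm l l' q pq zq : is_lcm q (alternating l' l k) zq ->
    acls zq = acls (alternating l' l k ++ pq) -> wdvd pq p ->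
    wdvd (l :: q) (l :: alternating l' l k ++ p).
  move=> zqP pqE pqp; apply/(@wdvd_cat2 [:: l]).
  apply: wdvd_trans (lcm_dvdl zqP) _; apply: wdvd_trans.
    by exists [::]; rewrite cats0; exact: esym pqE.
  exact/wdvd_cat2.
exists (s :: alternating t s k ++ p); split.
- exact: dvd_lcm z1P p1E (lcm_dvdl pP).
- apply: (wdvd_acls (esym (swap p))).
  exact: dvd_lcm z2P p2E (lcm_dvdr pP).
- move=> y [c yc] [d yd].
  have := garside_pairP (etrans (esym yc) yd).
  case=> [[//]|[_ [k' [z' [mst' [cE dE]]]]]].
  move: mst'; rewrite mst => -[kk']; rewrite -{}kk' in cE dE.
  apply: (wdvd_acls (esym yc)); apply/(@wdvd_cat2 [:: s]).
  apply: (wdvd_acls (esym cE)); apply/wdvd_cat2.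
  by apply: (lcm_min pP); [exact: p1_dvd cE|exact: p2_dvd dE].
- move=> J /= /andP[Js Ju] /andP[Jt Jv].
  rewrite Js all_cat all_alternating //=; apply: (lcm_letters pP).
    have := lcm_letters z1P Ju (all_alternating k Jt Js).
    by rewrite (acls_all J p1E) all_cat => /andP[].
  have := lcm_letters z2P Jv (all_alternating k Js Jt).
  by rewrite (acls_all J p2E) all_cat => /andP[].
Qed.

Record is_letter_lcm (A : seq S) z : Prop := IsLetterLcm {
  letter_lcm_dvd : forall s, s \in A -> wdvd [:: s] z;
  letter_lcm_min : forall y, (forall s, s \in A -> wdvd [:: s] y) -> wdvd z y;
  letter_lcm_letters : all (mem A) z
}.

Lemma letter_lcm_exists (A : seq S) w :
  (forall s, s \in A -> wdvd [:: s] w) -> exists z, is_letter_lcm A z.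
Proof.
elim: A => [|s A IHA] Aw.
  by exists [::]; split=> // y _; exists y.
have [t tA|z zP] := IHA; first by apply: Aw; rewrite inE tA orbT.
have [||y yP] := @lcm_exists w [:: s] z.
- by apply: Aw; rewrite mem_head.
- by apply: (letter_lcm_min zP) => t tA; apply: Aw; rewrite inE tA orbT.
exists y; split.
- move=> t; rewrite inE => /predU1P[->|tA]; first exact: lcm_dvdl yP.
  exact: wdvd_trans (letter_lcm_dvd zP tA) (lcm_dvdr yP).
- move=> x Ax; apply: (lcm_min yP); first by apply: Ax; rewrite mem_head.
  by apply: (letter_lcm_min zP) => t tA; apply: Ax; rewrite inE tA orbT.
- apply: (lcm_letters yP) => /=; first by rewrite mem_head.
  apply: sub_all (letter_lcm_letters zP) => t /= tA.
  by rewrite inE tA orbT.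
Qed.

End LeastCommonMultiples.

(** * Terminal positions and finiteness of Coxeter groups *)

Section TerminalPositions.
Variables (R : realType) (S : choiceType) (m : coxeter_matrix S).
Local Notation play := (@play R S m).
Local Notation legal := (@legal R S m).
Local Notation fire := (@fire R S m).

Definition terminal (f : S -> R) : Prop := forall s, ~~ (0 < f s).

Lemma terminal_extension B f : (forall v, legal f v -> (size v <= B)%N) ->
  exists2 w, legal f w & terminal (play f w).
Proof.
elim: B f => [|B IHB] f bnd.
  by exists [::] => // s; apply/negP => fs; have := bnd [:: s]; rewrite /= fs => /(_ isT).
have [[s fs]|term] := pselect (exists s, 0 < f s); last first.
  by exists [::] => // s; apply/negP => fs; apply: term; exists s.
have [|w lw tw] := IHB (fire s f).
  by move=> v lv; have := bnd (s :: v); rewrite /= fs lv => /(_ isT).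
by exists (s :: w) => //=; rewrite fs.
Qed.

(** A strong convergence argument: after two different first moves s and t, both games can complete
    the polygon of s and t and go on identically to a terminal position. The polygon is finite,
    because the games that follow s are bounded by induction. *)
Lemma terminal_bound f u v : legal f u -> terminal (play f u) -> legal f v ->
  (size v <= size u)%N.
Proof.
elim: {u}(size u).+1 {-2}u (ltnSn (size u)) f v => // n IHn u un f v.
case: v => [//|t v]; case: u un => [|s u] un /=.
  by move=> _ /(_ t) /negP ft /andP[].
move=> /andP[fs lu] tu /andP[ft lv]; rewrite ltnS in un *.
have [st|st] := pselect (s = t); first by rewrite -st in lv; exact: IHn lu tu lv.
have ubnd w : legal (fire s f) w -> (size w <= size u)%N by exact: IHn lu tu.
have alt k : braid_bounded m s t k.+1 -> legal (fire s f) (alternating t s k).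
  by rewrite -(@legal_alternatingE R S m s t k.+1 f) // => /andP[].
case mst: (m s t) => [n'|]; last first.
  have := ubnd _ (alt (size u).+1 _); rewrite /braid_bounded mst => /(_ isT).
  by rewrite size_alternating ltnn.
case: n' mst => [|k] mst; first by have := cox_offdiag st mst.
have lalt : legal (fire s f) (alternating t s k).
  by apply: alt; rewrite /braid_bounded mst.
have [|w lw tw] := @terminal_extension (size u) (play (fire s f) (alternating t s k)).
  move=> w lw; have := ubnd (alternating t s k ++ w).
  rewrite legal_cat lalt lw => /(_ isT).
  by rewrite size_cat; apply: leq_trans; rewrite leq_addl.
have altw : (size (alternating s t k ++ w) <= size u)%N.
  rewrite size_cat size_alternating -(size_alternating t s k) -size_cat.
  by apply: ubnd; rewrite legal_cat lalt.
have lalt' : legal f (alternating t s k.+1).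
  by apply: legal_polygon mst _ => //=; rewrite fs.
have playE : play (fire t f) (alternating s t k) = play (fire s f) (alternating t s k).
  exact: esym (play_polygon f st mst).
apply: (leq_trans _ altw); apply: IHn lv; first exact: leq_ltn_trans altw un.
  rewrite legal_cat playE lw andbT; by case/andP: lalt'.
by rewrite play_cat playE.
Qed.

End TerminalPositions.

Section FiniteCoxeterGroups.
Variables (R : realType) (S : choiceType) (m : coxeter_matrix S).
Local Notation acls := (acls m).
Local Notation W := (coxeter_group m).
Local Notation ones := (@ones R S).
Local Notation play := (@play R S m).
Local Notation legal := (@legal R S m).

Definition wcls (w : seq S) : W :=
  \pi_(pres_monoid (group_relation (coxeter_relation m))) [seq (s, false) | s <- w].

Lemma wcls_cat u v : wcls (u ++ v) = (wcls u * wcls v)%g.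
Proof. by rewrite /wcls map_cat pres_pi_cat. Qed.

Lemma wcls_square s : (wcls [:: s] * wcls [:: s] = 1)%g.
Proof.
by rewrite -wcls_cat; apply: pres_relE; apply: (GroupRel (CoxeterSquare m s)).
Qed.

Lemma wcls_acls u v : acls u = acls v -> wcls u = wcls v.
Proof.
move=> uv; apply/esym; apply: (acls_ind (P := fun w => wcls w = wcls u)) uv _ => //.
move=> {v} v w s t n st mst <-; rewrite !wcls_cat; congr (_ * (_ * _))%g.
by apply: pres_relE; apply: GroupRel; apply: CoxeterBraid; apply: BraidRelation;
  [exact/nesym|rewrite cox_sym].
Qed.

Lemma wcls_onto (g : W) : exists w, g = wcls w.
Proof.
suff letters u : \pi_(pres_monoid (group_relation (coxeter_relation m))) u =
    wcls [seq x.1 | x <- u] by exists [seq x.1 | x <- repr g]; rewrite -letters reprK.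
elim: u => [//|[s b] u IHu].
rewrite -cat1s pres_pi_cat IHu /= (wcls_cat [:: s]).
congr (_ * _)%g; case: b => //.
have inv : (\pi_(pres_monoid (group_relation (coxeter_relation m))) [:: (s, true)]
    * wcls [:: s] = 1)%g.
  by rewrite -pres_pi_cat; apply: pres_relE; exact: (GroupCancel _ s true).
by rewrite -[LHS]mulg1 -(wcls_square s) mulgA inv mul1g.
Qed.

Lemma wcls_legal (g : W) : exists2 w, legal ones w & g = wcls w.
Proof.
have [w ->] := wcls_onto g.
elim: {w}(size w).+1 {-2}w (ltnSn (size w)) => // n IHn w wn.
have [lw|/illegal_square[u [s [v wE]]]] := boolP (legal ones w); first by exists w.
have [|w' lw' uvE] := IHn (u ++ v).
  by move: wn; rewrite (acls_size wE) !size_cat /=; lia.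
exists w' => //; rewrite -uvE (wcls_acls wE) !wcls_cat.
by rewrite -[[:: s; s]]/([:: s] ++ [:: s]) wcls_cat wcls_square mul1g.
Qed.

(** Firing is an involution and respects the braid relations, so W acts on positions. *)
Lemma play_wcls f u v : wcls u = wcls v -> play f u = play f v.
Proof.
move=> /pres_eqP; rewrite -{2}[u](map_id u) -{2}[v](map_id v).
suff inv x y : clos_refl_sym_trans _
    (rewrite_step (group_relation (coxeter_relation m))) x y ->
    play f [seq z.1 | z <- x] = play f [seq z.1 | z <- y].
  by move=> /inv; rewrite -!map_comp.
elim=> {x y} [_ _ [x y l0 r0 rel]|//|//|x y z _ -> _ //].
rewrite !map_cat !play_cat; congr play.
case: l0 r0 / rel => [s b|l r lr] /=; first by rewrite fireK.
have fstK (w : seq S) : [seq z.1 | z <- [seq (s, false) | s <- w]] = w.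
  by rewrite -map_comp map_id.
rewrite !fstK; case: l r / lr => [l' r' lr|s]; last by rewrite /= fireK.
exact/(@play_acls R S m)/pres_relE.
Qed.

(** Without terminal position there are legal words of every length, and those of different lengths
    differ in W: equal classes give equal positions, to which [matsumoto] applies. *)
Lemma finite_terminal : finite_set [set: W] ->
  exists2 u, legal ones u & terminal (play ones u).
Proof.
move=> finW; apply: contrapT => noterm.
have ext u : legal ones u -> exists s, 0 < play ones u s.
  move=> lu; apply: contrapT => no; apply: noterm; exists u => // s.
  by apply/negP => us; apply: no; exists s.
have long k : exists u, legal ones u /\ size u = k.
  elim: k => [|k [u [lu uk]]]; first by exists [::].
  have [s us] := ext u lu; exists (rcons u s).
  by rewrite legal_rcons lu us size_rcons uk.
have [h hP] := choice long; pose g k := wcls (h k).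
have g_inj : injective g.
  move=> j k gjk; have [lj <-] := hP j; have [lk <-] := hP k.
  by apply/(@acls_size _ m)/(matsumoto lj lk)/play_wcls.
have := finite_preimage (f := g) (B := [set: W]).
rewrite preimage_setT => /(_ (fun x y _ _ => @g_inj x y) finW).
exact: infinite_nat.
Qed.

(** By [dichotomy], every letter can be retracted from a terminal position, that is, ends its word;
    reversal turns ends into beginnings. *)
Lemma finite_common_multiple : finite_set [set: W] ->
  exists w, forall s, wdvd m [:: s] w.
Proof.
move=> /finite_terminal[u lu tu]; exists (rev u) => s.
have [us|[u' uE]] := dichotomy s lu; first by have := tu s; rewrite us.
by exists (rev u'); rewrite (acls_rev uE) rev_rcons.
Qed.

(** The longest legal prefix of a common multiple is still divisible by every letter, so its
    reversal leads to a terminal position. This bounds the length of all legal words, and these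
    represent every element of W. *)
Lemma common_multiple_finite (A : seq S) w : (forall s, s \in A) ->
  (forall s, wdvd m [:: s] w) -> finite_set [set: W].
Proof.
move=> inA dvdw.
have [v [w' g]] := greedy_exists (@reduction_all R S m _) ones (leqnn (size w)).
have lrv : legal ones (rev v) by rewrite legal_rev (greedy_legal g).
have tv : terminal (play ones (rev v)).
  move=> s; have [y wy] := dvdw s.
  have [|v' vE] := greedy_max g wy; first by rewrite /= ltr01.
  have rvE : acls (rev v) = acls (rcons (rev v') s).
    by rewrite (acls_rev vE) rev_cons.
  rewrite -leNgt ltW // (play_acls _ rvE) legal_descent_lt0 //.
  by rewrite -(legal_acls _ rvE).
pose fix L k : seq (seq S) :=
  if k is k'.+1 then [::] :: [seq s :: w | s <- A, w <- L k'] else [:: [::]].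
have inL k u : (size u <= k)%N -> u \in L k.
  elim: k u => [|k IHk] [|s u] //= uk; rewrite inE; apply/orP; right.
  by apply/allpairsP; exists (s, u); split=> //=; exact: IHk.
apply: (@sub_finite_set _ _ (wcls @` [set` L (size (rev v))])).
  move=> x _; have [u lu ->] := wcls_legal x; exists u => //=.
  by apply: inL; exact: terminal_bound lrv tv lu.
exact/finite_image/finite_seq.
Qed.

End FiniteCoxeterGroups.

Section ParabolicFiniteType.
Variables (R : realType) (S : choiceType) (m : coxeter_matrix S) (I : set S).
Local Notation mI := (cox_restrict m I).

Lemma map_alternating (s t : I) n :
  map val (alternating s t n) = alternating (val s) (val t) n.
Proof. by elim: n s t => //= n IHn s t; rewrite IHn. Qed.

Lemma acls_map_val (u v : seq I) : acls mI u = acls mI v ->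
  acls m (map val u) = acls m (map val v).
Proof.
move=> uv; apply/esym.
apply: (acls_ind (P := fun w => acls m (map val w) = acls m (map val u))) uv _ => //.
move=> {v} v w s t n st mst <-; rewrite !map_cat !map_alternating.
apply/acls_catr/acls_catl/esym/acls_alternating => //.
by move=> /val_inj.
Qed.

(** Braid moves keep the set of letters, so they relate a word over I only to words over I, by moves
    of the restricted matrix. *)
Lemma acls_map_val_inv (u : seq I) v : acls m (map val u) = acls m v ->
  exists2 u', v = map val u' & acls mI u = acls mI u'.
Proof.
move=> uv; pose P w := exists2 u', w = map val u' & acls mI u = acls mI u'.
apply: (acls_ind (P := P)) uv _; last by exists u.
move=> {v} x y s t n st mst [u' u'E uu'].
have split_map (a b : seq S) (c : seq I) : a ++ b = map val c ->
    exists c1 c2, [/\ c = c1 ++ c2, a = map val c1 & b = map val c2].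
  move=> abE; exists (take (size a) c), (drop (size a) c).
  by rewrite cat_take_drop map_take map_drop -abE take_size_cat ?drop_size_cat.
have [x' [z [u'E2 xE /esym zE]]] := split_map _ _ _ u'E.
have [a [y' [zE2 aE yE]]] := split_map _ _ _ (esym zE).
have n2 := cox_offdiag st mst.
have [s' [t' [sE tE]]] : exists s' t' : I, s = val s' /\ t = val t'.
  case: n n2 aE {mst u'E zE} => [|[|n]] // _.
  by case: a zE2 => [|s' [|t' a]] //= _ [-> -> _]; exists s', t'.
have a_alt : a = alternating s' t' n.
  by apply: (inj_map val_inj); rewrite -aE map_alternating sE tE.
have st' : s' <> t' by move=> e; apply: st; rewrite sE tE e.
have mst' : mI s' t' = Some n by rewrite -mst sE tE.
exists (x' ++ alternating t' s' n ++ y').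
  by rewrite !map_cat map_alternating -sE -tE -xE -yE.
by rewrite uu' u'E2 zE2 a_alt; apply/acls_catr/acls_catl/acls_alternating.
Qed.

(** For the converse, the lcm of A only uses letters of A, so it is a common multiple inside the
    monoid of I. *)
Lemma finite_type_common_multiple (A : seq S) : (forall s, I s <-> s \in A) ->
  finite_type_subsets m I <-> exists w, forall s, s \in A -> wdvd m [:: s] w.
Proof.
move=> IA; split.
  move=> /(@finite_common_multiple R)[w dvdw]; exists (map val w) => s /IA Is.
  have [y wy] := dvdw (exist _ s (mem_set Is) : I).
  by exists (map val y); rewrite (acls_map_val wy).
move=> [w /(letter_lcm_exists R)[z [zA _ z_letters]]].
have [z' zE] : exists z' : seq I, z = map val z'.
  elim: z z_letters {zA} => [|s z IHz] /=; first by exists [::].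
  move=> /andP[/IA Is /IHz[z' ->]].
  by exists ((exist _ s (mem_set Is) : I) :: z').
apply: (@common_multiple_finite R _ _ (pmap insub A) z').
  move=> s; rewrite mem_pmap_sub; apply/IA/set_mem; exact: valP.
move=> s; have [|y] := zA (val s); first by apply/IA/set_mem; exact: valP.
rewrite zE => /acls_map_val_inv[[//|s' y'] [/val_inj <- _] z'E].
by exists y'.
Qed.

End ParabolicFiniteType.

(** * Supports of chains and cone operators *)

Section Support.
Variable K : choiceType.
Local Notation Z := {freeg K / int}.
Implicit Types (z : Z) (P Q : K -> Prop).

Definition supported P z : Prop := forall x, coeff x z != 0 -> P x.

Lemma supported0 P : supported P 0.
Proof. by move=> x; rewrite coeff0 eqxx. Qed.

Lemma supportedB P z z' : supported P z -> supported P z' -> supported P (z - z').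
Proof.
move=> Pz Pz' x; rewrite coeffB => nz.
have [z0|/Pz//] := eqVneq (coeff x z) 0.
by apply: Pz'; move: nz; rewrite z0 sub0r oppr_eq0.
Qed.

Lemma supportedN P z : supported P z -> supported P (- z).
Proof. by move=> Pz; rewrite -sub0r; apply: supportedB => //; exact: supported0. Qed.

Lemma supportedD P z z' : supported P z -> supported P z' -> supported P (z + z').
Proof.
by move=> Pz Pz'; rewrite -[z']opprK; apply: supportedB => //; exact: supportedN.
Qed.

Lemma supported_sum P (I : Type) (r : seq I) (C : pred I) (F : I -> Z) :
  (forall i, C i -> supported P (F i)) -> supported P (\sum_(i <- r | C i) F i).
Proof.
move=> PF; elim/big_ind: _ => //; first exact: supported0.
by move=> *; exact: supportedD.
Qed.

Lemma supportedMz P z n : supported P z -> supported P (z *~ n).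
Proof.
move=> Pz x; rewrite raddfMz /=; have [->|xz _] := eqVneq (coeff x z) 0.
  by rewrite mul0rz eqxx.
exact: Pz.
Qed.

Lemma supportedU P x : P x -> supported P << x >>.
Proof.
move=> Px y; rewrite coeffU mul1r; have [<-//|] := eqVneq x y.
by rewrite eqxx.
Qed.

Lemma supported_sub P Q z : (forall x, P x -> Q x) -> supported P z -> supported Q z.
Proof. by move=> PQ Pz x /Pz /PQ. Qed.

Lemma supported_dom z : supported (fun x => x \in dom z) z.
Proof. by move=> x; rewrite mem_dom. Qed.

Lemma freeg_sumMz z : z = \sum_(x <- dom z) << x >> *~ coeff x z.
Proof.
rewrite -[LHS]freeg_sumE; apply: eq_bigr => x _.
by rewrite freegU_mulz intz.
Qed.

Lemma supported_ext P (V : zmodType) (f g : {additive Z -> V}) z :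
  (forall x, P x -> f << x >> = g << x >>) -> supported P z -> f z = g z.
Proof.
move=> fg Pz; rewrite [z]freeg_sumMz !raddf_sum big_seq [RHS]big_seq.
apply: eq_bigr => x xz; rewrite !raddfMz fg //.
by apply: Pz; rewrite -mem_dom.
Qed.

Lemma supported_bound (f : K -> nat) z :
  exists N, supported (fun x => (f x < N)%N) z.
Proof.
exists (\max_(x <- dom z) f x).+1 => x; rewrite -mem_dom => xz.
by rewrite ltnS; exact: (leq_bigmax_seq (F := f)).
Qed.

End Support.

Lemma supported_zlin (K L : choiceType) (P : K -> Prop) (Q : L -> Prop)
    (b : K -> {freeg L / int}) z :
  (forall x, P x -> supported Q (b x)) -> supported P z -> supported Q (zlin b z).
Proof.
move=> PQ Pz; rewrite [z]freeg_sumMz raddf_sum big_seq; apply: supported_sum => x xz.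
rewrite raddfMz /= zlinU; apply: supportedMz; apply: PQ; apply: Pz.
by rewrite -mem_dom.
Qed.

Section Cones.
Variable X : simplicial_set.
Local Notation Z n := {freeg (X n) / int}.

Definition zmap (K L : choiceType) (f : K -> L) : {freeg K / int} -> {freeg L / int} :=
  zlin (fun x => << f x >>).

HB.instance Definition _ (K L : choiceType) (f : K -> L) :=
  GRing.Additive.on (zmap f).

Lemma zmapU (K L : choiceType) (f : K -> L) x : zmap f << x >> = << f x >>.
Proof. exact: zlinU. Qed.

Lemma simplicial_diffU n (x : X n.+1) : simplicial_diff << x >> =
  \sum_(i < n.+2) << sact (coface i) x >> *~ (-1) ^+ i.
Proof. exact: zlinU. Qed.

Variable H : forall n, X n -> X n.+1.

Lemma cone_first_diff n (x : X n.+1) : sact (coface ord0) (H x) = x ->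
  (forall i : 'I_n.+2,
     sact (coface (fintype.lift ord0 i)) (H x) = H (sact (coface i) x)) ->
  simplicial_diff << H x >> = << x >> - zmap (@H n) (simplicial_diff << x >>).
Proof.
move=> H0 HS; rewrite !simplicial_diffU raddf_sum big_ord_recl H0 /= -sumrN.
congr (_ + _); apply: eq_bigr => i _.
by rewrite HS raddfMz /= zmapU exprS mulN1r mulrNz.
Qed.

Lemma cone_last_diff n (x : X n.+1) : sact (coface ord_max) (H x) = x ->
  (forall i : 'I_n.+2,
     sact (coface (widen_ord (leqnSn _) i)) (H x) = H (sact (coface i) x)) ->
  simplicial_diff << H x >> =
    zmap (@H n) (simplicial_diff << x >>) + << x >> *~ (-1) ^+ n.
Proof.
move=> H0 HS; rewrite !simplicial_diffU raddf_sum big_ord_recr /= H0.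
congr (_ + _); last by rewrite !exprS !mulN1r opprK.
by apply: eq_bigr => i _; rewrite HS raddfMz /= zmapU.
Qed.

(** In degree 0 a second vertex of the cone survives; where this is applied, that vertex depends
    only on the augmentation of x. *)
Lemma cone_diff0 (x : X 0) : sact (coface ord0) (H x) = x ->
  simplicial_diff << H x >> = << x >> - << sact (coface ord_max) (H x) >>.
Proof.
move=> H0; rewrite !simplicial_diffU !big_ord_recl big_ord0 /= addr0 H0.
by rewrite mulrNz; congr (_ - << sact (coface _) _ >>); apply: val_inj.
Qed.

Lemma cone_first_exact n (P : X n.+1 -> Prop) (z : Z n.+1) : supported P z ->
  (forall x, P x -> sact (coface ord0) (H x) = x /\
     forall i : 'I_n.+2,
       sact (coface (fintype.lift ord0 i)) (H x) = H (sact (coface i) x)) ->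
  simplicial_diff (zmap (@H n.+1) z) = z - zmap (@H n) (simplicial_diff z).
Proof.
move=> Pz PH; pose f1 : {additive Z n.+1 -> Z n.+1} :=
  (@simplicial_diff X n.+1) \o (zmap (@H n.+1)).
pose f2 : {additive Z n.+1 -> Z n.+1} :=
  idfun \- (zmap (@H n) \o @simplicial_diff X n).
apply: (supported_ext (f := f1) (g := f2)) Pz => x /PH[H0 HS] /=.
by rewrite zmapU cone_first_diff.
Qed.

Lemma cone_last_exact n (P : X n.+1 -> Prop) (z : Z n.+1) : supported P z ->
  (forall x, P x -> sact (coface ord_max) (H x) = x /\
     forall i : 'I_n.+2,
       sact (coface (widen_ord (leqnSn _) i)) (H x) = H (sact (coface i) x)) ->
  simplicial_diff z = 0 -> exists y, simplicial_diff y = z.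
Proof.
move=> Pz PH dz; exists (zmap (@H n.+1) z *~ (-1) ^+ n).
pose f1 : {additive Z n.+1 -> Z n.+1} :=
  (@simplicial_diff X n.+1) \o (zmap (@H n.+1)).
pose f2 : {additive Z n.+1 -> Z n.+1} :=
  (zmap (@H n) \o @simplicial_diff X n) \+
    ( *:%R (((-1) ^+ n)%:~R : int)).
have := supported_ext (f := f1) (g := f2) (P := P) _ Pz.
rewrite /= dz raddf0 add0r scaler_int raddfMz /= => ->.
  by rewrite -mulrzA -exprD addnn -mul2n exprM sqrrN !expr1n.
by move=> x /PH[H0 HS] /=; rewrite zmapU cone_last_diff // scaler_int.
Qed.

End Cones.

(** * A Koszul-type resolution of a monoid with lcms *)

Section KoszulSigns.
Variables (S : choiceType) (lt : rel S).
Hypothesis ltss : irreflexive lt.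
Hypothesis lt_flip : forall s t, s != t -> lt t s = ~~ lt s t.
Implicit Types (s t : S) (A : {fset S}).

(** The parity of the number of elements of A below s, the usual sign for removing s from an ordered
    simplex. *)
Definition ksign s A : int := \prod_(u <- A) (-1) ^+ lt u s.

Lemma ksignD1 s t A : t \in A -> ksign s A = (-1) ^+ lt t s * ksign s (A `\ t)%fset.
Proof. by move=> tA; rewrite /ksign (big_fsetD1 t). Qed.

Lemma ksignU1 s t A : t \notin A -> ksign s (t |` A)%fset = (-1) ^+ lt t s * ksign s A.
Proof. by move=> tA; rewrite /ksign big_fsetU1. Qed.

Lemma ksign_sqr s A : ksign s A * ksign s A = 1.
Proof.
by rewrite /ksign -big_split big1 //= => u _; rewrite -expr2 sqrr_sign.
Qed.

Lemma ksign_swap s t A : s != t -> s \in A -> t \in A ->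
  ksign s A * ksign t (A `\ s)%fset = - (ksign t A * ksign s (A `\ t)%fset).
Proof.
move=> st sA tA; rewrite (ksignD1 s tA) (ksignD1 t sA) (lt_flip st).
by rewrite signrN; ring.
Qed.

Lemma ksignU1_swap s t A : s != t -> s \in A -> t \notin A ->
  ksign t A * ksign s (t |` A)%fset = - (ksign s A * ksign t (A `\ s)%fset).
Proof.
move=> st sA tA; rewrite ksignU1 // (ksignD1 t sA) (lt_flip st) signrN.
by case: (lt s t); rewrite ?expr0 ?expr1; ring.
Qed.

Lemma antisym_sum_eq0 (V : zmodType) (r : seq S) (G : S -> S -> V) :
  (forall s t, s \in r -> t \in r -> s != t -> G t s = - G s t) ->
  \sum_(s <- r) \sum_(t <- r | t != s) G s t = 0.
Proof.
move=> GN; have splitG s : \sum_(t <- r | t != s) G s t =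
    \sum_(t <- r | lt t s) G s t + \sum_(t <- r | lt s t) G s t.
  rewrite (bigID (lt^~ s)) /=; congr (_ + _); apply: eq_bigl => t.
    by case: eqVneq => [->|//]; rewrite ltss.
  by case: eqVneq => [->|ts]; rewrite ?ltss //= (lt_flip ts).
under eq_bigr do rewrite splitG.
rewrite big_split /= [X in _ + X](exchange_big_dep xpredT) //= -big_split /=.
rewrite big_seq big1 // => s sr; rewrite -big_split /= big_seq_cond big1 // => t.
move=> /andP[tr ts]; rewrite (GN t s) ?subrr ?addNr //.
by apply: contraTneq ts => ->; rewrite ltss.
Qed.

Lemma sum_fsetD1 (V : zmodType) (A : {fset S}) s (F : S -> V) :
  \sum_(t <- (A `\ s)%fset) F t = \sum_(t <- A | t != s) F t.
Proof.
rewrite -[RHS]big_filter; apply: perm_big; apply: uniq_perm.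
- exact: fset_uniq.
- exact/filter_uniq/fset_uniq.
- by move=> t; rewrite mem_filter in_fsetD1.
Qed.

End KoszulSigns.

Section Divisibility.
Variable M : monoidType.
Definition mdvd (x y : M) : Prop := exists z, y = (x * z)%g.

Lemma mdvd_mulr x y z : mdvd x y -> mdvd x (y * z)%g.
Proof. by move=> [w ->]; exists (w * z)%g; rewrite mulgA. Qed.

End Divisibility.

Record lcm_gen (S : choiceType) (M : monoidType) (gen : S -> M) (A : {fset S})
    (z : M) : Prop := LcmGen {
  lcm_gen_dvd : forall s, s \in A -> mdvd (gen s) z;
  lcm_gen_min : forall y, (forall s, s \in A -> mdvd (gen s) y) -> mdvd z y
}.

Record garside_like (S : choiceType) (M : monoidType) (gen : S -> M)
    (len : M -> nat) : Prop := GarsideLike {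
  gl_lenM : forall x y, len (x * y)%g = (len x + len y)%N;
  gl_len_gen : forall s, (0 < len (gen s))%N;
  gl_gen : forall x, x <> 1%g -> exists s, mdvd (gen s) x;
  gl_cancel : forall x y z : M, (x * y = x * z -> y = z)%g;
  gl_lcm : forall (A : {fset S}) x, (forall s, s \in A -> mdvd (gen s) x) ->
    exists z, lcm_gen gen A z
}.

Section Koszul.
Variables (S : choiceType) (M : monoidType) (gen : S -> M) (len : M -> nat).
Hypothesis gl : garside_like gen len.
Variable lt : rel S.
Hypothesis ltss : irreflexive lt.
Hypothesis lt_flip : forall s t, s != t -> lt t s = ~~ lt s t.
Local Notation ksign := (ksign lt).
Implicit Types (s t : S) (A : {fset S}) (x y : M) (k : nat).

Definition is_kcell k (p : {fset S} * M) : bool :=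
  (#|` p.1| == k) && `[< forall s, s \in p.1 -> mdvd (gen s) p.2 >].

Definition kcell k : choiceType := {p | is_kcell k p}.

Local Notation Q k := {freeg (kcell k) / int}.

(** The value 0 off the cells lets differentials and homotopies be written on pairs, without
    membership proofs. *)
Definition kbasis k p : Q k := if insub p is Some q then << q >> else 0.

Lemma kbasisE k (q : kcell k) : kbasis k (val q) = << q >>.
Proof. by rewrite /kbasis valK. Qed.

Lemma kbasis_cases k p :
  (exists2 q : kcell k, val q = p & kbasis k p = << q >>) \/ kbasis k p = 0.
Proof.
by rewrite /kbasis; case: insubP => [q _ qE|_]; [left; exists q|right].
Qed.

Lemma kcellP k A x :
  is_kcell k (A, x) <-> #|` A| = k /\ forall s, s \in A -> mdvd (gen s) x.
Proof.
by split=> [/andP[/eqP cA /asboolP]|[/eqP cA Ax]] //; rewrite /is_kcell cA; apply/asboolP.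
Qed.

Lemma zlin_kbasis (V : zmodType) k (f : {fset S} * M -> V) p : is_kcell k p ->
  zlin (fun q : kcell k => f (val q)) (kbasis k p) = f p.
Proof. by move=> pk; rewrite /kbasis insubT zlinU. Qed.

Lemma kcellD1 k A x s : is_kcell k.+1 (A, x) -> s \in A ->
  is_kcell k ((A `\ s)%fset, x).
Proof.
move=> /kcellP[cA Ax] sA; apply/kcellP; split.
  by move: cA; rewrite (cardfsD1 s) sA => -[].
by move=> t; rewrite in_fsetD1 => /andP[_ /Ax].
Qed.

Lemma kcellU1 k A x s : is_kcell k (A, x) -> s \notin A -> mdvd (gen s) x ->
  is_kcell k.+1 ((s |` A)%fset, x).
Proof.
move=> /kcellP[cA Ax] sA sx; apply/kcellP; split.
  by rewrite cardfsU1 sA cA.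
by move=> t; rewrite in_fset1U => /predU1P[->|/Ax].
Qed.

Definition kbd_pair k (p : {fset S} * M) : Q k :=
  \sum_(s <- p.1) kbasis k ((p.1 `\ s)%fset, p.2) *~ ksign s p.1.

Definition kbd k : Q k.+1 -> Q k := zlin (fun q : kcell k.+1 => kbd_pair k (val q)).
HB.instance Definition _ k := GRing.Additive.on (@kbd k).

Lemma kbdE k p : is_kcell k.+1 p -> kbd (kbasis k.+1 p) = kbd_pair k p.
Proof. exact: (@zlin_kbasis _ k.+1 (kbd_pair k)). Qed.

Lemma kbdK k (z : Q k.+2) : kbd (kbd z) = 0.
Proof.
rewrite [z]freeg_sumMz !raddf_sum big1 // => -[[A x] Axk] _.
rewrite !raddfMz /= -[<< _ >>]kbasisE kbdE //= /kbd_pair raddf_sum.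
rewrite big_seq; under eq_bigr => s sA.
  rewrite raddfMz /= kbdE; last exact: kcellD1 sA.
  rewrite /kbd_pair /= sum_fsetD1 mulrz_suml.
  under eq_bigr do rewrite -mulrzA.
  over.
rewrite -big_seq (antisym_sum_eq0 ltss lt_flip) ?mul0rz // => s t sA tA st.
rewrite -mulrNz; congr (_ *~ _); last by rewrite mulrC [in RHS]mulrC (ksign_swap lt_flip st) ?opprK.
by congr (kbasis _ (_, _)); apply/fsetP => u; rewrite !in_fsetD1 andbCA.
Qed.

Definition some_divisor x : option S :=
  if pselect (exists s, mdvd (gen s) x) is left ex then Some (sval (cid ex))
  else None.

Lemma some_divisorP x s : some_divisor x = Some s -> mdvd (gen s) x.
Proof. by rewrite /some_divisor; case: pselect => // ex [<-]; case: cid. Qed.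

Lemma some_divisor_ex x s : mdvd (gen s) x -> exists t, some_divisor x = Some t.
Proof.
move=> sx; rewrite /some_divisor; case: pselect => [ex|[]]; first by eexists.
by exists s.
Qed.

(* Koszul contraction at weight [x], coning off a chosen divisor of [x]. *)
Definition khom_pair k (p : {fset S} * M) : Q k.+1 :=
  if some_divisor p.2 is Some s then
    if s \in p.1 then 0 else kbasis k.+1 ((s |` p.1)%fset, p.2) *~ ksign s p.1
  else 0.

Definition khom k : Q k -> Q k.+1 := zlin (fun q : kcell k => khom_pair k (val q)).
HB.instance Definition _ k := GRing.Additive.on (@khom k).

Lemma khomE k p : is_kcell k p -> khom (kbasis k p) = khom_pair k p.
Proof. exact: (@zlin_kbasis _ k (khom_pair k)). Qed.

(** The cone contracts the simplex of divisors of x down to the empty set; at x = 1 there would be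
    no divisor to cone off. *)
Lemma khom_exact0 (q : kcell 0) : (val q).2 <> 1%g -> kbd (khom << q >>) = << q >>.
Proof.
case: q => -[A x] /= Ak x1; rewrite -[<< _ >>]kbasisE khomE //= /khom_pair /=.
have [s0 /some_divisor_ex[s sE]] := gl_gen gl x1; rewrite sE.
have /kcellP[/eqP + _] := Ak; rewrite cardfs_eq0 => /eqP A0; subst A.
rewrite raddfMz /= kbdE; last exact: kcellU1 (some_divisorP sE).
rewrite /kbd_pair /= fsetU0 big_seq_fset1 -{1}[[fset s]%fset]fsetU0 fsetU1K //.
by rewrite -mulrzA -[[fset s]%fset]fsetU0 ksignU1 // ltss mul1r ksign_sqr.
Qed.

Lemma khom_exact k (q : kcell k.+1) : kbd (khom << q >>) + khom (kbd << q >>) = << q >>.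
Proof.
case: q => -[A x] Ak; rewrite -[<< _ >>]kbasisE kbdE // khomE //=.
have /kcellP[cA Ax] := Ak; have [s1 s1A] : exists s, s \in A.
  by case: (fset_0Vmem A) cA => [->|[s ?]]; [rewrite cardfs0|exists s].
have [s sE] := some_divisor_ex (Ax _ s1A).
rewrite /khom_pair /kbd_pair /= sE raddf_sum.
under [X in _ + X]eq_big_seq => t tA.
  rewrite raddfMz /= khomE; last exact: kcellD1 tA.
  rewrite /khom_pair /= sE in_fsetD1.
  over.
have [sA|sA] := boolP (s \in A).
  rewrite raddf0 add0r (big_fsetD1 s) //= eqxx /= big_seq big1 => [|t].
    rewrite addr0 -mulrzA mulrC (ksignD1 lt s sA) ltss mul1r fsetD1K //.
    by rewrite ksign_sqr mulr1z.
  by rewrite in_fsetD1 => /andP[ts _]; rewrite eq_sym ts /= mul0rz.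
rewrite raddfMz /= kbdE; last exact: kcellU1 (some_divisorP sE).
rewrite /kbd_pair /= big_fsetU1 //= mulrzDl -mulrzA ksignU1 // ltss mul1r.
rewrite ksign_sqr mulr1z fsetU1K // -addrA mulrz_suml -big_split /= big_seq.
rewrite big1 ?addr0 // => t tA; have ts : t != s by apply: contraNneq sA => <-.
rewrite andbF -!mulrzA.
have -> : ((s |` A) `\ t = s |` (A `\ t))%fset.
  apply/fsetP => u; rewrite !(in_fsetD1, in_fset1U).
  by case: (u =P s) => [->|_]; rewrite /= ?(eq_sym s) ?ts.
rewrite -mulrzDr [_ * ksign s A]mulrC ksignU1_swap //.
by rewrite [ksign s _ * _]mulrC addNr mulr0z.
Qed.

End Koszul.

(** * Deforming the Koszul complex into a resolution of Z *)

Section Resolution.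
Variables (S : choiceType) (M : monoidType) (gen : S -> M) (len : M -> nat).
Hypothesis gl : garside_like gen len.
Variable lt : rel S.
Hypothesis ltss : irreflexive lt.
Hypothesis lt_flip : forall s t, s != t -> lt t s = ~~ lt s t.
Implicit Types (s t : S) (A : {fset S}) (x y : M) (k : nat).
Local Notation kcell := (kcell gen).
Local Notation Q k := {freeg (kcell k) / int}.
Local Notation kbd := (@kbd S M gen lt _).
Local Notation khom := (@khom S M gen lt _).
Local Notation is_kcell := (is_kcell gen).
Local Notation kbasis := (kbasis gen).

Lemma kcell_mul_subproof k (q : kcell k) x :
  is_kcell k ((val q).1, ((val q).2 * x)%g).
Proof.
case: q => -[A y] /= /kcellP[cA Ay]; apply/kcellP; split=> // s /Ay.
exact: mdvd_mulr.
Qed.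

Definition kcell_mul k x (q : kcell k) : kcell k :=
  exist (fun p => is_kcell k p) _ (kcell_mul_subproof q x).

Definition kact k x : Q k -> Q k := zmap (kcell_mul x).
HB.instance Definition _ k x := GRing.Additive.on (@kact k x).

Lemma kactE k x p : is_kcell k p ->
  kact x (kbasis k p) = kbasis k (p.1, (p.2 * x)%g).
Proof.
move=> pk; pose q : kcell k := exist (fun p => is_kcell k p) p pk.
by rewrite -[p]/(val q) kbasisE [LHS]zmapU -kbasisE.
Qed.

Lemma kact_comp k x y (z : Q k) : kact y (kact x z) = kact (x * y)%g z.
Proof.
pose f : {additive Q k -> Q k} := kact y \o kact x.
apply: (zlin_ext (f := f)) => q /=; rewrite /kact !zmapU.
by congr << _ >>; apply: val_inj; rewrite /= mulgA.
Qed.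

Lemma kbd_act k x (z : Q k.+1) : kbd (kact x z) = kact x (kbd z).
Proof.
pose f : {additive Q k.+1 -> Q k} := kbd \o kact x.
pose g : {additive Q k.+1 -> Q k} := kact x \o kbd.
apply: (zlin_ext (f := f) (g := g)) => -[[A y] Ak] /=.
rewrite [kact _ _]zmapU -[<< _ >>]kbasisE -[<< exist _ _ _ >>]kbasisE.
rewrite !kbdE ?kcell_mul_subproof //= /kbd_pair /= raddf_sum.
apply: eq_big_seq => s sA; rewrite raddfMz /= kactE //; exact: kcellD1 sA.
Qed.

(** The filtration by the length of x. The Koszul differential preserves this length and is the
    leading part of the differentials built below. *)
Definition weight_lt l k (z : Q k) : Prop :=
  supported (fun q : kcell k => (len (val q).2 < l)%N) z.

Lemma weight_kbasis l k p : (len p.2 < l)%N -> weight_lt l (kbasis k p).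
Proof.
have [[q <- ->] ql|-> _] := kbasis_cases gen k p; last exact: supported0.
exact: supportedU.
Qed.

Lemma weight_act l k x (z : Q k) : weight_lt l z -> weight_lt (l + len x) (kact x z).
Proof.
by apply: supported_zlin => q ql; apply: supportedU; rewrite /= (gl_lenM gl) ltn_add2r.
Qed.

Lemma weight_kbd l k (z : Q k.+1) : weight_lt l z -> weight_lt l (kbd z).
Proof.
apply: supported_zlin => q ql; apply: supported_sum => s _.
by apply: supportedMz; apply: weight_kbasis.
Qed.

Lemma weight_khom l k (z : Q k) : weight_lt l z -> weight_lt l (khom z).
Proof.
apply: supported_zlin => q ql; rewrite /khom_pair.
case: some_divisor => [s|]; last exact: supported0.
by case: ifP => _; [exact: supported0|apply: supportedMz; exact: weight_kbasis].
Qed.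

Lemma len1 : len 1%g = 0%N.
Proof. by have := gl_lenM gl 1%g 1%g; rewrite mulg1; lia. Qed.

Lemma mdvd_len x y : mdvd x y -> (len x <= len y)%N.
Proof. by move=> [z ->]; rewrite (gl_lenM gl) leq_addr. Qed.

Lemma len_gt0 x : x <> 1%g -> (0 < len x)%N.
Proof.
move=> /(gl_gen gl)[s /mdvd_len]; apply: leq_trans; exact: gl_len_gen gl s.
Qed.

Lemma kcellS_neq1 k (q : kcell k.+1) : (val q).2 <> 1%g.
Proof.
case: q => -[A x] /= /kcellP[cA Ax] x1.
case: (fset_0Vmem A) cA => [->|[s sA]]; first by rewrite cardfs0.
have := mdvd_len (Ax s sA); rewrite x1 len1 leqn0 => /eqP s0.
by have := gl_len_gen gl s; rewrite s0.
Qed.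

Lemma khom_exact_lin k (z : Q k.+1) : kbd (khom z) + khom (kbd z) = z.
Proof.
pose f : {additive Q k.+1 -> Q k.+1} := (kbd \o khom) \+ (khom \o kbd).
exact: (zlin_ext (f := f) (g := idfun) (khom_exact ltss lt_flip (k := k))).
Qed.

Definition has_multiple A := exists x, forall s, s \in A -> mdvd (gen s) x.

Definition gcell k : choiceType :=
  {A : {fset S} | (#|` A| == k) && `[< has_multiple A >]}.

Definition lcmx A : M :=
  if pselect (exists z, lcm_gen gen A z) is left ex then sval (cid ex) else 1%g.

Lemma lcmxP A : has_multiple A -> lcm_gen gen A (lcmx A).
Proof.
move=> [x /(gl_lcm gl) ex]; rewrite /lcmx; case: pselect => // ex'.
by case: cid.
Qed.

Lemma gcell_lcm k (c : gcell k) : lcm_gen gen (val c) (lcmx (val c)).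
Proof. by apply: lcmxP; case/andP: (valP c) => _ /asboolP. Qed.

Lemma gcell_top_subproof k (c : gcell k) : is_kcell k (val c, lcmx (val c)).
Proof.
apply/kcellP; split; first by case/andP: (valP c) => /eqP.
exact: lcm_gen_dvd (gcell_lcm c).
Qed.

Definition gcell_top k (c : gcell k) : kcell k :=
  exist (fun p => is_kcell k p) _ (gcell_top_subproof c).

Lemma kcell_gen_subproof k (q : kcell k) :
  (#|` (val q).1| == k) && `[< has_multiple (val q).1 >].
Proof.
case: q => -[A x] /= /kcellP[-> Ax]; rewrite eqxx; apply/asboolP.
by exists x.
Qed.

Definition kcell_gen k (q : kcell k) : gcell k :=
  exist (fun A => (#|` A| == k) && `[< has_multiple A >]) _ (kcell_gen_subproof q).

Lemma kcell_quo_ex k (q : kcell k) :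
  exists x, (val q).2 = (lcmx (val q).1 * x)%g.
Proof.
have [_ mini] := gcell_lcm (kcell_gen q); apply: mini.
by case: q => -[A x] /= /kcellP[].
Qed.

(** By cancellation this is the only x with q = (A, lcm A) x, so the cells of degree k form a free
    right M-set on [gcell k]. *)
Definition kcell_quo k (q : kcell k) : M := sval (cid (kcell_quo_ex q)).

Lemma kcell_quoE k (q : kcell k) : q = kcell_mul (kcell_quo q) (gcell_top (kcell_gen q)).
Proof.
apply: val_inj; rewrite /= /kcell_quo; case: cid => x /= <-.
by case: (val q).
Qed.

Lemma kcell_gen_mul k x (q : kcell k) : kcell_gen (kcell_mul x q) = kcell_gen q.
Proof. exact: val_inj. Qed.

Lemma kcell_gen_top k (c : gcell k) : kcell_gen (gcell_top c) = c.
Proof. exact: val_inj. Qed.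

Lemma kcell_quo_mul k x (q : kcell k) :
  kcell_quo (kcell_mul x q) = (kcell_quo q * x)%g.
Proof.
apply: (gl_cancel gl (x := lcmx (val q).1)).
rewrite {1}/kcell_quo; case: cid => y /= <-; rewrite mulgA.
by rewrite /kcell_quo; case: cid => y' /= <-.
Qed.

(* The truncation at degree k of a deformation of the Koszul complex. *)
Record deformed k (T : zmodType) (d : {additive Q k -> T}) : Prop := Deformed {
  deformed_lead : forall l z, weight_lt l.+1 z -> d z = 0 ->
    exists y : Q k.+1, weight_lt l.+1 y /\ weight_lt l (z - kbd y);
  deformed_gen : forall c : gcell k.+1, exists g : Q k,
    weight_lt (len (lcmx (val c))) (g - kbd << gcell_top c >>) /\ d g = 0;
  deformed_act : forall z x, d z = 0 -> d (kact x z) = 0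
}.

Record next_differential k (T : zmodType) (d : {additive Q k -> T})
    (d' : {additive Q k.+1 -> Q k}) : Prop := NextDifferential {
  next_comp : forall z, d (d' z) = 0;
  next_exact : forall z, d z = 0 -> exists w, d' w = z;
  next_act : forall x z, d' (kact x z) = kact x (d' z)
}.

(** Each generator (A, lcm A) is sent to a cycle with the prescribed leading term, and the map is
    extended equivariantly. Exactness follows by removing the top weight of a cycle repeatedly; it
    then supplies the lower-order corrections for the generators of the next degree. *)
Lemma next_exists k (T : zmodType) (d : {additive Q k -> T}) : deformed d ->
  exists d', next_differential d d' /\ deformed d'.
Proof.
move=> [lead gen_ex act]; have [g gP] := choice gen_ex.
pose d'_fun := zlin (fun q : kcell k.+1 => kact (kcell_quo q) (g (kcell_gen q))).
pose d' : {additive Q k.+1 -> Q k} := d'_fun.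
have d'U q : d' << q >> = kact (kcell_quo q) (g (kcell_gen q)) by exact: zlinU.
have dd' z : d (d' z) = 0.
  pose f : {additive Q k.+1 -> T} := d \o d'.
  apply: (zlin_ext (f := f) (g := \0)) => q.
  rewrite /f [LHS]/= d'U; apply: act; exact: (gP _).2.
have d'act x z : d' (kact x z) = kact x (d' z).
  pose f1 : {additive Q k.+1 -> Q k} := d' \o kact x.
  pose f2 : {additive Q k.+1 -> Q k} := kact x \o d'.
  apply: (zlin_ext (f := f1) (g := f2)) => q.
  by rewrite /f1 /f2 /= [kact _ << _ >>]zmapU !d'U kcell_gen_mul kcell_quo_mul kact_comp.
have d'lead l z : weight_lt l.+1 z -> weight_lt l (d' z - kbd z).
  pose f : {additive Q k.+1 -> Q k} := d' \- kbd.
  rewrite [z]freeg_sumMz -[_ - _]/(f _) raddf_sum => zl.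
  rewrite big_seq; apply: supported_sum => q; rewrite mem_dom => qz.
  rewrite raddfMz; apply: supportedMz; rewrite /f /= d'U.
  have ql : (len (val q).2 < l.+1)%N by apply: zl; rewrite -freeg_sumMz.
  have -> : << q >> = kact (kcell_quo q) << gcell_top (kcell_gen q) >>.
    by rewrite [RHS]zmapU -kcell_quoE.
  rewrite kbd_act -raddfB.
  have := weight_act (x := kcell_quo q) (gP (kcell_gen q)).1.
  apply: supported_sub => p; rewrite (kcell_quoE q) /= (gl_lenM gl) in ql.
  by move=> pl; apply: leq_trans pl _.
have d'exact l z : weight_lt l z -> d z = 0 -> exists2 y, weight_lt l y & d' y = z.
  elim: l z => [|l IHl] z zl dz.
    exists 0; first exact: supported0.
    rewrite raddf0 [z]freeg_sumMz big_seq big1 // => q; rewrite mem_dom => /zl.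
    by [].
  have [y0 [y0l zy0]] := lead l z zl dz.
  have [||y1 y1l y1E] := IHl (z - d' y0).
  - have -> : z - d' y0 = (z - kbd y0) - (d' y0 - kbd y0) by rewrite opprB addrA subrK.
    by apply: supportedB zy0 _; exact: d'lead.
  - by rewrite raddfB dz dd' subrr.
  exists (y1 + y0); last by rewrite raddfD y1E subrK.
  by apply: supportedD y0l; apply: supported_sub y1l => q ql; exact: ltnW.
exists d'; split; split=> //.
- move=> z dz; have [l zl] := supported_bound (fun q : kcell k => len (val q).2) z.
  by have [y _ <-] := d'exact l z zl dz; exists y.
(* As d' kills z, the Koszul boundary of z has lower weight, and so has the defect [khom (kbd z)] of
   the contraction. *)
- move=> l z zl d'z; exists (khom z); split; first exact: weight_khom.
  rewrite -{1}[z]khom_exact_lin addrC addKr; apply: weight_khom.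
  by have := d'lead l z zl; rewrite d'z sub0r => /supportedN; rewrite opprK.
(* The Koszul boundary z0 is a cycle for the leading term only; its image has lower weight, and
   exactness gives the correction y. *)
- move=> c; pose z0 := kbd << gcell_top c >>.
  have z0l : weight_lt (len (lcmx (val c))).+1 z0.
    by apply: weight_kbd; apply: supportedU => /=.
  have d'z0 : weight_lt (len (lcmx (val c))) (d' z0).
    by have := d'lead _ _ z0l; rewrite /z0 kbdK // subr0.
  have [y yl yE] := d'exact _ _ d'z0 (dd' z0).
  exists (z0 - y); split; last by rewrite raddfB yE subrr.
  by rewrite addrC addKr; exact: supportedN.
- by move=> z x; rewrite d'act => ->; exact: raddf0.
Qed.

Definition kaug : Q 0 -> int := zlin (fun=> 1).
HB.instance Definition _ := GRing.Additive.on kaug.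

Lemma kaug_act x z : kaug (kact x z) = kaug z.
Proof.
pose f : {additive Q 0 -> int} := kaug \o kact x.
by apply: (zlin_ext (f := f)) => q; rewrite /= [kact _ _]zmapU /kaug !zlinU.
Qed.

Lemma kcell_one_subproof : is_kcell 0 (fset0, 1%g).
Proof. by apply/kcellP; rewrite cardfs0; split. Qed.

Definition kcell_one : kcell 0 :=
  exist (fun p => is_kcell 0 p) _ kcell_one_subproof.

Lemma kcell0_eq (q q' : kcell 0) : (val q).2 = (val q').2 -> q = q'.
Proof.
case: q q' => -[A x] Ak [[A' x'] A'k] /= xx'; apply: val_inj => /=.
move: Ak A'k => /kcellP[/eqP + _] /kcellP[/eqP + _]; rewrite !cardfs_eq0.
by move=> /eqP -> /eqP ->; rewrite xx'.
Qed.

(** The contraction reduces a 0-chain to its part at x = 1, which in the lowest weight is its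
    augmentation times the cell of 1. The cycle attached to a single letter s is the familiar s -
    1. *)
Lemma deformed_aug : deformed kaug.
Proof.
split.
- move=> l z zl augz; exists (khom z); split; first exact: weight_khom.
  pose f : {additive Q 0 -> Q 0} := idfun \- (kbd \o khom).
  pose g (q : kcell 0) : Q 0 := if (val q).2 == 1%g then << kcell_one >> else 0.
  have fg q : f << q >> = g q.
    rewrite /f /g /=; case: eqP => [q1|q1].
      have -> : q = kcell_one by apply: kcell0_eq.
      rewrite -[<< kcell_one >>]kbasisE khomE ?kcell_one_subproof //.
      rewrite /khom_pair /=; case sE: some_divisor => [s|]; last by rewrite raddf0 subr0.
      have := mdvd_len (some_divisorP sE); rewrite len1 leqn0 => /eqP s0.
      by have := gl_len_gen gl s; rewrite s0.
    by rewrite (khom_exact0 gl) // subrr.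
  rewrite -[_ - _]/(f z) (zlin_ext (f := f) (g := zlin g)) => [|q]; last first.
    by rewrite fg; exact/esym/zlinU.
  case: l zl => [|l] zl; last first.
    apply: supported_zlin zl => q ql; rewrite /g; case: eqP => q1; last exact: supported0.
    by apply: supportedU; rewrite /= len1.
  suff zg0 : zlin g z = 0 by rewrite [X in weight_lt _ X]zg0; exact: supported0.
  have -> : zlin g z = << kcell_one >> *~ kaug z; last by rewrite augz mulr0z.
  rewrite [z]freeg_sumMz !raddf_sum; apply: eq_big_seq => q.
  rewrite mem_dom => /zl q1; rewrite !raddfMz /= /kaug !zlinU /g.
  case: eqP => [_|/len_gt0]; last by rewrite lt0n -leqn0 -ltnS q1.
  by [].
- move=> c; have [A cE] : exists A : {fset S}, val c = A by exists (val c).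
  have : (#|` val c| == 1)%N by case/andP: (valP c).
  move=> /cardfs1P[s sE].
  have q0P : is_kcell 0 (fset0, lcmx (val c)).
    by apply/kcellP; rewrite cardfs0; split.
  pose q0 : kcell 0 := exist (fun p => is_kcell 0 p) _ q0P.
  exists (<< q0 >> - << kcell_one >>); split; last first.
    by rewrite raddfB /= /kaug !zlinU subrr.
  have -> : kbd << gcell_top c >> = << q0 >>.
    rewrite -[<< gcell_top c >>]kbasisE kbdE ?gcell_top_subproof //= /kbd_pair /=.
    rewrite sE big_seq_fset1 -{1}[[fset s]%fset]fsetU0 fsetU1K //.
    by rewrite /ksign big_seq_fset1 ltss mulr1z -[RHS]kbasisE /= sE.
  rewrite addrC addKr; apply: supportedN; apply: supportedU => /=.
  rewrite len1; apply: len_gt0 => l1.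
  exact: (kcellS_neq1 (q := gcell_top c)).
- by move=> z x augz; exact: etrans (kaug_act x z) augz.
Qed.

Theorem resolution_exists : exists d : forall k, {additive Q k.+1 -> Q k},
  [/\ forall k x z, d k (kact x z) = kact x (d k z),
      forall k z, d k (d k.+1 z) = 0,
      forall z, kaug (d 0 z) = 0,
      forall z, kaug z = 0 -> exists w, d 0 w = z &
      forall k z, d k z = 0 -> exists w, d k.+1 w = z].
Proof.
pose step k (D : {d : {additive Q k.+1 -> Q k} | deformed d}) :=
  cid (next_exists (svalP D)).
pose base := cid (next_exists deformed_aug).
pose st := nat_rect (fun k => {d : {additive Q k.+1 -> Q k} | deformed d})
  (exist _ (sval base) (svalP base).2)
  (fun k D => exist _ (sval (step k D)) (svalP (step k D)).2).
have nextS k : next_differential (sval (st k)) (sval (st k.+1)).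
  exact: (svalP (step k (st k))).1.
have next0 : next_differential kaug (sval (st 0)) by exact: (svalP base).1.
exists (fun k => sval (st k)); split.
- by case=> [|k] x z; [exact: next_act next0 _ _|exact: next_act (nextS k) _ _].
- by move=> k z; exact: next_comp (nextS k) _.
- exact: next_comp next0.
- by move=> z dz; have [w wE] := next_exact next0 dz; exists w.
- by move=> k z dz; have [w wE] := next_exact (nextS k) dz; exists w.
Qed.

End Resolution.

(** * The nerve with levels *)

Section LayeredNerve.
Variable M : monoidType.
Local Open Scope group_scope.

(* The level of a vertex is the index of an open set of the classifying space *)
(* (see [avoid]) to which a singular simplex is confined. *)
Definition is_layered n (p : n.+1.-tuple nat * n.-tuple M) : bool :=
  [forall i : 'I_n, (nth 0%N p.1 i.+1 <= nth 0%N p.1 i)%N &&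
     ((nth 0%N p.1 i.+1 == nth 0%N p.1 i) ==> (nth 1 p.2 i == 1))].

Definition layered n : choiceType := {p | @is_layered n p}.

Lemma layeredP n (p : n.+1.-tuple nat * n.-tuple M) : reflect
  (forall i, (i < n)%N -> (nth 0%N p.1 i.+1 <= nth 0%N p.1 i)%N /\
     (nth 0%N p.1 i.+1 = nth 0%N p.1 i -> nth 1 p.2 i = 1)) (is_layered p).
Proof.
apply: (iffP forallP) => [H i lin|H i].
  have /andP[le_i /implyP eq_i] := H (Ordinal lin); split=> // /eqP.
  by move=> /eq_i /eqP.
have [le_i eq_i] := H i (ltn_ord i); rewrite le_i.
by apply/implyP => /eqP /eq_i ->.
Qed.

Lemma layered_range n (p : n.+1.-tuple nat * n.-tuple M) a b :
  is_layered p -> (a <= b <= n)%N ->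
  (nth 0%N p.1 b <= nth 0%N p.1 a)%N /\
  (nth 0%N p.1 b = nth 0%N p.1 a -> \prod_(a <= i < b) nth 1 p.2 i = 1).
Proof.
move=> /layeredP pL /andP[/subnK <-]; elim: (b - a)%N => [|d IHd] dn.
  by split=> // _; rewrite big_geq.
have [|le_d eq_d] := IHd; first by lia.
have [|le_1 eq_1] := pL (d + a)%N; first by lia.
rewrite addSn in dn *; split; first exact: leq_trans le_1 le_d.
move=> e; rewrite big_nat_recr ?leq_addl //= eq_d ?eq_1 ?mulg1 //.
  by apply/eqP; rewrite eqn_leq le_1 e le_d.
by apply/eqP; rewrite eqn_leq le_d -e le_1.
Qed.

Definition level_act k n (f : delta_map k n) (ks : n.+1.-tuple nat) : k.+1.-tuple nat :=
  [tuple tnth ks (f j) | j < k.+1].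

Lemma nth_level_act k n (f : delta_map k n) ks (j : nat) : (j < k.+1)%N ->
  nth 0%N (level_act f ks) j = nth 0%N ks (f (inord j)).
Proof.
move=> jk; rewrite -(tnth_nth _ _ (Ordinal jk)) tnth_mktuple (tnth_nth 0%N).
by congr (nth _ _ (f _)); apply: val_inj; rewrite /= inordK.
Qed.

Lemma nth_nerve_act k n (f : delta_map k n) (ws : n.-tuple M) (j : nat) : (j < k)%N ->
  nth 1 (nerve_act f ws) j = \prod_(f (inord j) <= i < f (inord j.+1)) nth 1 ws i.
Proof. by move=> jk; rewrite -(tnth_nth _ _ (Ordinal jk)) tnth_mktuple. Qed.

Lemma layered_act_subproof k n (f : delta_map k n) (p : layered n) :
  is_layered (level_act f (val p).1, nerve_act f (val p).2).
Proof.
apply/layeredP => j jk /=; rewrite !nth_level_act ?ltnS ?nth_nerve_act //.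
  apply: layered_range (valP p) _; apply/andP; split; last by rewrite -ltnS.
  by apply: delta_homo; rewrite !inordK ?ltnS // ltnW.
exact: ltnW.
Qed.

Definition layered_act k n (f : delta_map k n) (p : layered n) : layered k :=
  exist (fun p => @is_layered k p) _ (layered_act_subproof f p).

Lemma layered_act_id n p : layered_act (delta_id n) p = p.
Proof.
apply: val_inj; case: p => -[ks ws] pL /=; congr (_, _); last exact: nerve_act_id.
by apply: eq_from_tnth => j; rewrite tnth_mktuple.
Qed.

Lemma layered_act_comp k l n (f : delta_map l n) (g : delta_map k l) p :
  layered_act (delta_comp f g) p = layered_act g (layered_act f p).
Proof.
apply: val_inj; case: p => -[ks ws] pL /=; congr (_, _); last exact: nerve_act_comp.
by apply: eq_from_tnth => j; rewrite !tnth_mktuple.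
Qed.

Definition layered_nerve : simplicial_set :=
  SimplicialSet layered_act_id layered_act_comp.

(** The element of M that acts when the first i vertices are dropped. *)
Definition head_label n (p : layered n) (i : nat) : M :=
  \prod_(0 <= j < i) nth 1 (val p).2 j.

Lemma head_label_comp k l n (f : delta_map l n) (g : delta_map k l) p :
  head_label p (f (g ord0)) =
  head_label p (f ord0) * head_label (layered_act f p) (g ord0).
Proof.
rewrite /head_label /=; set ws := (val p).2.
have gl : (g ord0 <= l)%N by rewrite -ltnS.
have nth_act j : (0 <= j < g ord0)%N -> nth 1 (nerve_act f ws) j =
    \prod_(f (inord j) <= i < f (inord j.+1)) nth 1 ws i.
  by move=> /andP[_ jg]; apply: nth_nerve_act; exact: leq_trans jg gl.
rewrite [X in _ * X](eq_big_nat _ _ nth_act).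
rewrite (prod_telescope (h := fun j => f (inord j))) // => [|j /andP[_ jg]].
  have -> : inord 0 = ord0 :> 'I_l.+1 by apply: val_inj; rewrite /= inordK.
  rewrite inord_val -big_cat_nat //=; apply: delta_homo => //.
by apply: delta_homo; rewrite !inordK; lia.
Qed.

Section ConeOfTuples.
Variables (k n : nat) (f : delta_map k n) (F : delta_map k.+1 n.+1).
Hypothesis F0 : F ord0 = ord0.
Hypothesis FS : forall j, F (fintype.lift ord0 j) = fintype.lift ord0 (f j).

Lemma cone_val (j : nat) : (j < k.+1)%N -> F (inord j.+1) = (f (inord j)).+1 :> nat.
Proof.
move=> jk; have -> : inord j.+1 = fintype.lift ord0 (inord j : 'I_k.+1).
  by apply: val_inj; rewrite /= /bump /= add1n !inordK.
by rewrite FS.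
Qed.

Lemma cone_val0 : F (inord 0) = 0%N :> nat.
Proof.
by have -> : inord 0 = ord0 :> 'I_k.+2; [apply: val_inj; rewrite /= inordK|rewrite F0].
Qed.

Lemma level_act_cone a (ks : n.+1.-tuple nat) :
  level_act F [tuple of a :: ks] = [tuple of a :: level_act f ks].
Proof.
apply: eq_from_tnth => j; rewrite tnth_mktuple.
case: (unliftP ord0 j) => [i ->|->]; first by rewrite FS !tnthS tnth_mktuple.
by rewrite F0 !tnth0.
Qed.

Lemma nerve_act_cone x (ws : n.-tuple M) :
  nerve_act F [tuple of x :: ws] =
  [tuple of x * \prod_(0 <= i < f ord0) nth 1 ws i :: nerve_act f ws].
Proof.
have val0 : inord 0 = ord0 :> 'I_k.+1 by apply: val_inj; rewrite /= inordK.
apply: eq_from_tnth => j; rewrite tnth_mktuple.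
case: (unliftP ord0 j) => [i ->|->].
  have e : fintype.lift ord0 i = i.+1 :> nat by [].
  have ik := ltn_ord i; rewrite tnthS tnth_mktuple e !cone_val ?ltnS //.
    by rewrite big_add1.
  exact: ltnW.
rewrite tnth0 /= cone_val0 cone_val // big_nat_recl //=.
by rewrite (_ : inord 0 = ord0) //; apply: val_inj; rewrite /= inordK.
Qed.

End ConeOfTuples.

End LayeredNerve.

Section TranslatedNerve.
Variables (M : monoidType) (E : choiceType) (act : M -> E -> E).
Hypothesis act1 : forall e, act 1%g e = e.
Hypothesis actM : forall x y e, act y (act x e) = act (x * y)%g e.

(** The bar construction of a right M-set E: the element of E sits at the first vertex and is moved
    by the labels dropped in front of it. *)
Definition trans_act k n (f : delta_map k n) (p : E * layered M n) : E * layered M k :=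
  (act (head_label p.2 (f ord0)) p.1, layered_act f p.2).

Lemma trans_act_id n p : trans_act (delta_id n) p = p.
Proof.
case: p => e p; rewrite /trans_act /= layered_act_id.
by rewrite /head_label big_geq // act1.
Qed.

Lemma trans_act_comp k l n (f : delta_map l n) (g : delta_map k l) p :
  trans_act (delta_comp f g) p = trans_act g (trans_act f p).
Proof.
case: p => e p; rewrite /trans_act /= layered_act_comp actM.
by rewrite head_label_comp.
Qed.

Definition translated_nerve : simplicial_set :=
  @SimplicialSet (fun n => (E * layered M n)%type : choiceType) trans_act
    trans_act_id trans_act_comp.

End TranslatedNerve.

Section ConesOfLayers.
Variable M : monoidType.

Definition level0 n (p : layered M n) : nat := nth 0%N (val p).1 0.

(** A new first vertex strictly above all others may carry any label x: this is the room for cones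
    that levels provide. The maximum makes the cone defined for every p; when a exceeds the levels
    in use, the new level is a itself and the cone commutes with faces. *)
Lemma cone_layer_subproof a x n (p : layered M n) :
  is_layered ([tuple of maxn a (level0 p).+1 :: (val p).1],
              [tuple of x :: (val p).2] : n.+1.-tuple M).
Proof.
apply/layeredP => -[|i] lt_in /=; last exact: (layeredP _ (valP p)).
by rewrite -/(level0 p); split=> [|e]; [|have := leq_maxr a (level0 p).+1]; lia.
Qed.

Definition cone_layer a x n (p : layered M n) : layered M n.+1 :=
  exist (fun p => @is_layered M n.+1 p) _ (cone_layer_subproof a x p).

Lemma coface0_cone a x n (p : layered M n) :
  layered_act (coface ord0) (cone_layer a x p) = p.
Proof.
apply: val_inj; case: p => -[ks ws] pL /=; congr (_, _).
  by apply: eq_from_tnth => j; rewrite tnth_mktuple /= tnthS.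
apply: eq_from_tnth => j; rewrite tnth_mktuple /= /bump /= !add1n.
by rewrite !inordK ?ltnS // 1?ltnW // big_nat1 (tnth_nth 1%g).
Qed.

Lemma coface_lift_ord0 n (i : 'I_n.+2) :
  coface (fintype.lift ord0 i) ord0 = ord0.
Proof. exact: val_inj. Qed.

Lemma coface_lift_lift n (i : 'I_n.+2) (j : 'I_n.+1) :
  coface (fintype.lift ord0 i) (fintype.lift ord0 j) = fintype.lift ord0 (coface i j).
Proof. by apply: val_inj; rewrite /= /bump; lia. Qed.

Lemma level0_coface n (p : layered M n.+1) (i : 'I_n.+2) :
  (level0 (layered_act (coface i) p) <= level0 p)%N.
Proof.
rewrite /level0 [(val (layered_act _ _)).1]/(level_act (coface i) (val p).1) nth_level_act //.
have /= := @layered_range _ _ _ 0 (coface i (inord 0)) (valP p).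
by case=> [|//]; exact: (ltn_ord (coface i (inord 0))).
Qed.

Lemma cofaceS_cone a x n (p : layered M n.+1) (i : 'I_n.+2) : (level0 p < a)%N ->
  layered_act (coface (fintype.lift ord0 i)) (cone_layer a x p) =
  cone_layer a (x * head_label p (coface i ord0))%g (layered_act (coface i) p).
Proof.
move=> pa; have pa' := leq_ltn_trans (level0_coface p i) pa.
apply: val_inj => /=; rewrite (maxn_idPl pa) (maxn_idPl pa').
congr (_, _).
  exact: (level_act_cone (coface_lift_ord0 i) (coface_lift_lift i)).
rewrite (nerve_act_cone (coface_lift_ord0 i) (coface_lift_lift i)).
exact: val_inj.
Qed.

Lemma cofacemax_cone a x (p q : layered M 0) : (level0 p < a)%N -> (level0 q < a)%N ->
  layered_act (coface ord_max) (cone_layer a x p) =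
  layered_act (coface ord_max) (cone_layer a 1%g q).
Proof.
move=> pa qa; apply: val_inj => /=; rewrite (maxn_idPl pa) (maxn_idPl qa).
congr (_, _); last by rewrite [LHS]tuple0 [RHS]tuple0.
by apply: eq_from_tnth => j; rewrite !tnth_mktuple !(tnth_nth 0%N) /= ord1.
Qed.

End ConesOfLayers.

(** * From the layered nerve to the small complex *)

Section AlgebraicDoubleComplex.
Variables (S : choiceType) (M : monoidType) (gen : S -> M) (len : M -> nat).
Hypothesis gl : garside_like gen len.
Variable lt : rel S.
Local Notation kcell := (kcell gen).
Local Notation gcell := (gcell gen).
Local Notation Q k := {freeg (kcell k) / int}.
Variable d : forall k, {additive Q k.+1 -> Q k}.
Hypothesis d_act : forall k x z, d k (kact x z) = kact x (d k z).
Hypothesis dK : forall k z, d k (d k.+1 z) = 0.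
Hypothesis daug : forall z, kaug (d 0 z) = 0.
Hypothesis dexact0 : forall z, kaug z = 0 -> exists w, d 0 w = z.
Hypothesis dexactS : forall k z, d k z = 0 -> exists w, d k.+1 w = z.

Lemma kcell_mul1 k (c : kcell k) : kcell_mul 1%g c = c.
Proof. by apply: val_inj; rewrite /= mulg1; case: (val c). Qed.

Lemma kcell_mulM k x y (c : kcell k) :
  kcell_mul y (kcell_mul x c) = kcell_mul (x * y)%g c.
Proof. by apply: val_inj; rewrite /= mulgA. Qed.

Definition cell_nerve k : simplicial_set :=
  translated_nerve (@kcell_mul1 k) (@kcell_mulM k).

Local Notation DD p q := {freeg (cell_nerve p q) / int}.

Definition tens p q (y : layered M q) : Q p -> DD p q := zmap (fun c => (c, y)).
HB.instance Definition _ p q y := GRing.Additive.on (@tens p q y).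

Definition ad_h p q : DD p.+1 q -> DD p q := zlin (fun cy => tens cy.2 (d p << cy.1 >>)).
HB.instance Definition _ p q := GRing.Additive.on (@ad_h p q).

Lemma ad_h_tens p q y z : ad_h (@tens p.+1 q y z) = tens y (d p z).
Proof.
pose f : {additive Q p.+1 -> DD p q} := @ad_h p q \o tens y.
pose g : {additive Q p.+1 -> DD p q} := tens y \o d p.
by apply: (zlin_ext (f := f) (g := g)) => c /=; rewrite [tens _ _]zmapU [LHS]zlinU.
Qed.

Lemma ad_hU p q c y : @ad_h p q << (c, y) >> = tens y (d p << c >>).
Proof. exact: zlinU. Qed.

Lemma ad_v_tens p q (y : layered M q.+1) z :
  simplicial_diff (X := cell_nerve p) (tens y z) = \sum_(i < q.+2)
    tens (layered_act (coface i) y) (kact (head_label y (coface i ord0)) z)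
      *~ (-1) ^+ i.
Proof.
pose f : {additive Q p -> DD p q} := @simplicial_diff (cell_nerve p) q \o tens y.
rewrite -[LHS]/(f z) [z]freeg_sumMz raddf_sum.
under [RHS]eq_bigr do rewrite !raddf_sum mulrz_suml.
rewrite exchange_big /=; apply: eq_bigr => c _.
rewrite !raddfMz /f /= [tens _ _]zmapU simplicial_diffU mulrz_suml.
apply: eq_bigr => i _; rewrite !raddfMz /= [kact _ _]zmapU [tens _ _]zmapU.
by rewrite -!mulrzA mulrC.
Qed.

Lemma ad_hh p q (x : DD p.+2 q) : ad_h (ad_h x) = 0.
Proof.
pose f : {additive DD p.+2 q -> DD p q} := @ad_h p q \o @ad_h p.+1 q.
apply: (zlin_ext (f := f) (g := \0)) => -[c y].
by rewrite /f /= ad_hU ad_h_tens dK raddf0.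
Qed.

Lemma ad_hv p q (x : DD p.+1 q.+1) :
  ad_h (simplicial_diff (X := cell_nerve p.+1) x) =
  simplicial_diff (X := cell_nerve p) (ad_h x).
Proof.
pose f : {additive DD p.+1 q.+1 -> DD p q} :=
  @ad_h p q \o @simplicial_diff (cell_nerve p.+1) q.
pose g : {additive DD p.+1 q.+1 -> DD p q} :=
  @simplicial_diff (cell_nerve p) q \o @ad_h p q.+1.
apply: (zlin_ext (f := f) (g := g)) => -[c y]; rewrite /f /g /= ad_hU ad_v_tens.
rewrite -[<< (c, y) >>](zmapU (fun c => (c, y))) -/(tens y _) ad_v_tens raddf_sum.
by apply: eq_bigr => i _; rewrite raddfMz /= ad_h_tens d_act.
Qed.

Definition ad_complex : double_complex :=
  @DoubleComplex (fun p q => DD p q) (fun p q => @ad_h p q)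
    (fun p q => @simplicial_diff (cell_nerve p) q)
    ad_hh (fun p q => @simplicial_diffK (cell_nerve p) q) ad_hv.

Local Notation BB := (simplicial_chains (layered_nerve M)).

Definition ad_augA q : DD 0 q -> {freeg (layered M q) / int} := zmap snd.
HB.instance Definition _ q := GRing.Additive.on (@ad_augA q).

Lemma ad_augA_tens q y z : ad_augA (@tens 0 q y z) = << y >> *~ kaug z.
Proof.
rewrite [z]freeg_sumMz !raddf_sum; apply: eq_bigr => c _.
rewrite !raddfMz /= [tens _ _]zmapU [ad_augA _]zmapU /kaug zlinU /=.
by rewrite -mulrzA mul1r.
Qed.

Lemma ad_augA_h q (x : DD 1 q) : ad_augA (ad_h x) = 0.
Proof.
pose f : {additive DD 1 q -> {freeg (layered M q) / int}} := @ad_augA q \o @ad_h 0 q.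
apply: (zlin_ext (f := f) (g := \0)) => -[c y].
by rewrite /f /= ad_hU ad_augA_tens daug mulr0z.
Qed.

Lemma ad_augA_v q (x : DD 0 q.+1) :
  ad_augA (simplicial_diff (X := cell_nerve 0) x) =
  simplicial_diff (X := layered_nerve M) (ad_augA x).
Proof.
pose f : {additive DD 0 q.+1 -> {freeg (layered M q) / int}} :=
  @ad_augA q \o @simplicial_diff (cell_nerve 0) q.
pose g : {additive DD 0 q.+1 -> {freeg (layered M q) / int}} :=
  @simplicial_diff (layered_nerve M) q \o @ad_augA q.+1.
apply: (zlin_ext (f := f) (g := g)) => -[c y]; rewrite /f /g /=.
rewrite [ad_augA << _ >>]zmapU !simplicial_diffU raddf_sum.
by apply: eq_bigr => i _; rewrite raddfMz /= [ad_augA _]zmapU.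
Qed.

Definition ad_rowaug : row_augmentation ad_complex BB :=
  @RowAug ad_complex BB (fun q => @ad_augA q) ad_augA_h ad_augA_v.

(** The coefficient along the layer y; it reduces exactness of the rows to exactness of the
    resolution. *)
Definition slice p q (y : layered M q) : DD p q -> Q p :=
  zlin (fun cy => if cy.2 == y then << cy.1 >> else 0).
HB.instance Definition _ p q y := GRing.Additive.on (@slice p q y).

Lemma slice_tens p q y y' z :
  slice y' (@tens p q y z) = if y == y' then z else 0.
Proof.
rewrite [z]freeg_sumMz !raddf_sum.
case: eqP => [yy'|yy']; [apply: eq_bigr|apply: big1] => c _; rewrite !raddfMz /=.
  by rewrite [tens _ _]zmapU [slice _ _]zlinU /= yy' eqxx.
by rewrite [tens _ _]zmapU [slice _ _]zlinU /=; case: eqP; rewrite ?mul0rz.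
Qed.

Lemma sum_slice p q (z : DD p q) (ys : seq (layered M q)) : uniq ys ->
  supported (fun cy => cy.2 \in ys) z -> z = \sum_(y <- ys) tens y (slice y z).
Proof.
move=> uys zys; rewrite [in LHS](freeg_sumMz z).
under [RHS]eq_bigr do rewrite {1}[z]freeg_sumMz !raddf_sum.
rewrite exchange_big /=; apply: eq_big_seq => -[c y]; rewrite mem_dom => /zys /= yys.
rewrite (bigD1_seq y) //= !raddfMz /= [slice _ _]zlinU /= eqxx [tens _ _]zmapU.
rewrite big1 ?addr0 // => y' y'y; rewrite !raddfMz /= [slice _ _]zlinU /=.
by rewrite eq_sym (negbTE y'y) raddf0 mul0rz.
Qed.

Lemma slice_ad_h p q y (z : DD p.+1 q) : slice y (ad_h z) = d p (slice y z).
Proof.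
pose f : {additive DD p.+1 q -> Q p} := slice y \o @ad_h p q.
pose g : {additive DD p.+1 q -> Q p} := d p \o slice y.
apply: (zlin_ext (f := f) (g := g)) => -[c y']; rewrite /f /g /= ad_hU slice_tens.
by rewrite [slice _ _]zlinU /=; case: eqP; rewrite ?raddf0.
Qed.

Lemma tens_exact p q (z : DD p q) :
  (forall y, exists w, d p w = slice y z) -> exists w, ad_h w = z.
Proof.
move=> /choice[w wE]; pose ys := undup [seq cy.2 | cy <- dom z].
exists (\sum_(y <- ys) tens y (w y)); rewrite raddf_sum /=.
rewrite [RHS](@sum_slice _ _ z ys) ?undup_uniq //.
  by apply: eq_bigr => y _; rewrite ad_h_tens wE.
by move=> cy; rewrite -mem_dom mem_undup; exact: map_f.
Qed.

Lemma kaug_slice q y (z : DD 0 q) : kaug (slice y z) = coeff y (ad_augA z).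
Proof.
pose f : {additive DD 0 q -> int} := @kaug _ _ gen \o slice y.
pose g : {additive DD 0 q -> int} := coeff y \o @ad_augA q.
apply: (zlin_ext (f := f) (g := g)) => -[c y']; rewrite /f /g /=.
rewrite [slice _ _]zlinU [ad_augA _]zmapU coeffU mul1r /=.
by case: eqP => _; rewrite ?raddf0 // /kaug zlinU.
Qed.

Lemma ad_rows_exact : rows_exact ad_rowaug.
Proof.
split=> [q z|p q z] dz; apply: tens_exact => y.
  by apply: dexact0; rewrite kaug_slice [ad_augA z]dz coeff0.
by apply: dexactS; rewrite -slice_ad_h [ad_h z]dz raddf0.
Qed.

Lemma ad_aug_onto : aug_onto ad_rowaug.
Proof.
have onto q (a : {freeg (layered M q) / int}) : exists x : DD 0 q, ad_augA x = a.
  exists (zmap (fun y => (kcell_one gen, y)) a).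
  pose f : {additive {freeg (layered M q) / int} -> {freeg (layered M q) / int}} :=
    @ad_augA q \o zmap (fun y => (kcell_one gen, y)).
  apply: (zlin_ext (f := f) (g := idfun)) => y.
  by rewrite /f /= zmapU [ad_augA _]zmapU.
split=> [a|q a _]; have [x xa] := onto _ a; exists 0, x.
  by rewrite raddf0 addr0 [RHS]xa.
by rewrite raddf0 addr0 [RHS]xa.
Qed.

Local Notation C k := {freeg (gcell k) / int}.

(** Passage to the coinvariants of M. *)
Definition to_gen k : Q k -> C k := zmap (@kcell_gen _ _ gen k).
HB.instance Definition _ k := GRing.Additive.on (@to_gen k).

Definition gen_diff k : C k.+1 -> C k :=
  zlin (fun c => to_gen (d k << gcell_top gl c >>)).
HB.instance Definition _ k := GRing.Additive.on (@gen_diff k).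

Lemma to_gen_act k x (z : Q k) : to_gen (kact x z) = to_gen z.
Proof.
pose f : {additive Q k -> C k} := @to_gen k \o kact x.
apply: (zlin_ext (f := f)) => c; rewrite /f /= [kact _ _]zmapU [LHS]zmapU [RHS]zmapU.
by rewrite kcell_gen_mul.
Qed.

Lemma gen_diff_to_gen k (z : Q k.+1) : gen_diff (to_gen z) = to_gen (d k z).
Proof.
pose f : {additive Q k.+1 -> C k} := @gen_diff k \o @to_gen k.+1.
pose g : {additive Q k.+1 -> C k} := @to_gen k \o d k.
apply: (zlin_ext (f := f) (g := g)) => c; rewrite /f /g /=.
rewrite [to_gen _]zmapU [LHS]zlinU.
have -> : << c >> = kact (kcell_quo gl c) << gcell_top gl (kcell_gen c) >>.
  by rewrite [RHS]zmapU -kcell_quoE.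
by rewrite d_act to_gen_act.
Qed.

Lemma gen_diffK k (z : C k.+2) : gen_diff (gen_diff z) = 0.
Proof.
pose f : {additive C k.+2 -> C k} := @gen_diff k \o @gen_diff k.+1.
apply: (zlin_ext (f := f) (g := \0)) => c; rewrite /f /=.
by rewrite [gen_diff << c >>]zlinU gen_diff_to_gen dK raddf0.
Qed.

Definition gen_complex : chain_complex :=
  @ChainComplex (fun k => C k) (fun k => @gen_diff k) gen_diffK.

Definition ad_augB p : DD p 0 -> C p := zmap (fun cy => kcell_gen cy.1).
HB.instance Definition _ p := GRing.Additive.on (@ad_augB p).

Lemma ad_augB_tens p y (z : Q p) : ad_augB (tens y z) = to_gen z.
Proof.
pose f : {additive Q p -> C p} := @ad_augB p \o tens y.
apply: (zlin_ext (f := f)) => c; rewrite /f /=.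
by rewrite [tens _ _]zmapU [LHS]zmapU [RHS]zmapU.
Qed.

Lemma ad_augB_v p (x : DD p 1) :
  ad_augB (simplicial_diff (X := cell_nerve p) x) = 0.
Proof.
pose f : {additive DD p 1 -> C p} := @ad_augB p \o @simplicial_diff (cell_nerve p) 0.
apply: (zlin_ext (f := f) (g := \0)) => -[c y]; rewrite /f /=.
rewrite -[<< (c, y) >>](zmapU (fun c => (c, y))) -/(tens y _) ad_v_tens raddf_sum.
rewrite !big_ord_recl big_ord0 !raddfMz /= !ad_augB_tens !to_gen_act addr0.
by rewrite mulrNz subrr.
Qed.

Lemma ad_augB_h p (x : DD p.+1 0) : ad_augB (ad_h x) = gen_diff (ad_augB x).
Proof.
pose f : {additive DD p.+1 0 -> C p} := @ad_augB p \o @ad_h p 0.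
pose g : {additive DD p.+1 0 -> C p} := @gen_diff p \o @ad_augB p.+1.
apply: (zlin_ext (f := f) (g := g)) => -[c y]; rewrite /f /g /=.
rewrite ad_hU ad_augB_tens [ad_augB _]zmapU /= -gen_diff_to_gen.
by rewrite [to_gen _]zmapU.
Qed.

Definition ad_colaug : row_augmentation (dc_transpose ad_complex) gen_complex :=
  @RowAug (dc_transpose ad_complex) gen_complex (fun p => @ad_augB p)
    ad_augB_v ad_augB_h.

(** Over each generator the bar construction of the free M-set of cells is contractible: the
    quotient of c by its generator becomes the label of a new first edge. *)
Definition ad_cone a p q (cy : cell_nerve p q) : cell_nerve p q.+1 :=
  (gcell_top gl (kcell_gen cy.1), cone_layer a (kcell_quo gl cy.1) cy.2).

Lemma ad_cone0 a p q (cy : cell_nerve p q) : sact (coface ord0) (ad_cone a cy) = cy.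
Proof.
case: cy => c y; congr (_, _); last exact: coface0_cone.
rewrite /head_label /= /bump /= big_nat1 /=.
exact: esym (kcell_quoE gl c).
Qed.

Lemma ad_coneS a p q (cy : cell_nerve p q.+1) (i : 'I_q.+2) : (level0 cy.2 < a)%N ->
  sact (coface (fintype.lift ord0 i)) (ad_cone a cy) =
  ad_cone a (sact (coface i) cy).
Proof.
case: cy => c y ya; rewrite /ad_cone /= /trans_act [(_, _).1]/= [(_, _).2]/=.
congr (_, _); last by rewrite cofaceS_cone // kcell_quo_mul.
rewrite kcell_gen_mul /head_label coface_lift_ord0 big_geq //.
by rewrite kcell_mul1.
Qed.

Lemma ad_cols_exact : rows_exact ad_colaug.
Proof.
split=> [p z|q p z] dz.
  have [a za] := supported_bound (fun cy : cell_nerve p 0 => level0 cy.2) z.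
  exists (zmap (@ad_cone a p 0) z).
  have y0P : is_layered ([tuple 0%N], [tuple] : 0.-tuple M) by apply/layeredP.
  pose y0 : layered M 0 := exist (fun p => @is_layered M 0 p) _ y0P.
  (* The left-over vertex of the cone depends only on the generator of the cell, so it factors
     through the augmentation. *)
  pose base (c : gcell p) : DD p 0 :=
    << (gcell_top gl c, layered_act (coface ord_max) (cone_layer a 1%g y0)) >>.
  pose f : {additive DD p 0 -> DD p 0} :=
    @simplicial_diff (cell_nerve p) 0 \o zmap (@ad_cone a p 0).
  pose g : {additive DD p 0 -> DD p 0} := idfun \- (zlin base \o @ad_augB p).
  have fg : f z = g z.
    apply: supported_ext za => -[c y] ya; rewrite /f /g /= zmapU.
    rewrite cone_diff0; last exact: ad_cone0.
    congr (_ - _); rewrite [ad_augB _]zmapU zlinU; congr << (_, _) >>.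
      rewrite /= /head_label /bump /= big_geq // kcell_mul1 //.
    rewrite (@cofacemax_cone _ a _ _ y0) //.
    by apply: leq_ltn_trans ya.
  rewrite -[LHS]/(f z) fg /g /= [ad_augB z]dz raddf0 subr0 //.
have [a za] := supported_bound (fun cy : cell_nerve p q.+1 => level0 cy.2) z.
exists (zmap (@ad_cone a p q.+1) z).
rewrite [LHS](cone_first_exact (H := @ad_cone a p) za).
  by rewrite [simplicial_diff z]dz raddf0 subr0.
by move=> cy cya; split=> [|i]; [exact: ad_cone0|exact: ad_coneS].
Qed.

Theorem gen_complex_homology n :
  zmod_iso (homology BB n) (homology gen_complex n).
Proof.
apply: (double_complex_iso ad_rows_exact ad_aug_onto ad_cols_exact) => p b.
have y0P : is_layered ([tuple 0%N], [tuple] : 0.-tuple M) by apply/layeredP.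
pose y0 : layered M 0 := exist (fun p => @is_layered M 0 p) _ y0P.
exists (zmap (fun c => (gcell_top gl c, y0)) b).
pose f : {additive C p -> C p} := @ad_augB p \o zmap (fun c => (gcell_top gl c, y0)).
apply: (zlin_ext (f := f) (g := idfun)) => c; rewrite /f /= zmapU [LHS]zmapU.
by rewrite kcell_gen_top.
Qed.

End AlgebraicDoubleComplex.

Arguments std_simplex : clear implicits.

(** * Configurations on the interval *)

Section PartialSums.
Variable R : realType.
Local Notation Delta := (std_simplex R).

(** A point of the simplex is read as a nondecreasing sequence in [0, 1]. Structure maps then select
    terms of it ([psum_push_below]) and self-maps of [0, 1] act termwise, so the two commute. *)
Definition psum n (t : 'rV[R]_n) (i : nat) : R := \sum_(j < n | (j < i)%N) t 0 j.

Lemma psum0 n (t : 'rV[R]_n) : psum t 0 = 0.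
Proof. by rewrite /psum big_pred0. Qed.

Lemma psumS n (t : 'rV[R]_n) (i : 'I_n) : psum t i.+1 = psum t i + t 0 i.
Proof.
rewrite /psum (bigD1 i) //= addrC; congr (_ + _); apply: eq_bigl => j.
by rewrite ltnS ltn_neqAle andbC.
Qed.

Lemma psum_coord n (t : 'rV[R]_n) (i : 'I_n) : t 0 i = psum t i.+1 - psum t i.
Proof. by rewrite psumS addrAC subrr add0r. Qed.

Lemma psum_inj n (t u : 'rV[R]_n) : psum t =1 psum u -> t = u.
Proof. by move=> tu; apply/rowP => i; rewrite !psum_coord !tu. Qed.

Lemma psum_row (h : nat -> R) n i : (i <= n)%N -> h 0%N = 0 ->
  psum (\row_(j < n) (h j.+1 - h j)) i = h i.
Proof.
move=> + h0; elim: i => [|i IHi] lin; first by rewrite psum0 h0.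
by rewrite (psumS _ (Ordinal lin)) IHi ?(ltnW lin) // mxE addrC subrK.
Qed.

Section Simplex.
Variables (n : nat) (t : Delta n).

Lemma simplex_ge0 i : 0 <= (val t) 0 i.
Proof. by have [] := set_mem (valP t). Qed.

Lemma psum_full i : (n < i)%N -> psum (val t) i = 1.
Proof.
move=> ni; have [_ <-] := set_mem (valP t); apply: eq_bigl => j.
exact: leq_trans (ltn_ord j) ni.
Qed.

Lemma psum_mono i j : (i <= j)%N -> psum (val t) i <= psum (val t) j.
Proof.
move=> ij; rewrite /psum [leRHS]big_mkcond [leLHS]big_mkcond.
apply: ler_sum => l _; case: ifP => li; first by rewrite (leq_trans li ij).
by case: ifP => // _; exact: simplex_ge0.
Qed.

End Simplex.

Lemma delta_threshold k n (f : delta_map k n) i :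
  exists2 c, (c <= k.+1)%N & forall l, (f l < i)%N = (l < c)%N.
Proof.
have [/existsP[l0 il0]|/existsPn none] := boolP [exists l, (i <= f l)%N].
  case: (@arg_minnP _ l0 (fun l => (i <= f l)%N) (fun l : 'I_k.+1 => l : nat) il0) => c ic cmin; exists c.
    exact: ltnW.
  move=> l; apply/idP/idP => [fl|lc]; rewrite ltnNge; apply/negP.
    by move=> /(delta_homo f) /(leq_trans ic); rewrite leqNgt fl.
  by move=> /cmin; rewrite leqNgt lc.
exists k.+1 => // l; rewrite ltn_ord; have := none l.
by rewrite -ltnNge.
Qed.

Lemma psum_push k n (f : delta_map k n) (t : 'rV[R]_k.+1) i :
  psum (simplex_push f t) i = \sum_(l | (f l < i)%N) t 0 l.
Proof.
rewrite (partition_big f (fun j : 'I_n.+1 => (j < i)%N)) //=.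
apply: eq_bigr => j ji; rewrite mxE; apply: eq_bigl => l.
by case: eqP => [->|]; rewrite ?ji // andbF.
Qed.

Lemma psum_push_below k n (f : delta_map k n) (t : 'rV[R]_k.+1) i c :
  (forall l, (f l < i)%N = (l < c)%N) ->
  psum (simplex_push f t) i = psum t c.
Proof. by move=> fc; rewrite psum_push; apply: eq_bigl => l; rewrite fc. Qed.

(* A nondecreasing self-map of [0, 1] acts on points seen as sequences of *)
(* partial sums. *)
Definition reparam_row n (phi : R -> R) (t : 'rV[R]_n) : 'rV[R]_n :=
  \row_j (phi (psum t j.+1) - phi (psum t j)).

Lemma psum_reparam n phi (t : Delta n) i : phi 0 = 0 ->
  psum (reparam_row phi (val t)) i = phi (psum (val t) i).
Proof.
move=> phi0; have [ni|ni] := leqP i n.+1.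
  by rewrite (psum_row (h := fun i => phi (psum (val t) i))) // psum0.
rewrite (psum_full t (ltnW ni)) -(psum_full t (ltnSn n)).
rewrite -(psum_row (h := fun i => phi (psum (val t) i)) (leqnn n.+1)) ?psum0 //.
by apply: eq_bigl => j; rewrite ltn_ord (ltn_trans (ltn_ord j) ni).
Qed.

Record unit_reparam (phi : R -> R) : Prop := UnitReparam {
  unit_reparam0 : phi 0 = 0;
  unit_reparam1 : phi 1 = 1;
  unit_reparam_homo : {homo phi : r s / r <= s}
}.

Lemma reparam_simplex n phi (t : Delta n) : unit_reparam phi ->
  reparam_row phi (val t) \in Delta n.
Proof.
move=> [phi0 phi1 phi_homo]; apply/mem_set; split=> [j|].
  by rewrite mxE subr_ge0; apply/phi_homo/psum_mono.
have := psum_reparam t n.+1 phi0; rewrite psum_full // phi1 => <-.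
by apply: eq_bigl => j; rewrite ltn_ord.
Qed.

Definition reparam n phi (phiP : unit_reparam phi) (t : Delta n) : Delta n :=
  exist (fun u => u \in Delta n) _ (reparam_simplex t phiP).

Lemma reparam_map k n phi (phiP : unit_reparam phi) (f : delta_map k n) (t : Delta k) :
  reparam phiP (simplex_map f t) = simplex_map f (reparam phiP t).
Proof.
apply/val_inj/psum_inj => i; have phi0 := unit_reparam0 phiP.
have [c _ fc] := delta_threshold f i.
rewrite [LHS](psum_reparam _ _ phi0) [val (simplex_map _ _)]/=.
by rewrite !(psum_push_below _ fc) [RHS](psum_reparam _ _ phi0).
Qed.

Lemma psum_continuous n i : continuous (fun t : Delta n => psum (val t) i).
Proof.
have sum_cont : continuous (fun u : 'rV[R]_n.+1 => psum u i).
  apply: (continuous_big (op := fun x y : R => x + y)) => [|j _].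
    exact: add_continuous.
  exact: coord_continuous.
move=> t; apply: (continuous_comp (f := @set_val _ (Delta n)) (g := fun u => psum u i)).
  exact: initial_continuous.
exact: sum_cont.
Qed.

Lemma simplex_continuous (T : topologicalType) n (h : T -> Delta n) :
  (forall i, continuous (fun u => (val (h u)) 0 i)) -> continuous h.
Proof.
move=> hc; apply: continuous_comp_initial => u A /= [P uP sPA].
suff : \forall v \near u, forall i j, P i j (val (h v) i j).
  by apply: filterS => v Pv; apply: sPA => i j; rewrite set_valE.
apply: (filter_forall (F := nbhs u)
  (f := fun i v => forall j, P i j (val (h v) i j))) => i.
apply: (filter_forall (F := nbhs u) (f := fun j v => P i j (val (h v) i j))) => j.
by have := uP i j; rewrite set_valE ord1 => /(hc j u).
Qed.

End PartialSums.

Section Labels.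
Variables (R : realType) (M : monoidType).
Hypothesis conical : forall x y : M, (x * y = 1 -> x = 1 /\ y = 1)%g.
Local Notation Delta := (std_simplex R).
Local Notation cells := (realization_cells R (nerve M)).
Local Notation Y := (classifying_space R M).
Local Open Scope group_scope.

Definition bpt n (x : n.-tuple M) (t : Delta n) : Y :=
  \pi_({eq_quot (equiv_closure (@Defs.glue R (nerve M)))}) (cell (X := nerve M) x t).

Lemma bpt_ex (y : Y) : exists n x t, y = @bpt n x t.
Proof.
have [c ->] : exists c, y = \pi_({eq_quot (equiv_closure (@Defs.glue R (nerve M)))}) c.
  by exists (repr (y : {eq_quot (equiv_closure (@Defs.glue R (nerve M)))})); rewrite reprK.
by case: c => n [x t]; exists n, x, t.
Qed.

Lemma bpt_glue k n (f : delta_map k n) (x : n.-tuple M) (t : Delta k) :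
  bpt x (simplex_map f t) = bpt (nerve_act f x) t.
Proof. by apply/eqquotP/equiv_closureP/rst_step; exact: Glue. Qed.

(* A point (x, t) of a cell is a configuration of particles on [0, 1], the one *)
(* with label x_i standing at the position t_0 + ... + t_i. *)
Definition cell_label (P : pred R) (c : cells) : M :=
  let: existT n p := c in
  \prod_(0 <= i < n | P (psum (val p.2) i.+1)) nth 1 (p.1 : n.-tuple M) i.

(** Gluing creates or deletes particles at 0 and 1, which P excludes, and merges or splits particles
    at one position, whose labels multiply. *)
Lemma cell_label_glue P c c' : ~~ P 0%R -> ~~ P 1%R -> Defs.glue c c' ->
  cell_label P c = cell_label P c'.
Proof.
move=> P0 P1 [k n f x t] /=; rewrite [RHS]big_mkcond [LHS]big_mkcond /=.
pose F i := if P (psum (simplex_push f (sval t)) i.+1) then nth 1 x i else 1.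
rewrite -[LHS]/(\prod_(0 <= i < n) F i); have homo_f := @delta_homo _ _ f.
have f0k : (f ord0 <= f ord_max)%N by apply: homo_f.
have fkn : (f ord_max <= n)%N by rewrite -ltnS.
have F_left i : (0 <= i < f ord0)%N -> F i = 1.
  move=> /= if0; rewrite /F psum_push big1 ?(negbTE P0) // => l fl.
  by have := homo_f ord0 l (leq0n _); lia.
have F_right i : (f ord_max <= i < n)%N -> F i = 1.
  move=> /andP[fi lt_in].
  rewrite /F psum_push; have [_ t1] := set_mem (valP t).
  rewrite (eq_bigl xpredT) ?t1 ?(negbTE P1) // => l; rewrite ltnS.
  by apply: leq_trans fi; apply: homo_f; rewrite -ltnS.
rewrite (@big_cat_nat _ _ _ (f ord_max)) //= (@big_cat_nat _ _ _ (f ord0)) //=.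
rewrite [X in X * _ * _](eq_big_nat _ _ F_left) [X in X * _ * _]big1 // mul1g.
rewrite [X in _ * X](eq_big_nat _ _ F_right) [X in _ * X]big1 // mulg1.
have i0 : inord 0 = ord0 :> 'I_k.+1 by apply: val_inj; rewrite /= inordK.
have ik : inord k = ord_max :> 'I_k.+1 by apply: val_inj; rewrite /= inordK.
have homo_inord j j' : (j <= j' <= k)%N -> (f (inord j) <= f (inord j'))%N.
  by move=> /andP[jj' j'k]; apply: homo_f; rewrite !inordK; lia.
rewrite -i0 -ik -(prod_telescope (h := fun j => f (inord j))) //; last first.
  by move=> j jk; apply: homo_inord; lia.
apply: eq_big_nat => j /andP[_ jk]; rewrite nth_nerve_act //.
have Fj i : (f (inord j) <= i < f (inord j.+1))%N ->
    F i = if P (psum (val t) j.+1) then nth 1 x i else 1.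
  move=> /andP[ji ij]; rewrite /F (@psum_push_below R k n f (sval t) i.+1 j.+1) // => l.
  rewrite !ltnS; apply/idP/idP => [fl|lj]; last first.
    by apply: leq_trans ji; apply: homo_f; rewrite inordK; lia.
  rewrite leqNgt; apply/negP => jl; have : (f (inord j.+1) <= f l)%N.
    by apply: homo_f; rewrite inordK; lia.
  by lia.
by rewrite (eq_big_nat _ _ Fj); case: ifP => // _; rewrite big1.
Qed.

Definition label (P : pred R) (y : Y) : M :=
  cell_label P (repr (y : {eq_quot (equiv_closure (@Defs.glue R (nerve M)))})).

Lemma labelE P n (x : n.-tuple M) (t : Delta n) : ~~ P 0%R -> ~~ P 1%R ->
  label P (bpt x t) = \prod_(0 <= i < n | P (psum (val t) i.+1)) nth 1 x i.
Proof.
move=> P0 P1; rewrite /label.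
have /eqquotP/equiv_closureP : \pi_({eq_quot (equiv_closure (@Defs.glue R (nerve M)))})
  (repr (bpt x t : {eq_quot (equiv_closure (@Defs.glue R (nerve M)))})) =
  \pi_({eq_quot (equiv_closure (@Defs.glue R (nerve M)))}) (cell (X := nerve M) x t).
  by rewrite reprK.
suff gen c c' : clos_refl_sym_trans _ (@Defs.glue R (nerve M)) c c' ->
    cell_label P c = cell_label P c' by exact: gen.
elim=> {c c'} [c c'|//|c c' _ ->//|c c' c'' _ -> _ -> //].
exact: cell_label_glue.
Qed.

Lemma prod_eq1 (F : nat -> M) (P : pred nat) n :
  \prod_(0 <= i < n | P i) F i = 1 <-> forall i, (i < n)%N -> P i -> F i = 1.
Proof.
elim: n => [|n IHn]; first by rewrite big_geq //; split.
rewrite big_mkcond big_nat_recr //= -big_mkcond; split=> [/conical[/IHn F1 Fn] i|F1].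
  by rewrite ltnS leq_eqVlt => /predU1P[-> Pn|/F1 //]; move: Fn; rewrite Pn.
rewrite (IHn.2 _) ?mul1g => [|i lt_in]; last by apply: F1; exact: ltnW.
by case: ifP => // Pn; apply: F1.
Qed.

(** As M is conical, a trivial product means that every particle in the interval has label 1. *)
Definition avoids (a b : R) : set Y := [set y | label (fun r => a <= r <= b)%R y = 1].

Section Interval.
Variables a b : R.
Hypothesis ab : (0 < a /\ a < b /\ b < 1)%R.

Lemma avoidsE n (x : n.-tuple M) (t : Delta n) : avoids a b (bpt x t) <->
  forall i, (i < n)%N -> (a <= psum (val t) i.+1 <= b)%R -> nth 1 x i = 1.
Proof.
have [a0 [_ b1]] := ab; rewrite /avoids /= labelE ?prod_eq1 //.
  by rewrite leNgt a0.
by rewrite andbC leNgt b1.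
Qed.

End Interval.

Lemma nondegenerate_rep (y : Y) : exists n x t, y = @bpt n x t /\
  forall i, (i < n)%N -> nth 1 x i <> 1.
Proof.
have [n [x [t ->]]] := bpt_ex y; elim: n x t => [|n IHn] x t.
  by exists 0%N, x, t.
have [[i [i_lt xi]]|nd] := pselect (exists i, (i < n.+1)%N /\ nth 1 x i = 1); last first.
  exists n.+1, x, t; split=> // i i_lt xi; apply: nd; by exists i.
(* The degeneracy that forgets the particle i, whose label is 1. *)
have sP (j : 'I_n.+2) : ((if j <= i then j : nat else j.-1) < n.+1)%N.
  by have := ltn_ord j; case: ifP; lia.
pose s j : 'I_n.+1 := Ordinal (sP j).
have s_homo : {homo s : j k / (j <= k)%N}.
  by move=> j k jk /=; case: ifP; case: ifP; lia.
pose f : delta_map n.+1 n := DeltaMap s_homo.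
pose x' : n.-tuple M := [tuple nth 1 x (bump i l) | l < n].
have nth_x' l : (l < n)%N -> nth 1 x' l = nth 1 x (bump i l).
  by move=> ln; rewrite -(tnth_nth 1 _ (Ordinal ln)) tnth_mktuple.
have <- : nerve_act f x' = x; last by rewrite -bpt_glue; exact: IHn.
apply: eq_from_tnth => j.
have [jn jn'] : (j < n.+2)%N /\ (j.+1 < n.+2)%N by have := ltn_ord j; lia.
rewrite tnth_mktuple /= !inordK // (tnth_nth 1); have [ji|ij|ji] := ltngtP j i.
- by rewrite big_nat1 nth_x' ?/bump; [rewrite leqNgt ji|lia].
- move: jn jn' ij; case: (nat_of_ord j) => // j' jn jn' ij'.
  by rewrite /= big_nat1 nth_x' // /bump; move: ij'; rewrite ltnS => ->.
- by rewrite big_geq // ji xi.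
Qed.

Lemma open_cells (A : set Y) : (forall n (x : n.-tuple M) t0, A (bpt x t0) ->
    \forall t \near t0, A (bpt x t)) -> open A.
Proof.
move=> nearA; apply/sigT_openP => n; rewrite openE => -[x t0] /= At0.
exists ([set x], [set t | A (bpt x t)]) => /=; first by split=> //; exact: nearA.
by move=> [x' t] /= [-> At].
Qed.

Lemma near_psum n (t0 : Delta n) i (A : set R) : nbhs (psum (val t0) i) A ->
  \forall t \near t0, A (psum (val t) i).
Proof. by move=> nA; exact: (@psum_continuous R n i t0 A nA). Qed.

Lemma near_forall_ord n (t0 : Delta n) (P : nat -> Delta n -> Prop) :
  (forall i, (i < n)%N -> \forall t \near t0, P i t) ->
  \forall t \near t0, forall i, (i < n)%N -> P i t.
Proof.
move=> nP; have : \forall t \near t0, forall i : 'I_n, P i t.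
  by apply: (filter_forall (F := nbhs t0) (f := fun (i : 'I_n) t => P i t)) => i; exact: nP.
by apply: filterS => t Pt i lt_in; exact: (Pt (Ordinal lt_in)).
Qed.

Lemma near_outside (a b r0 : R) : ~ (a <= r0 <= b)%R ->
  nbhs r0 [set r : R | ~ (a <= r <= b)%R].
Proof.
move=> /negP; rewrite negb_and -!ltNge => /orP[ra|br].
  apply: (filterS (P := [set r | (r < a)%R])).
    by move=> r /= ra' /andP[]; rewrite leNgt ra'.
  by apply: open_nbhs_nbhs; split=> //; exact: open_lt.
apply: (filterS (P := [set r | (b < r)%R])).
  by move=> r /= br' /andP[_]; rewrite leNgt br'.
by apply: open_nbhs_nbhs; split=> //; exact: open_gt.
Qed.

Lemma open_avoids (a b : R) : (0 < a /\ a < b /\ b < 1)%R -> open (avoids a b).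
Proof.
move=> ab; apply: open_cells => n x t0 /(avoidsE ab) At0.
suff : \forall t \near t0, forall i, (i < n)%N ->
    (a <= psum (val t) i.+1 <= b)%R -> nth 1 x i = 1.
  by apply: filterS => t At; apply/(avoidsE ab).
apply: near_forall_ord => i lt_in.
have [xi|xi] := pselect (nth 1 x i = 1); first by apply: filterE => t _.
have /near_outside/near_psum : ~ (a <= psum (val t0) i.+1 <= b)%R.
  by move=> /(At0 _ lt_in).
by apply: filterS => t.
Qed.

Lemma open_gap_label (a b a' b' : R) (w : M) :
  (0 < a /\ a < b /\ b < 1)%R -> (0 < a' /\ a' < b' /\ b' < 1)%R ->
  open [set y : Y | [/\ avoids a b y, avoids a' b' y &
                      label (fun r => b < r < a')%R y = w]].
Proof.
move=> ab ab'; apply: open_cells => n x t0 [/(avoidsE ab) At0 /(avoidsE ab') At0'].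
have P0 : ~~ (b < 0 < a')%R.
  by rewrite negb_and -leNgt ltW //; case: ab => a0 [/(lt_trans a0)].
have P1 : ~~ (b < 1 < a')%R.
  by rewrite negb_and orbC -leNgt ltW //; case: ab' => a0 [] /lt_trans h /h.
rewrite labelE // => w0.
suff : \forall t \near t0, forall i, (i < n)%N -> nth 1 x i <> 1 ->
    [/\ ~ (a <= psum (val t) i.+1 <= b)%R, ~ (a' <= psum (val t) i.+1 <= b')%R &
        (b < psum (val t) i.+1 < a')%R = (b < psum (val t0) i.+1 < a')%R].
  apply: filterS => t Pt; split.
  - apply/(avoidsE ab) => i lt_in it; apply: contrapT => xi.
    by have [] := Pt i lt_in xi.
  - apply/(avoidsE ab') => i lt_in it; apply: contrapT => xi.
    by have [_] := Pt i lt_in xi.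
  rewrite labelE // -w0 big_mkcond [RHS]big_mkcond; apply: eq_big_nat => i /andP[_ lt_in].
  have [->|xi] := pselect (nth 1 x i = 1); first by rewrite !if_same.
  by have [_ _ ->] := Pt i lt_in xi.
apply: near_forall_ord => i lt_in.
have [xi|xi] := pselect (nth 1 x i = 1); first by apply: filterE => t /(_ xi).
have out : ~ (a <= psum (val t0) i.+1 <= b)%R by move=> /(At0 _ lt_in).
have out' : ~ (a' <= psum (val t0) i.+1 <= b')%R by move=> /(At0' _ lt_in).
set r0 := psum _ _ in out out' *.
suff : nbhs r0 [set r | [/\ ~ (a <= r <= b)%R, ~ (a' <= r <= b')%R &
    (b < r < a')%R = (b < r0 < a')%R]].
  by move=> /near_psum; apply: filterS => t.
(* A particle outside [a, b] can pass b only by crossing the whole interval, so nearby it stays on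
   its side. *)
have nb : nbhs r0 [set r | (b < r)%R = (b < r0)%R].
  have [br|rb] := ltP b r0.
    apply: (filterS (P := [set r | (b < r)%R])); first by move=> r /= ->.
    by apply: open_nbhs_nbhs; split=> //; exact: open_gt.
  have ra : (r0 < a)%R by rewrite ltNge; apply/negP => ar; apply: out; rewrite ar.
  apply: (filterS (P := [set r | (r < a)%R])).
    move=> r /= ra'; apply: negbTE; rewrite -leNgt; apply: ltW.
    by apply: lt_trans ra' _; case: ab => _ [].
  by apply: open_nbhs_nbhs; split=> //; exact: open_lt.
have na : nbhs r0 [set r | (r < a')%R = (r0 < a')%R].
  have [ra|ar] := ltP r0 a'.
    apply: (filterS (P := [set r | (r < a')%R])); first by move=> r /= ->.
    by apply: open_nbhs_nbhs; split=> //; exact: open_lt.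
  have br : (b' < r0)%R by rewrite ltNge; apply/negP => rb; apply: out'; rewrite ar.
  apply: (filterS (P := [set r | (b' < r)%R])).
    move=> r /= br'; apply: negbTE; rewrite -leNgt; apply: ltW.
    by apply: lt_trans br'; case: ab' => _ [].
  by apply: open_nbhs_nbhs; split=> //; exact: open_gt.
apply: filterS (filterI (filterI (near_outside out) (near_outside out')) (filterI nb na)).
by move=> r [[o1 o2] [/= e1 e2]]; split=> //; rewrite e1 e2.
Qed.

End Labels.

Section Levels.
Variable R : realType.

Definition ilevel (j : nat) : R := j.+1%:R^-1.

Lemma ilevel_gt0 j : 0 < ilevel j.
Proof. by rewrite invr_gt0 ltr0n. Qed.

Lemma ilevel0 : ilevel 0 = 1.
Proof. exact: invr1. Qed.

Lemma ilevel_lt i j : (i < j)%N -> ilevel j < ilevel i.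
Proof. by move=> ij; rewrite ltf_pV2 ?posrE ?ltr0n // ltr_nat ltnS. Qed.

Lemma ilevel_le i j : (i <= j)%N -> ilevel j <= ilevel i.
Proof. by rewrite leq_eqVlt => /predU1P[->//|/ilevel_lt/ltW]. Qed.

(* The disjoint intervals [jlo k, jhi k], moving to the left as k grows, and *)
(* a point in the gap on the right of each of them. *)
Definition jlo k := ilevel k.*2.+2.
Definition jhi k := ilevel k.*2.+1.
Definition jgap k := (ilevel k.*2.+1 + ilevel k.*2) / 2.

Lemma jlo_jhi k : 0 < jlo k /\ jlo k < jhi k /\ jhi k < 1.
Proof.
split; first exact: ilevel_gt0; split; first exact: ilevel_lt.
by rewrite -ilevel0; exact: ilevel_lt.
Qed.

Lemma jhi_gap k : jhi k < jgap k.
Proof. by have := @ilevel_lt k.*2 k.*2.+1 (ltnSn _); rewrite /jhi /jgap; lra. Qed.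

Lemma jgap_lt1 k : jgap k < 1.
Proof.
have := @ilevel_lt k.*2 k.*2.+1 (ltnSn _); have := @ilevel_le 0 k.*2 (leq0n _).
by rewrite ilevel0 /jgap; lra.
Qed.

Lemma jgap_jlo k l : (l < k)%N -> jgap k < jlo l.
Proof.
move=> lk; have := @ilevel_lt k.*2 k.*2.+1 (ltnSn _).
have := @ilevel_le l.*2.+2 k.*2; rewrite -doubleS leq_double => /(_ lk).
by rewrite /jgap /jlo doubleS; lra.
Qed.

Lemma jlo_le k l : (l <= k)%N -> jlo k <= jlo l.
Proof. by move=> lk; apply: ilevel_le; rewrite -!doubleS leq_double. Qed.

Lemma jhi_le k l : (l <= k)%N -> jhi k <= jhi l.
Proof. by move=> lk; apply: ilevel_le; rewrite ltnS leq_double. Qed.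

Lemma jgap_le k l : (l <= k)%N -> jgap k <= jgap l.
Proof.
rewrite leq_eqVlt => /predU1P[->//|lk]; apply/ltW/(lt_trans (jgap_jlo lk)).
by have [_ [ab _]] := jlo_jhi l; exact: lt_trans ab (jhi_gap l).
Qed.

Lemma jhi_small (e : R) : 0 < e -> exists k, jhi k < e.
Proof.
move=> e0; have [k ke] : exists k : nat, e^-1 < k%:R.
  by exists (Num.truncn e^-1).+1; rewrite truncnS_gt.
exists k; rewrite /jhi /ilevel -[ltRHS]invrK ltf_pV2 ?posrE ?ltr0n ?invr_gt0 //.
by apply: lt_le_trans ke _; rewrite ler_nat -addnn; lia.
Qed.

Definition ramp k (r : R) : R :=
  Num.max 0 (Num.min 1 ((r - jlo k) / (jhi k - jlo k))).

Lemma ramp_ge0 k r : 0 <= ramp k r.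
Proof. by rewrite /ramp le_max lexx. Qed.

Lemma ramp_le1 k r : ramp k r <= 1.
Proof. by rewrite /ramp ge_max ler01 ge_min lexx. Qed.

Lemma jlen_gt0 k : 0 < jhi k - jlo k.
Proof. by rewrite subr_gt0; have [_ []] := jlo_jhi k. Qed.

Lemma ramp_left k r : r <= jlo k -> ramp k r = 0.
Proof.
move=> rk; apply/max_idPl; rewrite ge_min; apply/orP; right.
by rewrite pmulr_lle0 ?invr_gt0 ?jlen_gt0 // subr_le0.
Qed.

Lemma ramp_right k r : jhi k <= r -> ramp k r = 1.
Proof.
move=> kr; rewrite /ramp; have -> : Num.min 1 ((r - jlo k) / (jhi k - jlo k)) = 1.
  by apply/min_idPl; rewrite ler_pdivlMr ?jlen_gt0 // mul1r lerB.
by apply/max_idPr.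
Qed.

Lemma ramp_homo k : {homo ramp k : r s / r <= s}.
Proof.
move=> r s rs; rewrite /ramp le_max2 // le_min2 // ler_pM2r ?invr_gt0 ?jlen_gt0 //.
exact: lerB.
Qed.

Lemma ramp_continuous k : continuous (ramp k).
Proof.
move=> r; apply: (@continuous_max R R (fun=> 0)
  (fun r => Num.min 1 ((r - jlo k) / (jhi k - jlo k)))); first exact: cst_continuous.
apply: (@continuous_min R R (fun=> 1) (fun r => (r - jlo k) / (jhi k - jlo k))).
  exact: cst_continuous.
by apply: cvgMl; apply: cvgB; [exact: cvg_id|exact: cvg_cst].
Qed.

End Levels.

(** * Squeezing configurations between the intervals *)

Section Squeeze.
Variables (R : realType) (p : nat) (ks : p.+1.-tuple nat).
Local Notation kk := (nth 0%N ks).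
Hypothesis ks_decr : forall i j, (i <= j <= p)%N -> (kk j <= kk i)%N.
Local Notation jlo := (jlo R).
Local Notation jhi := (jhi R).
Local Notation jgap := (jgap R).

(** Target positions. What lies left of all the intervals goes to 0 and what lies right of the last
    one goes to 1, where particles disappear; in between, everything gathers at the gap point just
    right of an interval. *)
Definition squeeze_level (i : nat) : R :=
  if i is j.+1 then (if kk j == kk p then 1 else jgap (kk j)) else 0.

Lemma jgap_ge0 k : 0 <= jgap k.
Proof.
have [a0 [ab _]] := jlo_jhi R k.
by apply/ltW/(lt_trans a0)/(lt_trans ab)/jhi_gap.
Qed.

Lemma squeeze_level_le i : (i <= p)%N -> squeeze_level i <= squeeze_level i.+1.
Proof.
case: i => [_|i ip] /=; first by case: ifP => _; rewrite ?ler01 ?jgap_ge0.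
have kki : (kk i.+1 <= kk i)%N by apply: ks_decr; rewrite leqnSn.
have kkp : (kk p <= kk i.+1)%N by apply: ks_decr; rewrite ip /=.
case: (kk i.+1 =P kk p) => [ip1|ip1]; first by case: ifP => // _; exact/ltW/jgap_lt1.
case: (kk i =P kk p) => [ip2|ip2]; first by case: ip1; lia.
exact: jgap_le.
Qed.

Definition squeeze_row : 'rV[R]_p.+1 :=
  \row_(j < p.+1) (squeeze_level j.+1 - squeeze_level j).

Lemma psum_squeeze i : (i <= p.+1)%N -> psum squeeze_row i = squeeze_level i.
Proof. by move=> ip; rewrite (psum_row (h := squeeze_level)). Qed.

Lemma squeeze_row_ge0 j : 0 <= squeeze_row 0 j.
Proof. by rewrite mxE subr_ge0; apply: squeeze_level_le; rewrite -ltnS. Qed.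

Lemma squeeze_sum : \sum_j squeeze_row 0 j = 1.
Proof.
rewrite -[LHS](_ : psum squeeze_row p.+1 = _); first by rewrite psum_squeeze //= eqxx.
by apply: eq_bigl => j; rewrite ltn_ord.
Qed.

Lemma squeeze_row_simplex : squeeze_row \in std_simplex R p.
Proof.
by apply/mem_set; split; [exact: squeeze_row_ge0|exact: squeeze_sum].
Qed.

Definition squeeze_pt : std_simplex R p :=
  exist (fun u => u \in std_simplex R p) _ squeeze_row_simplex.

(** A staircase, constant off the intervals, whose jumps are the entries of [squeeze_row]. *)
Definition squeeze (r : R) : R := \sum_j squeeze_row 0 j * ramp (kk j) r.

Lemma squeeze_reparam : unit_reparam squeeze.
Proof.
split.
- by rewrite /squeeze big1 // => j _; rewrite ramp_left ?mulr0 // ltW // ilevel_gt0.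
- rewrite -[RHS]squeeze_sum; apply: eq_bigr => j _; rewrite ramp_right ?mulr1 //.
  by have [_ [_ /ltW]] := jlo_jhi R (kk j).
- move=> r s rs; apply: ler_sum => j _; apply: ler_wpM2l; first exact: squeeze_row_ge0.
  exact: ramp_homo.
Qed.

Lemma squeeze_continuous : continuous squeeze.
Proof.
apply: (continuous_big (op := fun x y : R => x + y)) => [|j _].
  exact: add_continuous.
by move=> r; apply: cvgMr; exact: ramp_continuous.
Qed.

(** With c the first index of level at most [kk l], only the jumps before c are reached; they add up
    to 0 or to a gap point left of the interval of [kk l]. *)
Lemma squeeze_lt l r : (l <= p)%N -> r < jlo (kk l) -> squeeze r < jlo (kk l).
Proof.
move=> lp rl; have ex : exists j, (kk j <= kk l)%N by exists l.
case: (ex_minnP ex) => c cl cmin.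
have lc : (c <= l)%N by exact: cmin.
have below j : (j <= p)%N -> (kk l < kk j)%N = (j < c)%N.
  move=> jp; rewrite !ltnNge; congr (~~ _); apply/idP/idP => [/cmin //|cj].
  by apply: leq_trans cl; apply: ks_decr; rewrite cj.
have : squeeze r <= squeeze_level c.
  rewrite -psum_squeeze; last by apply: leq_trans lc _; exact: leqW.
  rewrite /squeeze /psum [leRHS]big_mkcond; apply: ler_sum => j _.
  rewrite -below -1?ltnS //; case: ltnP => jl.
    by rewrite ler_piMr ?ramp_le1 // squeeze_row_ge0.
  by rewrite ramp_left ?mulr0 // ltW // (lt_le_trans rl) // jlo_le.
move/le_lt_trans; apply; case: c lc below {cl cmin} => [|c] lc below /=.
  exact: ilevel_gt0.
have lkc : (kk l < kk c)%N by rewrite below // ltnW // (leq_trans lc).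
have plk : (kk p <= kk l)%N by apply: ks_decr; rewrite lp /=.
by case: eqP => [cp|_]; [lia|exact: jgap_jlo].
Qed.

Lemma squeeze_gt l r : (l <= p)%N -> jhi (kk l) < r -> jhi (kk l) < squeeze r.
Proof.
move=> lp rl; apply: (@lt_le_trans _ _ (squeeze_level l.+1)).
  by rewrite /=; case: ifP => _; [have [_ []] := jlo_jhi R (kk l)|exact: jhi_gap].
rewrite -psum_squeeze // /squeeze /psum [leLHS]big_mkcond; apply: ler_sum => j _.
case: ifP => jl; last by rewrite mulr_ge0 ?squeeze_row_ge0 ?ramp_ge0.
rewrite ramp_right ?mulr1 //; apply: le_trans (ltW rl); apply: jhi_le.
by apply: ks_decr; rewrite lp andbT -ltnS.
Qed.

Definition squeeze_at (s r : R) : R := (1 - s) * r + s * squeeze r.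

Lemma squeeze_at_reparam s : 0 <= s <= 1 -> unit_reparam (squeeze_at s).
Proof.
move=> /andP[s0 s1]; have [phi0 phi1 phi_homo] := squeeze_reparam; split.
- by rewrite /squeeze_at phi0 !mulr0 addr0.
- by rewrite /squeeze_at phi1 !mulr1 subrK.
- move=> r r' rr'; apply: lerD; first by apply: ler_wpM2l; rewrite ?subr_ge0.
  by apply: ler_wpM2l => //; exact: phi_homo.
Qed.

Lemma mix_le (s x y : R) : 0 <= s <= 1 ->
  Num.min x y <= (1 - s) * x + s * y <= Num.max x y.
Proof.
move=> /andP[s0 s1]; have s1' : 0 <= 1 - s by rewrite subr_ge0.
case: (leP x y) => xy; apply/andP; split.
- have := mulr_ge0 s0 (_ : 0 <= y - x); rewrite subr_ge0 => /(_ xy); lra.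
- have := mulr_ge0 s1' (_ : 0 <= y - x); rewrite subr_ge0 => /(_ xy); lra.
- have := mulr_ge0 s1' (_ : 0 <= x - y); rewrite subr_ge0 => /(_ (ltW xy)); lra.
- have := mulr_ge0 s0 (_ : 0 <= x - y); rewrite subr_ge0 => /(_ (ltW xy)); lra.
Qed.

Lemma squeeze_at_lt s l r : 0 <= s <= 1 -> (l <= p)%N -> r < jlo (kk l) ->
  squeeze_at s r < jlo (kk l).
Proof.
move=> s01 lp rl; have /andP[_ h] := mix_le r (squeeze r) s01.
by apply: le_lt_trans h _; rewrite gt_max rl squeeze_lt.
Qed.

Lemma squeeze_at_gt s l r : 0 <= s <= 1 -> (l <= p)%N -> jhi (kk l) < r ->
  jhi (kk l) < squeeze_at s r.
Proof.
move=> s01 lp rl; have /andP[h _] := mix_le r (squeeze r) s01.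
by apply: lt_le_trans h; rewrite lt_min rl squeeze_gt.
Qed.

Definition clamp (s : R) : R := Num.max 0 (Num.min 1 s).

Lemma clamp01 s : 0 <= clamp s <= 1.
Proof. by rewrite le_max lexx /= ge_max ler01 ge_min lexx. Qed.

Lemma clamp_continuous : continuous clamp.
Proof.
move=> r; apply: (@continuous_max R R (fun=> 0) (fun r => Num.min 1 r)).
  exact: cst_continuous.
apply: (@continuous_min R R (fun=> 1) idfun); first exact: cst_continuous.
exact: cvg_id.
Qed.

End Squeeze.

Section Deformation.
Variables (R : realType) (M : monoidType).
Hypothesis conical : forall x y : M, (x * y = 1 -> x = 1 /\ y = 1)%g.
Local Notation Delta := (std_simplex R).
Local Notation Y := (classifying_space R M).
Local Notation bpt := (@bpt R M _).
Local Notation label := (@label R M).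

Definition bspace_reparam phi (phiP : unit_reparam phi) (y : Y) : Y :=
  let: existT n p := repr (y : {eq_quot (equiv_closure (@Defs.glue R (nerve M)))})
  in bpt (p.1 : n.-tuple M) (reparam phiP p.2).

Lemma bspace_reparamE phi (phiP : unit_reparam phi) n (x : n.-tuple M) (t : Delta n) :
  bspace_reparam phiP (bpt x t) = bpt x (reparam phiP t).
Proof.
pose F (c : realization_cells R (nerve M)) : Y :=
  let: existT n p := c in bpt (p.1 : n.-tuple M) (reparam phiP p.2).
rewrite -[RHS]/(F (cell (X := nerve M) x t)) -[LHS]/(F _).
have /eqquotP/equiv_closureP : \pi_({eq_quot (equiv_closure (@Defs.glue R (nerve M)))})
  (repr (bpt x t : {eq_quot (equiv_closure (@Defs.glue R (nerve M)))})) =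
  \pi_({eq_quot (equiv_closure (@Defs.glue R (nerve M)))}) (cell (X := nerve M) x t).
  by rewrite reprK.
suff gen c c' : clos_refl_sym_trans _ (@Defs.glue R (nerve M)) c c' -> F c = F c'.
  exact: gen.
elim=> {c c'} [_ _ [k l f z u]|//|c c' _ ->//|c c' c'' _ -> _ -> //].
by rewrite /F /= reparam_map bpt_glue.
Qed.

Lemma bpt_continuous n (x : n.-tuple M) : continuous (fun t : Delta n => bpt x t).
Proof.
move=> t; apply: (@continuous_comp _ _ _
  (fun t : Delta n => @cell R (nerve M) n x t)
  (\pi_(quotient_topology {eq_quot (equiv_closure (@Defs.glue R (nerve M)))}))).
  apply: (@continuous_comp _ _ _ (fun t : Delta n =>
    (x, t) : discrete_topology (n.-tuple M) * Delta n) (existT _ n)).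
    apply: (@cvg_pair _ _ _ (nbhs t) (nbhs (x : discrete_topology (n.-tuple M))) (nbhs t)).
      exact: cvg_cst.
    exact: cvg_id.
  exact: existT_continuous.
exact: pi_continuous.
Qed.

Section Squeezing.
Variables (p : nat) (ks : p.+1.-tuple nat).
Local Notation kk := (nth 0%N ks).
Hypothesis ks_decr : forall i j, (i <= j <= p)%N -> (kk j <= kk i)%N.

Definition squeezing (s : R) (y : Y) : Y :=
  bspace_reparam (squeeze_at_reparam ks_decr (clamp01 s)) y.

Definition squeeze_simplex n (s : R) (t : Delta n) : Delta n :=
  reparam (squeeze_at_reparam ks_decr (clamp01 s)) t.

Lemma squeezingE s n (x : n.-tuple M) (t : Delta n) :
  squeezing s (bpt x t) = bpt x (squeeze_simplex s t).
Proof. exact: bspace_reparamE. Qed.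

Lemma psum_squeeze_simplex n s (t : Delta n) i :
  psum (val (squeeze_simplex s t)) i = squeeze_at ks (clamp s) (psum (val t) i).
Proof. exact/psum_reparam/unit_reparam0/squeeze_at_reparam/clamp01. Qed.

Lemma squeeze_simplex_continuous n :
  continuous (fun st : R * Delta n => squeeze_simplex st.1 st.2).
Proof.
apply: simplex_continuous => i; have at_cont j : continuous
    (fun st : R * Delta n => squeeze_at ks (clamp st.1) (psum (val st.2) j)).
  move=> st; have c1 : {for st, continuous (fun st : R * Delta n => clamp st.1)}.
    apply: (@continuous_comp _ _ _ fst (@clamp R)); first exact: cvg_fst.
    exact: clamp_continuous.
  have c2 : {for st, continuous (fun st : R * Delta n => psum (val st.2) j)}.
    apply: (@continuous_comp _ _ _ snd (fun t : Delta n => psum (val t) j)).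
      exact: cvg_snd.
    exact: psum_continuous.
  have c3 : {for st, continuous (fun st : R * Delta n => squeeze ks (psum (val st.2) j))}.
    apply: (@continuous_comp _ _ _ (fun st : R * Delta n => psum (val st.2) j) (squeeze ks)) => //.
    exact: squeeze_continuous.
  rewrite /squeeze_at; apply: cvgD; apply: cvgM => //.
  by apply: cvgB => //; exact: cvg_cst.
have -> : (fun st : R * Delta n => (val (squeeze_simplex st.1 st.2)) 0 i) =
    (fun st => squeeze_at ks (clamp st.1) (psum (val st.2) i.+1) -
               squeeze_at ks (clamp st.1) (psum (val st.2) i)).
  by apply/funext => st; rewrite psum_coord !psum_squeeze_simplex.
by move=> st; apply: cvgB; exact: at_cont.
Qed.

(** Joint continuity is obtained by a tube argument over a compact time interval K: the points that
    stay in O during all of K form an open set, which can be tested on cells. *)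
Lemma squeezing_continuous : continuous (fun sy : R * Y => squeezing sy.1 sy.2).
Proof.
move=> [s0 y0] A nA; have : nbhs (squeezing s0 y0) A by [].
rewrite nbhsE => -[O [oO Oy0] OA].
have cell_cont n (x : n.-tuple M) : continuous (fun st : R * Delta n =>
    bpt x (squeeze_simplex st.1 st.2)).
  move=> st; apply: (@continuous_comp _ _ _
    (fun st : R * Delta n => squeeze_simplex st.1 st.2) (fun t => bpt x t)).
    exact: squeeze_simplex_continuous.
  exact: bpt_continuous.
have [e e0 eO] : exists2 e : R, 0 < e & forall s, s0 - e <= s <= s0 + e -> O (squeezing s y0).
  have [n [x [t yE]]] := bpt_ex y0; rewrite yE /= in Oy0 *.
  have : nbhs s0 [set s | O (squeezing s (bpt x t))].
    have c : continuous_at s0 (fun s => bpt x (squeeze_simplex s t)).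
      apply: (@continuous_comp _ _ _ (fun s : R => (s, t)) (fun st : R * Delta n =>
        bpt x (squeeze_simplex st.1 st.2))); last exact: cell_cont.
      apply: (@cvg_pair _ _ _ (nbhs s0) (nbhs s0) (nbhs t)); first exact: cvg_id.
      exact: cvg_cst.
    rewrite squeezingE in Oy0.
    have nO : nbhs s0 [set s | O (bpt x (squeeze_simplex s t))].
      exact: (c O (open_nbhs_nbhs (conj oO Oy0))).
    by apply: filterS nO => s /=; rewrite squeezingE.
  move=> /nbhs_ballP[e /= e0 eO]; exists (e / 2); first by rewrite divr_gt0.
  move=> s /andP[s1 s2]; apply: eO; rewrite /ball /= ltr_norml; apply/andP; split; lra.
pose K := [set` `[s0 - e, s0 + e]].
pose U := [set y | forall s, K s -> O (squeezing s y)].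
have oU : open U.
  apply: open_cells => n x t0 /= Ut0.
  have cK : near_covering K by apply/compact_near_coveringP/segment_compact.
  have := cK _ (nbhs t0) (fun t s => O (squeezing s (bpt x t))) _.
  apply=> s /Ut0 Os; rewrite squeezingE in Os.
  have [[B1 B2] /= [B1s B2t] B12] := cell_cont n x (s, t0) O (open_nbhs_nbhs (conj oO Os)).
  by exists (B1, B2) => // -[s' t'] /= [B1s' B2t']; rewrite squeezingE; exact: (B12 (_, _)).
exists (K, U) => /=; last first.
  by move=> [s y] /= [Ks Uy]; exact/OA/Uy.
split.
  apply: (filterS (P := ball s0 e)); last exact: nbhsx_ballx.
  move=> s; rewrite /ball /= /K /= in_itv /= ltr_norml => /andP[s1 s2].
  by apply/andP; split; lra.
have Uy0 : U y0 by move=> s; rewrite /K /= in_itv /=; exact: eO.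
exact: (open_nbhs_nbhs (conj oU Uy0)).
Qed.

Lemma squeezing0 y : squeezing 0 y = y.
Proof.
have [n [x [t ->]]] := bpt_ex y; rewrite squeezingE; congr (bpt _ _).
apply/val_inj/psum_inj => i; rewrite psum_squeeze_simplex.
have -> : clamp 0 = 0 :> R by apply/max_idPl; rewrite ge_min lexx orbT.
by rewrite /squeeze_at subr0 mul1r mul0r addr0.
Qed.

Definition avoid k : set Y := avoids (jlo R k) (jhi R k).

Lemma avoidE k n (x : n.-tuple M) (t : Delta n) : avoid k (bpt x t) <->
  forall i, (i < n)%N -> jlo R k <= psum (val t) i.+1 <= jhi R k -> nth 1%g x i = 1%g.
Proof. exact/(avoidsE conical)/jlo_jhi. Qed.

Lemma squeezing_avoid s y l : (l <= p)%N -> avoid (kk l) y -> avoid (kk l) (squeezing s y).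
Proof.
move=> lp; have [n [x [t ->]]] := bpt_ex y; rewrite squeezingE.
move=> /avoidE xt; apply/avoidE => i lt_in.
rewrite psum_squeeze_simplex => /andP[lo hi]; apply: xt => //.
apply/andP; split; rewrite leNgt; apply/negP => h.
  by have := squeeze_at_lt ks_decr (clamp01 s) lp h; rewrite ltNge lo.
by have := squeeze_at_gt ks_decr (clamp01 s) lp h; rewrite ltNge hi.
Qed.

Definition gap_label k l (y : Y) : M := label (fun r => jhi R k < r < jlo R l) y.

Lemma gap_labelE k l n (x : n.-tuple M) (t : Delta n) : gap_label k l (bpt x t) =
  (\prod_(0 <= i < n | jhi R k < psum (val t) i.+1 < jlo R l) nth 1 x i)%g.
Proof.
rewrite /gap_label labelE //.
  by rewrite negb_and -leNgt ltW // ilevel_gt0.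
rewrite negb_and orbC -leNgt ltW //; have [_ [ab b1]] := jlo_jhi R l.
exact: lt_trans ab b1.
Qed.

Definition level_labels (y : Y) : p.-tuple M :=
  [tuple gap_label (kk i) (kk i.+1) y | i < p].

(** Counting the particles to the left of each interval gives a monotone map f. At the end of the
    deformation the particles have merged along f, and the gluing relation for f identifies the
    result. *)
Lemma squeezing1 s y : 1 <= s -> (forall l, (l <= p)%N -> avoid (kk l) y) ->
  squeezing s y = bpt (level_labels y) (squeeze_pt R ks_decr).
Proof.
move=> s1; have [n [x [t [-> nd]]]] := nondegenerate_rep y => av.
have av_i l i : (l <= p)%N -> (i < n)%N ->
    (psum (val t) i.+1 < jlo R (kk l)) = ~~ (jhi R (kk l) < psum (val t) i.+1).
  move=> lp lt_in; have /avoidE/(_ i lt_in) x1 := av l lp.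
  have [_ [ab _]] := jlo_jhi R (kk l); apply/idP/idP => [h|].
    by rewrite -leNgt ltW // (lt_trans h).
  rewrite -leNgt => h; rewrite ltNge; apply/negP => h'.
  by apply: nd lt_in _; apply: x1; rewrite h' h.
pose g_fun l := find (fun i => ~~ (psum (val t) i.+1 < jlo R (kk l))) (iota 0 n).
have gn l : (g_fun l < n.+1)%N.
  by rewrite ltnS -[leqRHS](size_iota 0) find_size.
have gP l i : (i < n)%N -> (psum (val t) i.+1 < jlo R (kk l)) = (i < g_fun l)%N.
  move=> lt_in; apply/idP/idP => [h|ig]; last first.
    by have := before_find 0%N ig; rewrite nth_iota // add0n => /negbFE.
  rewrite ltnNge; apply/negP => gi.
  have hs : has (fun i => ~~ (psum (val t) i.+1 < jlo R (kk l))) (iota 0 n).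
    by rewrite has_find size_iota; exact: leq_ltn_trans gi lt_in.
  have := nth_find 0%N hs; rewrite -/(g_fun l) nth_iota ?(leq_ltn_trans gi) // add0n.
  by move=> /negP; apply; apply: le_lt_trans h; exact: psum_mono.
pose g (l : 'I_p.+1) : 'I_n.+1 := Ordinal (gn l).
have g_homo : {homo g : l l' / (l <= l')%N}.
  move=> l l' ll' /=; rewrite leqNgt; apply/negP => lt_g.
  have lt_n : (g_fun l' < n)%N by apply: leq_trans lt_g _; rewrite -ltnS.
  have := gP l _ lt_n; rewrite lt_g => h.
  have := gP l' _ lt_n; rewrite ltnn => /negP; apply; apply: lt_le_trans h _.
  by apply: jlo_le; apply: ks_decr; rewrite ll' /= -ltnS.
pose f : delta_map p n := DeltaMap g_homo.
have -> : level_labels (bpt x t) = nerve_act f x.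
  apply: eq_from_tnth => l; rewrite !tnth_mktuple gap_labelE /=.
  have lp := ltn_ord l; have lp' := ltnW lp; rewrite !inordK ?ltnS //.
  rewrite [RHS](big_nat_widen _ _ n) /=; last by rewrite -ltnS.
  rewrite [RHS](big_nat_widenl _ 0) //= big_mkcond [RHS]big_mkcond.
  apply: eq_big_nat => i /andP[_ lt_in] /=; congr (if _ then _ else _).
  by rewrite -/(g_fun l.+1) -/(g_fun l) -(negbK (jhi R _ < _)) -av_i // !gP //; lia.
rewrite -bpt_glue squeezingE; congr (bpt _ _).
apply/val_inj/psum_inj => i; rewrite psum_squeeze_simplex.
have [ni|ni] := ltnP n i.
  rewrite !psum_full //; have [_ -> //] := squeeze_at_reparam ks_decr (clamp01 s).
have [c cp fc] := delta_threshold f i.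
rewrite [val (simplex_map _ _)]/= (psum_push_below _ fc) psum_squeeze //.
have -> : clamp s = 1.
  by rewrite /clamp; have /min_idPl-> := s1; apply/max_idPr.
rewrite /squeeze_at subrr mul0r add0r mul1r.
rewrite -psum_squeeze // /squeeze [in RHS]/psum [RHS]big_mkcond /=; apply: eq_bigr => l _.
rewrite -fc /=; case: i ni fc => [|i] ni fc.
  by rewrite psum0 ramp_left ?mulr0 // ltW // ilevel_gt0.
have lp : (l <= p)%N by rewrite -ltnS.
rewrite ltnS; case: leqP => gi.
  rewrite ramp_right ?mulr1 //; apply: ltW.
  by have := av_i l i lp ni; rewrite gP // ltnNge gi => /esym/negbFE.
by rewrite ramp_left ?mulr0 // ltW // gP.
Qed.

End Squeezing.
End Deformation.

(** * Levelled singular simplices *)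

Section SimplexPaths.
Variables (R : realType) (q : nat).
Local Notation Delta := (std_simplex R).

Definition segment_row (t u : Delta q) (s : R) : 'rV[R]_q.+1 :=
  \row_i ((1 - clamp s) * (val t) 0 i + clamp s * (val u) 0 i).

Lemma segment_row_simplex t u s : segment_row t u s \in Delta q.
Proof.
have /andP[s0 s1] := clamp01 s; have [t0 t1] := set_mem (valP t).
have [u0 u1] := set_mem (valP u); apply/mem_set; split=> [i|].
  by rewrite mxE addr_ge0 ?mulr_ge0 ?subr_ge0.
under eq_bigr do rewrite mxE; rewrite big_split -!mulr_sumr /=.
by rewrite t1 u1 !mulr1 subrK.
Qed.

Definition simplex_segment t u s : Delta q :=
  exist (fun v => v \in Delta q) _ (segment_row_simplex t u s).

Lemma simplex_segment_continuous t u : continuous (simplex_segment t u).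
Proof.
apply: simplex_continuous => i; rewrite (_ : (fun s => _) = fun s =>
  (1 - clamp s) * (val t) 0 i + clamp s * (val u) 0 i); last first.
  by apply/funext => s; rewrite mxE.
move=> s; have c : clamp r @[r --> s] --> clamp s by exact: clamp_continuous.
apply: cvgD; apply: cvgMl => //.
by apply: cvgB => //; exact: cvg_cst.
Qed.

Lemma simplex_locally_constant (T : Type) (f : Delta q -> T) :
  (forall t, \forall u \near t, f u = f t) -> forall t u, f t = f u.
Proof.
move=> f_loc t u; pose g s := f (simplex_segment t u s).
have g_loc s : \forall r \near s, g r = g s.
  exact: (simplex_segment_continuous (f_loc (simplex_segment t u s))).
have g0 : g 0 = f t.
  congr f; apply/val_inj/rowP => i; rewrite mxE.
  have -> : clamp 0 = 0 :> R by apply/max_idPl; rewrite ge_min lexx orbT.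
  by rewrite subr0 mul1r mul0r addr0.
have g1 : g 1 = f u.
  congr f; apply/val_inj/rowP => i; rewrite mxE.
  have -> : clamp 1 = 1 :> R by rewrite /clamp minxx; apply/max_idPr.
  by rewrite subrr mul1r mul0r add0r.
pose C := [set s | g s = f t].
have oC : open C by rewrite openE => s gs; apply: filterS (g_loc s) => r; rewrite gs.
have cC : closed C.
  rewrite -openC openE => s gs; apply: filterS (g_loc s) => r rs; rewrite /C /= rs.
  exact: gs.
have eC : `[0, 1]%classic `&` C = `[0, 1]%classic.
  apply: segment_connected; [|by exists C|by exists C].
  by exists 0; split=> //; rewrite /= in_itv /= lexx ler01.
have : (`[0, 1]%classic : set R) 1 by rewrite /= in_itv /= lexx ler01.
by rewrite -eC => -[_]; rewrite /C /= g1.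
Qed.

End SimplexPaths.

Section GapLabels.
Variables (R : realType) (M : monoidType).
Hypothesis conical : forall x y : M, (x * y = 1 -> x = 1 /\ y = 1)%g.
Local Notation Delta := (std_simplex R).
Local Notation Y := (classifying_space R M).
Local Notation Sing q := (singular_simplex R Y q).
Local Notation avoid := (@avoid R M).
Local Notation gap_label := (@gap_label R M).
Implicit Types y : Y.

Lemma gap_label_refl k y : gap_label k k y = 1%g.
Proof.
have [n [x [t ->]]] := bpt_ex y; rewrite gap_labelE // big_pred0 // => i.
apply/negbTE/negP => /andP[h1 h2]; have [_ [h _]] := jlo_jhi R k.
by have := lt_trans (lt_trans h1 h2) h; rewrite ltxx.
Qed.

Lemma prod_split (F : nat -> M) (P P1 P2 : pred nat) n :
  (forall i, (i < n)%N -> P i = P1 i || P2 i) ->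
  (forall i j, (j <= i < n)%N -> P1 i -> ~~ P2 j) ->
  (\prod_(0 <= i < n | P i) F i =
   \prod_(0 <= i < n | P1 i) F i * \prod_(0 <= i < n | P2 i) F i)%g.
Proof.
move=> PE P12.
rewrite big_mkcond [X in (X * _)%g]big_mkcond [X in (_ * X)%g]big_mkcond /=.
elim: n PE P12 => [|n IHn] PE P12; first by rewrite !big_geq // mulg1.
rewrite !big_nat_recr //= IHn; first last.
- by move=> i j jin; apply: P12; lia.
- by move=> i lt_in; apply: PE; exact: ltnW.
rewrite PE // -!mulgA; congr (_ * _)%g.
case: (boolP (P1 n)) => P1n /=; last by rewrite mul1g.
rewrite (negbTE (P12 n n _ P1n)) ?leqnn // mulg1 big_nat_cond big1 ?mul1g ?mulg1 //.
by move=> i /andP[lt_in _]; rewrite (negbTE (P12 n i _ P1n)) //; lia.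
Qed.

(** The interval of l holds no particle, so it separates those of the two smaller gaps. *)
Lemma gap_label_cocycle k l h y : (h <= l <= k)%N -> avoid l y ->
  gap_label k h y = (gap_label k l y * gap_label l h y)%g.
Proof.
move=> /andP[hl lk]; have [n [x [t [-> nd]]]] := nondegenerate_rep y.
move=> /(avoidE conical) av; rewrite !gap_labelE //.
have [_ [lol _]] := jlo_jhi R l; have lokl := jlo_le R lk; have hikl := jhi_le R lk.
have lohl := jlo_le R hl; have hihl := jhi_le R hl.
apply: prod_split => [i lt_in|i j /andP[ji lt_in]].
  have : ~ (jlo R l <= psum (val t) i.+1 <= jhi R l) by move=> /(av _ lt_in) /nd; exact.
  set r := psum _ _ => out; case: (ltP r (jlo R l)) => rl.
    have h2 : (jhi R l < r) = false by apply/negbTE; rewrite -leNgt (ltW (lt_trans rl lol)).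
    by rewrite (lt_le_trans rl lohl) h2 orbF.
  have h1 : jhi R l < r by rewrite ltNge; apply/negP => rl'; apply: out; rewrite rl.
  by rewrite h1 (le_lt_trans hikl h1).
move=> /andP[_ il]; rewrite negb_and -leNgt; apply/orP; left; apply: ltW.
by apply: le_lt_trans (lt_trans il lol); exact: psum_mono.
Qed.

Definition level_decr p (ks : p.+1.-tuple nat) :=
  forall i j, (i <= j <= p)%N -> (nth 0%N ks j <= nth 0%N ks i)%N.

Lemma gap_label_prod p (ks : p.+1.-tuple nat) y a b : level_decr ks ->
  (forall l, (l <= p)%N -> avoid (nth 0%N ks l) y) -> (a <= b <= p)%N ->
  (\prod_(a <= i < b) gap_label (nth 0%N ks i) (nth 0%N ks i.+1) y =
   gap_label (nth 0%N ks a) (nth 0%N ks b) y)%g.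
Proof.
move=> kd av /andP[/subnK <-]; elim: (b - a)%N => [|d IHd] dp.
  by rewrite big_geq // gap_label_refl.
rewrite addSn in dp *; have dp' := ltnW dp.
rewrite big_nat_recr ?leq_addl //= IHd // -gap_label_cocycle //; last exact: av.
by rewrite !kd //; lia.
Qed.

Lemma nth_level_labels p (ks : p.+1.-tuple nat) y i : (i < p)%N ->
  (nth 1 (level_labels ks y) i)%g = gap_label (nth 0%N ks i) (nth 0%N ks i.+1) y.
Proof. by move=> ip; rewrite -(tnth_nth _ _ (Ordinal ip)) tnth_mktuple. Qed.

(** Forgetting a level multiplies adjacent gap labels and repeating one inserts 1, as in the
    nerve. *)
Lemma level_labels_act k p (f : delta_map k p) (ks : p.+1.-tuple nat) y :
  level_decr ks -> (forall l, (l <= p)%N -> avoid (nth 0%N ks l) y) ->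
  level_labels (level_act f ks) y = nerve_act f (level_labels ks y).
Proof.
move=> kd av; apply: eq_from_tnth => j; rewrite !tnth_mktuple.
have jk := ltn_ord j; have jk' := ltnW jk.
have fp : (f (inord j.+1) <= p)%N by rewrite -ltnS.
rewrite !nth_level_act // -gap_label_prod //; last first.
  by rewrite fp andbT; apply: delta_homo; rewrite !inordK.
apply: eq_big_nat => i /andP[_ ip]; rewrite nth_level_labels //.
exact: leq_trans ip fp.
Qed.

Lemma gap_label_const k l q (s : Sing q) : (forall t, avoid k (s t)) ->
  (forall t, avoid l (s t)) -> forall t u, gap_label k l (s t) = gap_label k l (s u).
Proof.
move=> ak al; apply: simplex_locally_constant => t.
have oU := open_gap_label conical (w := gap_label k l (s t)) (jlo_jhi R k) (jlo_jhi R l).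
have nU := open_nbhs_nbhs (conj oU (And3 (ak t) (al t) erefl)).
have : \forall u \near t, [/\ avoid k (s u), avoid l (s u) & gap_label k l (s u) = gap_label k l (s t)].
  exact: (@cts_fun _ _ s t _ nU).
by apply: filterS => u [].
Qed.

End GapLabels.

Section RealFunctions.
Variables (R : realType) (T : topologicalType) (f g : T -> R).
Hypotheses (f_cont : continuous f) (g_cont : continuous g).

Lemma fun_contD : continuous (fun x => f x + g x).
Proof. by move=> x; apply: cvgD; [exact: f_cont|exact: g_cont]. Qed.

Lemma fun_contB : continuous (fun x => f x - g x).
Proof. by move=> x; apply: cvgB; [exact: f_cont|exact: g_cont]. Qed.

Lemma fun_contM : continuous (fun x => f x * g x).
Proof. by move=> x; apply: cvgM; [exact: f_cont|exact: g_cont]. Qed.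

Lemma fun_contV : (forall x, f x != 0) -> continuous (fun x => (f x)^-1).
Proof. by move=> f0 x; apply: cvgV => //; exact: f_cont. Qed.

End RealFunctions.

Section ConeRetraction.
Variables (R : realType) (q : nat).
Local Notation Delta := (std_simplex R).
Implicit Types t : Delta q.+1.

Definition cone_scale t : R := Num.max (1 - (val t) 0 ord0) 2^-1.

Lemma cone_scale_gt0 t : 0 < cone_scale t.
Proof. by rewrite lt_max invr_gt0 ltr0n orbT. Qed.

(* Away from the vertex 0 this is the projection from this vertex to the *)
(* opposite face; closer to it, the missing weight goes to one coordinate. *)
Definition cone_row t : 'rV[R]_q.+1 :=
  \row_i ((val t) 0 (fintype.lift ord0 i) / cone_scale t +
          (if i == ord0 then 1 - (1 - (val t) 0 ord0) / cone_scale t else 0)).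

Lemma simplex_sumS n (t : Delta n.+1) :
  \sum_i (val t) 0 (fintype.lift ord0 i) = 1 - (val t) 0 ord0.
Proof.
by have [_] := set_mem (valP t); rewrite big_ord_recl => <-; rewrite addrC addKr.
Qed.

Lemma cone_row_simplex t : cone_row t \in Delta q.
Proof.
have s0 := cone_scale_gt0 t; apply/mem_set; split=> [i|].
  rewrite mxE addr_ge0 ?divr_ge0 ?simplex_ge0 ?(ltW s0) //; case: ifP => // _.
  by rewrite subr_ge0 ler_pdivrMr // mul1r le_max lexx.
under eq_bigr do rewrite mxE; rewrite big_split -mulr_suml simplex_sumS /=.
by rewrite (bigD1 ord0) //= big1 ?addr0 1?addrC ?subrK // => i /negbTE ->.
Qed.

Definition cone_ret t : Delta q :=
  exist (fun v => v \in Delta q) _ (cone_row_simplex t).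

Lemma simplex_coord_continuous n i : continuous (fun u : Delta n => (val u) 0 i).
Proof.
move=> u; apply: (continuous_comp (f := @set_val _ (Delta n)) (g := fun v : 'rV[R]_n.+1 => v 0 i)).
  exact: initial_continuous.
exact: coord_continuous.
Qed.

Lemma cone_scale_continuous : continuous cone_scale.
Proof.
have c1 : continuous (fun t : Delta q.+1 => 1 - (val t) 0 ord0).
  by apply: (@fun_contB R (Delta q.+1)); [exact: cst_continuous|exact: simplex_coord_continuous].
move=> t; apply: (@continuous_max R (Delta q.+1) (fun t => 1 - (val t) 0 ord0) (fun=> 2^-1)).
  exact: c1.
exact: cst_continuous.
Qed.

Lemma cone_ret_continuous : continuous cone_ret.
Proof.
have inv_cont : continuous (fun t => (cone_scale t)^-1).
  apply: (@fun_contV R (Delta q.+1) _ cone_scale_continuous) => t.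
  exact: lt0r_neq0 (cone_scale_gt0 t).
apply: simplex_continuous => i.
rewrite (_ : (fun t => _) = fun t => (val t) 0 (fintype.lift ord0 i) / cone_scale t +
   (if i == ord0 then 1 - (1 - (val t) 0 ord0) / cone_scale t else 0)); last first.
  by apply/funext => t; rewrite mxE.
apply: (@fun_contD R (Delta q.+1)).
  by apply: (@fun_contM R (Delta q.+1) _ _ _ inv_cont); exact: simplex_coord_continuous.
case: (i == ord0); last exact: cst_continuous.
apply: (@fun_contB R (Delta q.+1)); first exact: cst_continuous.
apply: (@fun_contM R (Delta q.+1) _ _ _ inv_cont); apply: (@fun_contB R (Delta q.+1)); first exact: cst_continuous.
exact: simplex_coord_continuous.
Qed.

Lemma cone_scale_far t : (val t) 0 ord0 <= 2^-1 -> cone_scale t = 1 - (val t) 0 ord0.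
Proof. by move=> h; apply/max_idPl; lra. Qed.

Lemma cone_ret_far t i : (val t) 0 ord0 <= 2^-1 ->
  (val (cone_ret t)) 0 i = (val t) 0 (fintype.lift ord0 i) / (1 - (val t) 0 ord0).
Proof.
move=> h; rewrite mxE cone_scale_far // divff ?subrr ?if_same ?addr0 //.
by apply/eqP; lra.
Qed.

End ConeRetraction.

Section Faces.
Variable R : realType.
Local Notation Delta := (std_simplex R).

Lemma push_coface0 q (t : Delta q) : (val (simplex_map (coface ord0) t)) 0 ord0 = 0.
Proof. by rewrite mxE big_pred0. Qed.

Lemma push_coface q (i : 'I_q.+2) (t : Delta q) j :
  (val (simplex_map (coface i) t)) 0 (fintype.lift i j) = (val t) 0 j.
Proof.
rewrite mxE (big_pred1 j) // => l; exact: (inj_eq (@fintype.lift_inj _ i)).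
Qed.

Lemma push_coface_vertex q (i : 'I_q.+2) (t : Delta q) :
  (val (simplex_map (coface i) t)) 0 i = 0.
Proof. by rewrite mxE big_pred0 // => l; rewrite eq_sym (negbTE (neq_lift _ _)). Qed.

Lemma cone_ret_coface0 q (t : Delta q) : cone_ret (simplex_map (coface ord0) t) = t.
Proof.
apply/val_inj/rowP => i; rewrite cone_ret_far push_coface_vertex.
  by rewrite push_coface subr0 divr1.
by rewrite invr_ge0.
Qed.

Lemma push_cofaceS q (i : 'I_q.+2) (t : Delta q.+1) :
  (val (simplex_map (coface (fintype.lift ord0 i)) t)) 0 ord0 = (val t) 0 ord0.
Proof.
have {2}-> : ord0 = fintype.lift (fintype.lift ord0 i) ord0 :> 'I_q.+3.
  exact: val_inj.
exact: push_coface.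
Qed.

Lemma cone_ret_cofaceS q (i : 'I_q.+2) (t : Delta q.+1) : (val t) 0 ord0 <= 2^-1 ->
  cone_ret (simplex_map (coface (fintype.lift ord0 i)) t) =
  simplex_map (coface i) (cone_ret t).
Proof.
move=> h; apply/val_inj/rowP => j; rewrite cone_ret_far push_cofaceS //.
case: (unliftP i j) => [l ->|->]; last first.
  by rewrite !push_coface_vertex mul0r.
rewrite push_coface cone_ret_far //; congr (_ / _).
have -> : fintype.lift ord0 (fintype.lift i l) =
    fintype.lift (fintype.lift ord0 i) (fintype.lift ord0 l).
  by apply: val_inj; rewrite /= /bump; lia.
exact: push_coface.
Qed.

End Faces.

Section SingularCone.
Variables (R : realType) (M : monoidType).
Hypothesis conical : forall x y : M, (x * y = 1 -> x = 1 /\ y = 1)%g.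
Local Notation Delta := (std_simplex R).
Local Notation Y := (classifying_space R M).
Local Notation Sing q := (singular_simplex R Y q).
Local Notation avoid := (@avoid R M).

Section Fixed.
Variables (p : nat) (ks : p.+1.-tuple nat) (kd : level_decr ks).
Local Notation kk := (nth 0%N ks).

(** The coordinate at vertex 0 serves as time. The factor 2 ends the squeezing at one half, where
    [cone_ret] stops being the projection; beyond, a simplex avoiding the intervals has a constant
    value. *)
Definition cone_fun q (s : Sing q) (t : Delta q.+1) : Y :=
  squeezing kd (2 * (val t) 0 ord0) (s (cone_ret t)).

Lemma cone_fun_continuous q (s : Sing q) : continuous (cone_fun s).
Proof.
move=> t; apply: (@continuous_comp _ _ _
  (fun t : Delta q.+1 => (2 * (val t) 0 ord0, s (cone_ret t)) : R * Y)
  (fun sy => squeezing kd sy.1 sy.2)); last exact: squeezing_continuous.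
apply: (@cvg_pair _ _ _ (nbhs t) (nbhs (2 * (val t) 0 ord0)) (nbhs (s (cone_ret t)))).
  apply: (@fun_contM R (Delta q.+1)); first exact: cst_continuous.
  exact: simplex_coord_continuous.
apply: (@continuous_comp _ _ _ (@cone_ret R q) s); first exact: cone_ret_continuous.
exact: cts_fun.
Qed.

Definition sing_cone q (s : Sing q) : Sing q.+1 := mkcts (@cone_fun_continuous q s).

Lemma sing_cone_avoid q (s : Sing q) l : (l <= p)%N ->
  (forall t, avoid (kk l) (s t)) -> forall t, avoid (kk l) (sing_cone s t).
Proof. by move=> lp av t; apply: squeezing_avoid. Qed.

Lemma sing_cone_coface0 q (s : Sing q) : singular_act (coface ord0) (sing_cone s) = s.
Proof.
apply/continuousEP => t; rewrite [LHS]/(cone_fun s (simplex_map (coface ord0) t)).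
by rewrite /cone_fun push_coface0 cone_ret_coface0 mulr0 squeezing0.
Qed.

Section Avoiding.
Variables (q : nat) (s : Sing q).
Hypothesis av : forall l, (l <= p)%N -> forall t, avoid (kk l) (s t).

Lemma level_labels_const t u : level_labels ks (s t) = level_labels ks (s u).
Proof.
apply: eq_from_tnth => j; rewrite !tnth_mktuple.
have jp := ltn_ord j; apply: gap_label_const => //; apply: av => //.
exact: ltnW.
Qed.

Lemma cone_fun_near (t : Delta q.+1) (u : Delta q) : 2^-1 <= (val t) 0 ord0 -> cone_fun s t =
  bpt (level_labels ks (s u)) (squeeze_pt R kd).
Proof.
move=> h; rewrite /cone_fun squeezing1 //; first by rewrite (level_labels_const _ u).
  by lra.
by move=> l lp; exact: av.
Qed.

End Avoiding.

Lemma sing_cone_cofaceS q (s : Sing q.+1) (i : 'I_q.+2) :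
  (forall l, (l <= p)%N -> forall t, avoid (kk l) (s t)) ->
  singular_act (coface (fintype.lift ord0 i)) (sing_cone s) =
  sing_cone (singular_act (coface i) s).
Proof.
move=> av; apply/continuousEP => t.
rewrite [LHS]/(cone_fun s (simplex_map (coface (fintype.lift ord0 i)) t)).
rewrite [RHS]/(cone_fun (singular_act (coface i) s) t).
have [h|h] := leP ((val t) 0 ord0) 2^-1.
  by rewrite /cone_fun push_cofaceS cone_ret_cofaceS.
have av' l : (l <= p)%N -> forall t, avoid (kk l) (singular_act (coface i) s t).
  by move=> lp u; exact: av.
transitivity (bpt (level_labels ks (s (simplex_map (coface i) (cone_ret t)))) (squeeze_pt R kd)).
  by apply: (cone_fun_near av); rewrite push_cofaceS ltW.
by symmetry; apply: (cone_fun_near av'); exact: ltW.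
Qed.

Lemma sing_cone_vertex (s : Sing 0) (t u : Delta 0) :
  (forall l, (l <= p)%N -> forall t, avoid (kk l) (s t)) ->
  singular_act (coface ord_max) (sing_cone s) t =
  bpt (level_labels ks (s u)) (squeeze_pt R kd).
Proof.
move=> av; rewrite [LHS]/(cone_fun s (simplex_map (coface ord_max) t)).
apply: cone_fun_near => //.
have [_] := set_mem (valP t); rewrite big_ord1 => t1.
have -> : ord0 = fintype.lift ord_max ord0 :> 'I_2 by apply: val_inj.
by rewrite push_coface t1; lra.
Qed.

End Fixed.
End SingularCone.

Lemma zmap_comp (J K L : choiceType) (f : K -> L) (g : J -> K) z :
  zmap f (zmap g z) = zmap (f \o g) z.
Proof.
pose h : {additive {freeg J / int} -> {freeg L / int}} := zmap f \o zmap g.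
by apply: (zlin_ext (f := h) (g := zmap (f \o g))) => x; rewrite /h /= !zmapU.
Qed.

Lemma eq_zmap (K L : choiceType) (f g : K -> L) z : f =1 g -> zmap f z = zmap g z.
Proof. by move=> /funext ->. Qed.

Lemma zmap_id (K : choiceType) z : zmap (id : K -> K) z = z.
Proof.
by apply: (zlin_ext (f := zmap (id : K -> K)) (g := idfun)) => x; exact: zmapU.
Qed.

(** * The double complex of levelled simplices *)

Section LevelledSimplices.
Variables (R : realType) (M : monoidType).
Hypothesis conical : forall x y : M, (x * y = 1 -> x = 1 /\ y = 1)%g.
Local Notation Delta := (std_simplex R).
Local Notation Y := (classifying_space R M).
Local Notation Sing q := (singular_simplex R Y q).
Local Notation avoid := (@avoid R M).

Definition is_levelled p q (x : p.+1.-tuple nat * Sing q) : bool :=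
  `[< level_decr x.1 /\
      forall l, (l <= p)%N -> forall t, avoid (nth 0%N x.1 l) (x.2 t) >].

Definition levelled p q : choiceType := {x | @is_levelled p q x}.

Section Accessors.
Variables (p q : nat) (x : levelled p q).

Lemma levelled_decr : level_decr (val x).1.
Proof. by have /asboolP[] := valP x. Qed.

Lemma levelled_avoid l : (l <= p)%N -> forall t, avoid (nth 0%N (val x).1 l) ((val x).2 t).
Proof. by have /asboolP[_] := valP x; exact. Qed.

End Accessors.

Lemma level_act_subproof p k q (f : delta_map k p) (x : levelled p q) :
  is_levelled (level_act f (val x).1, (val x).2).
Proof.
apply/asboolP; split=> [i j /andP[ij jk]|l lk t] /=; rewrite !nth_level_act ?ltnS //.
- apply: levelled_decr; apply/andP; split; last by rewrite -ltnS.
  by apply: delta_homo; rewrite !inordK ?ltnS //; exact: leq_trans ij jk.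
- exact: leq_trans ij jk.
- by apply: levelled_avoid; rewrite -ltnS.
Qed.

Definition level_hact q k p (f : delta_map k p) (x : levelled p q) : levelled k q :=
  exist (fun x => @is_levelled k q x) _ (level_act_subproof f x).

Lemma level_hact_id q p (x : levelled p q) : level_hact (delta_id p) x = x.
Proof.
apply: val_inj; case: x => -[ks s] xL /=; congr (_, _).
by apply: eq_from_tnth => j; rewrite tnth_mktuple.
Qed.

Lemma level_hact_comp q k l p (f : delta_map l p) (g : delta_map k l) (x : levelled p q) :
  level_hact (delta_comp f g) x = level_hact g (level_hact f x).
Proof.
apply: val_inj; case: x => -[ks s] xL /=; congr (_, _).
by apply: eq_from_tnth => j; rewrite !tnth_mktuple.
Qed.

Definition level_rows q : simplicial_set :=
  @SimplicialSet (fun p => levelled p q) (@level_hact q) (@level_hact_id q) (@level_hact_comp q).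

Lemma sing_act_subproof p q k (f : delta_map k q) (x : levelled p q) :
  is_levelled ((val x).1, singular_act f (val x).2).
Proof.
by apply/asboolP; split=> [|l lp t]; [exact: levelled_decr|exact: levelled_avoid].
Qed.

Definition level_vact p k q (f : delta_map k q) (x : levelled p q) : levelled p k :=
  exist (fun x => @is_levelled p k x) _ (sing_act_subproof f x).

Lemma level_vact_id p q (x : levelled p q) : level_vact (delta_id q) x = x.
Proof.
apply: val_inj; case: x => -[ks s] xL; congr (_, _); exact: singular_act_id.
Qed.

Lemma level_vact_comp p k l q (f : delta_map l q) (g : delta_map k l) (x : levelled p q) :
  level_vact (delta_comp f g) x = level_vact g (level_vact f x).
Proof.
apply: val_inj; case: x => -[ks s] xL; congr (_, _); exact: singular_act_comp.
Qed.

Definition level_cols p : simplicial_set :=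
  @SimplicialSet (fun q => levelled p q) (@level_vact p) (@level_vact_id p) (@level_vact_comp p).

Local Notation D p q := {freeg (levelled p q) / int}.

Definition lv_h p q : D p.+1 q -> D p q := @simplicial_diff (level_rows q) p.
HB.instance Definition _ p q := GRing.Additive.on (@lv_h p q).
Definition lv_v p q : D p q.+1 -> D p q := @simplicial_diff (level_cols p) q.
HB.instance Definition _ p q := GRing.Additive.on (@lv_v p q).

Lemma lv_hU p q (x : levelled p.+1 q) : lv_h << x >> =
  \sum_(i < p.+2) << level_hact (coface i) x >> *~ (-1) ^+ i.
Proof. exact: (@simplicial_diffU (level_rows q)). Qed.

Lemma lv_vU p q (x : levelled p q.+1) : lv_v << x >> =
  \sum_(i < q.+2) << level_vact (coface i) x >> *~ (-1) ^+ i.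
Proof. exact: (@simplicial_diffU (level_cols p)). Qed.

Lemma lv_hv p q (z : D p.+1 q.+1) : lv_h (lv_v z) = lv_v (lv_h z).
Proof.
pose f : {additive D p.+1 q.+1 -> D p q} := @lv_h p q \o @lv_v p.+1 q.
pose g : {additive D p.+1 q.+1 -> D p q} := @lv_v p q \o @lv_h p q.+1.
apply: (zlin_ext (f := f) (g := g)) => x; rewrite /f /g /= lv_hU lv_vU !raddf_sum.
under eq_bigr do rewrite raddfMz /= lv_hU mulrz_suml.
rewrite exchange_big /=; apply: eq_bigr => i _.
rewrite raddfMz /= lv_vU mulrz_suml; apply: eq_bigr => j _.
rewrite -!mulrzA mulrC; congr (<< _ >> *~ _); exact: val_inj.
Qed.

Definition level_complex : double_complex :=
  @DoubleComplex (fun p q => D p q) (fun p q => @lv_h p q) (fun p q => @lv_v p q)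
    (fun p q => @simplicial_diffK (level_rows q) p)
    (fun p q => @simplicial_diffK (level_cols p) q) lv_hv.

Local Notation SY := (singular_complex R Y).
Local Notation BB := (simplicial_chains (layered_nerve M)).

Definition lv_augA q : D 0 q -> SY q := zmap (fun x => (val x).2).
HB.instance Definition _ q := GRing.Additive.on (@lv_augA q).

Lemma lv_augA_h q (z : D 1 q) : lv_augA (lv_h z) = 0.
Proof.
pose f : {additive D 1 q -> SY q} := @lv_augA q \o @lv_h 0 q.
apply: (zlin_ext (f := f) (g := \0)) => x.
rewrite /f /= lv_hU !big_ord_recl big_ord0 addr0 !(raddfD, raddfMz) /=.
by rewrite ![lv_augA << _ >>]zmapU mulrNz subrr.
Qed.

Lemma lv_augA_v q (z : D 0 q.+1) : lv_augA (lv_v z) = chain_diff SY q (lv_augA z).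
Proof.
pose f : {additive D 0 q.+1 -> SY q} := @lv_augA q \o @lv_v 0 q.
pose g : {additive D 0 q.+1 -> SY q} := chain_diff SY q \o @lv_augA q.+1.
apply: (zlin_ext (f := f) (g := g)) => x; rewrite /f /g /=.
rewrite [lv_augA << _ >>]zmapU lv_vU [RHS]simplicial_diffU raddf_sum.
by apply: eq_bigr => i _; rewrite raddfMz /= [lv_augA _]zmapU.
Qed.

Definition lv_rowaug : row_augmentation level_complex SY :=
  @RowAug level_complex SY (fun q => @lv_augA q) lv_augA_h lv_augA_v.

Section LeastLevel.
Variables (q : nat) (s : Sing q).
Hypothesis ex : exists k, `[< forall t, avoid k (s t) >].

(** It depends on s alone and is below every level that s avoids. Appending it as the last level
    therefore keeps the levels decreasing and commutes with faces, which contracts the rows. *)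
Definition least_level : nat := ex_minn ex.

Lemma least_level_avoid t : avoid least_level (s t).
Proof. by rewrite /least_level; case: ex_minnP => k /asboolP + _; exact. Qed.

Lemma least_level_min k : (forall t, avoid k (s t)) -> (least_level <= k)%N.
Proof. by move=> av; rewrite /least_level; case: ex_minnP => l _; apply; apply/asboolP. Qed.

End LeastLevel.

Lemma levelled_ex p q (x : levelled p q) : exists k, `[< forall t, avoid k ((val x).2 t) >].
Proof. by exists (nth 0%N (val x).1 0); apply/asboolP; exact: levelled_avoid. Qed.

Lemma least_level_irr q (s s' : Sing q) (ex : exists k, `[< forall t, avoid k (s t) >])
  (ex' : exists k, `[< forall t, avoid k (s' t) >]) : s = s' -> least_level ex = least_level ex'.
Proof. by move=> ss'; subst s'; congr ex_minn; exact: Prop_irrelevance. Qed.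

Lemma append_subproof p q (x : levelled p q) :
  is_levelled ([tuple of rcons (val x).1 (least_level (levelled_ex x))], (val x).2).
Proof.
have nthE l : nth 0%N (rcons (val x).1 (least_level (levelled_ex x))) l =
    if (l < p.+1)%N then nth 0%N (val x).1 l
    else if l == p.+1 then least_level (levelled_ex x) else 0%N.
  by rewrite nth_rcons size_tuple.
apply/asboolP; split=> [i j /andP[ij jp]|l lp t] /=; rewrite !nthE.
  case: (ltnP j p.+1) => jp1; first by rewrite (leq_ltn_trans ij jp1) levelled_decr // ij.
  have -> : j = p.+1 by apply/eqP; rewrite eqn_leq jp.
  rewrite eqxx; case: (ltnP i p.+1) => ip; last by have -> : i == p.+1 by lia.
  by apply: least_level_min; exact: levelled_avoid.
case: (ltnP l p.+1) => lp1; first exact: levelled_avoid.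
have -> : l == p.+1 by lia.
exact: least_level_avoid.
Qed.

Definition level_append q p (x : level_rows q p) : level_rows q p.+1 :=
  exist (fun x => @is_levelled p.+1 q x) _ (append_subproof x).

Lemma level_append_max p q (x : levelled p q) :
  level_hact (coface ord_max) (level_append x) = x.
Proof.
apply: val_inj; case: x => -[ks s] xL /=; congr (_, _).
apply: eq_from_tnth => j; rewrite tnth_mktuple !(tnth_nth 0%N) /= nth_rcons size_tuple.
have jp := ltn_ord j; have -> : bump p.+1 j = j by rewrite /bump; lia.
by rewrite jp.
Qed.

Lemma level_append_widen p q (x : levelled p.+1 q) (i : 'I_p.+2) :
  level_hact (coface (widen_ord (leqnSn _) i)) (level_append x) =
  level_append (level_hact (coface i) x : level_rows q p).
Proof.
apply: val_inj; rewrite /=; congr (_, _).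
have lE : least_level (levelled_ex (level_hact (coface i) x)) = least_level (levelled_ex x).
  exact: least_level_irr.
apply: eq_from_tnth => j; rewrite tnth_mktuple !(tnth_nth 0%N) /= !nth_rcons !size_tuple !card_ord lE.
have ip := ltn_ord i; have jp := ltn_ord j.
have [jp1|jp1] := ltnP j p.+1.
  have -> : (bump i j < p.+2)%N by rewrite /bump; lia.
  by have := nth_level_act (coface i) (val x).1 jp1; rewrite /= inordK.
have -> : (bump i j < p.+2)%N = false by rewrite /bump; lia.
have -> : bump i j == p.+2 by rewrite /bump; lia.
by have -> : nat_of_ord j == p.+1 by lia.
Qed.

Definition level_least q (x : levelled 0 q) : levelled 0 q :=
  level_hact (coface ord0) (level_append x).

Lemma lv_rows_exact : rows_exact lv_rowaug.
Proof.
split=> [q z|p q z] dz; last first.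
  apply: (@cone_last_exact (level_rows q) (level_append (q := q)) p (fun=> True) z) => //.
  by move=> x _; split=> [|i]; [exact: level_append_max|exact: level_append_widen].
exists (- zmap (@level_append q 0) z).
pose f : {additive D 0 q -> D 0 q} := @lv_h 0 q \o zmap (@level_append q 0).
pose g : {additive D 0 q -> D 0 q} := zmap (@level_least q) \- idfun.
have -> : dc_h level_complex 0 q (- zmap (@level_append q 0) z) = - f z by rewrite raddfN.
have -> : f z = g z.
  apply: (zlin_ext (f := f) (g := g)) => x; rewrite /f /g /= !zmapU lv_hU.
  rewrite !big_ord_recl big_ord0 addr0 mulrNz; congr (_ - << _ >>).
  rewrite -[RHS]level_append_max; congr (level_hact (coface _) _); exact: val_inj.
(* [level_least x] only remembers the simplex and its least level, so it factors through the
   augmentation. *)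
have back (s : Sing q) : exists c : D 0 q, forall x : levelled 0 q,
    (val x).2 = s -> << level_least x >> = c.
  have [[x xs]|no] := pselect (exists x : levelled 0 q, (val x).2 = s); last first.
    by exists 0 => x xs; case: no; exists x.
  exists << level_least x >> => y ys; congr << _ >>; apply: val_inj => /=.
  congr (_, _); last by rewrite xs ys.
  apply: eq_from_tnth => j; rewrite !tnth_mktuple.
  rewrite !(tnth_nth 0%N) /= ord1 /= !nth_rcons !size_tuple /=.
  by apply: least_level_irr; rewrite xs.
have [b bE] := choice back.
pose h1 : {additive D 0 q -> D 0 q} := zmap (@level_least q).
pose h2 : {additive D 0 q -> D 0 q} := zlin b \o @lv_augA q.
have hE : h1 z = h2 z.
  apply: (zlin_ext (f := h1) (g := h2)) => x; rewrite /h1 /h2 /= !zmapU.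
  by rewrite [lv_augA _]zmapU zlinU; exact: bE.
by rewrite /g /= -[zmap _ z]/(h1 z) hE /h2 /= [lv_augA z]dz raddf0 sub0r opprK.
Qed.

Lemma simplex0_subproof : const_mx 1 \in Delta 0.
Proof.
by apply/mem_set; split=> [i|]; rewrite ?big_ord1 mxE ?ler01.
Qed.

Definition simplex0 : Delta 0 := exist (fun v => v \in Delta 0) _ simplex0_subproof.

(** The gap between equal levels is empty and has label 1, whence the condition in [is_layered]. *)
Lemma layer_subproof p (x : levelled p 0) :
  is_layered ((val x).1, level_labels (val x).1 ((val x).2 simplex0)).
Proof.
apply/layeredP => i ip /=; split.
  by apply: levelled_decr; rewrite leqnSn.
by move=> e; rewrite nth_level_labels // e gap_label_refl.
Qed.

Definition layer_of p (x : levelled p 0) : layered M p :=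
  exist (fun x => @is_layered M p x) _ (layer_subproof x).

Definition lv_augB p : D p 0 -> BB p := zmap (@layer_of p).
HB.instance Definition _ p := GRing.Additive.on (@lv_augB p).

Lemma lv_augB_v p (z : D p 1) : lv_augB (lv_v z) = 0.
Proof.
pose f : {additive D p 1 -> BB p} := @lv_augB p \o @lv_v p 0.
apply: (zlin_ext (f := f) (g := \0)) => x.
rewrite /f /= lv_vU !big_ord_recl big_ord0 addr0 !(raddfD, raddfMz) /=.
rewrite ![lv_augB << _ >>]zmapU mulrNz; apply/eqP; rewrite subr_eq0; apply/eqP.
congr << _ >>; apply: val_inj; congr (_, _).
exact: (level_labels_const conical (@levelled_avoid p 1 x)).
Qed.

Lemma lv_augB_h p (z : D p.+1 0) : lv_augB (lv_h z) = chain_diff BB p (lv_augB z).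
Proof.
pose f : {additive D p.+1 0 -> BB p} := @lv_augB p \o @lv_h p 0.
pose g : {additive D p.+1 0 -> BB p} := chain_diff BB p \o @lv_augB p.+1.
apply: (zlin_ext (f := f) (g := g)) => x; rewrite /f /g /=.
rewrite [lv_augB << _ >>]zmapU lv_hU [RHS]simplicial_diffU raddf_sum.
apply: eq_bigr => i _; rewrite raddfMz /= [lv_augB _]zmapU; congr (<< _ >> *~ _).
apply: val_inj; congr (_, _); apply: (level_labels_act conical).
  exact: levelled_decr.
by move=> l lp; exact: levelled_avoid.
Qed.

Definition lv_colaug : row_augmentation (dc_transpose level_complex) BB :=
  @RowAug (dc_transpose level_complex) BB (fun p => @lv_augB p) lv_augB_v lv_augB_h.

Lemma level_cone_subproof p q (x : levelled p q) :
  is_levelled ((val x).1, sing_cone (@levelled_decr p q x) (val x).2).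
Proof.
apply/asboolP; split=> [|l lp]; first exact: levelled_decr.
by apply: sing_cone_avoid => // t; exact: levelled_avoid.
Qed.

Definition level_cone p q (x : level_cols p q) : level_cols p q.+1 :=
  exist (fun x => @is_levelled p q.+1 x) _ (level_cone_subproof x).

Lemma layered_decr p (y : layered M p) : level_decr (val y).1.
Proof. by move=> i j ij; have [] := layered_range (valP y) ij. Qed.

(** The standard configuration onto which all those with the labels of y are squeezed. *)
Definition layer_pt p (y : layered M p) : Y := bpt (val y).2 (squeeze_pt R (@layered_decr p y)).

Lemma layer_pt_avoid p (y : layered M p) l : (l <= p)%N ->
  avoid (nth 0%N (val y).1 l) (layer_pt y).
Proof.
move=> lp; apply/(avoidE conical) => i ip; rewrite psum_squeeze /=; last exact: leqW.
set k := nth _ _ l; set k' := nth _ _ i; case: ifP => _ /andP[h1 h2].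
  by have [_ [_ /(le_lt_trans h2)]] := jlo_jhi R k; rewrite ltxx.
case: (ltnP k k') => kk'; first by have := lt_le_trans (jgap_jlo R kk') h1; rewrite ltxx.
have := lt_le_trans (jhi_gap R k) (jgap_le R kk').
by move/lt_le_trans/(_ h2); rewrite ltxx.
Qed.

Lemma prod_single (F : nat -> M) n j : (j < n)%N ->
  (forall i, (i < n)%N -> i <> j -> F i = 1%g) -> (\prod_(0 <= i < n) F i = F j)%g.
Proof.
move=> jn F1; rewrite (@big_cat_nat _ _ _ j) //=; last exact: ltnW.
rewrite big_nat_cond big1 ?mul1g; last first.
  by move=> i /andP[/andP[_ ij] _]; apply: F1; lia.
rewrite big_ltn // big_nat_cond big1 ?mulg1 // => i /andP[/andP[ji lt_in] _].
by apply: F1; lia.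
Qed.

Lemma level_labels_layer_pt p (y : layered M p) :
  level_labels (val y).1 (layer_pt y) = (val y).2.
Proof.
set ks := (val y).1; pose kk := nth 0%N ks.
have kd : level_decr ks := @layered_decr p y.
apply: eq_from_tnth => j; have jp := ltn_ord j; rewrite [RHS](tnth_nth 1%g) tnth_mktuple.
rewrite gap_labelE // big_mkcond /= (prod_single (j := j)) //.
  have /layeredP/(_ j jp)[kj kj1] := valP y; rewrite psum_squeeze 1?leqW //=.
  case: ifP => // /negbT/negP cond; symmetry; apply: kj1.
  apply: contra_notP cond => /eqP ne; have lt_kj : (kk j.+1 < kk j)%N by rewrite ltn_neqAle ne.
  have kp : (kk p <= kk j.+1)%N by apply: kd; rewrite jp /=.
  rewrite -/kk; case: eqP => [e|_]; first by move: kp; rewrite leqNgt -e lt_kj.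
  by rewrite jhi_gap jgap_jlo.
move=> i ip ij; rewrite psum_squeeze 1?leqW //=; case: ifP => // /andP[].
have [_ [lohi_j hi1]] := jlo_jhi R (kk j.+1); have [_ [lohi _]] := jlo_jhi R (kk j).
case: ifP => [_ _ h|_ h1 h2]; first by have := lt_trans h (lt_trans lohi_j hi1); rewrite ltxx.
have ki : (kk i <= kk j)%N.
  rewrite leqNgt; apply/negP => lt_ki.
  by have := lt_trans (lt_trans h1 (jgap_jlo R lt_ki)) lohi; rewrite ltxx.
have ki' : (kk j.+1 < kk i)%N.
  rewrite ltnNge; apply/negP => le_ki; have h := le_trans (ltW h2) (ltW lohi_j).
  by have := le_lt_trans (le_trans (jgap_le R le_ki) h) (jhi_gap R _); rewrite ltxx.
have lt_ij : (i < j)%N.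
  rewrite ltn_neqAle; apply/andP; split; first exact/eqP.
  rewrite leqNgt; apply/negP => ji; have : (kk i <= kk j.+1)%N by apply: kd; lia.
  by rewrite leqNgt ki'.
have /layeredP/(_ i ip)[le_i ->//] := valP y.
apply/eqP; rewrite eqn_leq le_i; apply: leq_trans ki _; apply: kd; lia.
Qed.

Lemma level_pt_subproof p (y : layered M p) :
  is_levelled ((val y).1, (cst (layer_pt y) : continuousType (Delta 0) Y) : Sing 0).
Proof.
by apply/asboolP; split=> [|l lp t]; [exact: layered_decr|exact: layer_pt_avoid].
Qed.

Definition level_pt p (y : layered M p) : levelled p 0 :=
  exist (fun x => @is_levelled p 0 x) _ (level_pt_subproof y).

Lemma layer_of_pt p (y : layered M p) : layer_of (level_pt y) = y.
Proof.
apply: val_inj; rewrite [RHS]surjective_pairing; congr (_, _).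
exact: level_labels_layer_pt.
Qed.

Lemma level_cone_vertex p (x : levelled p 0) :
  level_vact (coface ord_max) (level_cone x : levelled p 1) = level_pt (layer_of x).
Proof.
apply: val_inj; congr (_, _); apply/continuousEP => t.
rewrite [LHS](sing_cone_vertex conical _ _ simplex0); last first.
  by move=> l lp; exact: levelled_avoid.
by congr (bpt _ (squeeze_pt _ _)); exact: Prop_irrelevance.
Qed.

Lemma level_cone0 p q (x : levelled p q) :
  level_vact (coface ord0) (level_cone x : levelled p q.+1) = x.
Proof.
apply: val_inj; rewrite [RHS]surjective_pairing; congr (_, _).
exact: sing_cone_coface0.
Qed.

Lemma level_coneS p q (x : levelled p q.+1) (i : 'I_q.+2) :
  level_vact (coface (fintype.lift ord0 i)) (level_cone x : levelled p q.+2) =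
  level_cone (level_vact (coface i) x : level_cols p q).
Proof.
apply: val_inj; congr (_, _); rewrite [LHS](sing_cone_cofaceS conical).
  exact: (congr1 (fun kd => sing_cone kd _) (Prop_irrelevance _ _)).
by move=> l lp; exact: (@levelled_avoid _ _ x).
Qed.

Lemma lv_cols_exact : rows_exact lv_colaug.
Proof.
split=> [p z|q p z] dz; last first.
  exists (zmap (@level_cone p q.+1) z).
  rewrite [LHS](@cone_first_exact (level_cols p) (@level_cone p) q (fun=> True) z) //.
    by rewrite (dz : @simplicial_diff (level_cols p) q z = 0) raddf0 subr0.
  by move=> x _; split=> [|i]; [exact: level_cone0|exact: level_coneS].
exists (zmap (@level_cone p 0) z).
pose f : {additive D p 0 -> D p 0} := @lv_v p 0 \o zmap (@level_cone p 0).
pose g : {additive D p 0 -> D p 0} := idfun \- (zmap (@level_pt p) \o @lv_augB p).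
rewrite -[LHS]/(f z); have -> : f z = g z.
  apply: (zlin_ext (f := f) (g := g)) => x; rewrite /f /g /= zmapU.
  rewrite [lv_v _]cone_diff0; last exact: level_cone0.
  by rewrite [lv_augB _]zmapU [zmap _ << _ >>]zmapU -level_cone_vertex.
by rewrite /g /= [lv_augB z]dz raddf0 subr0.
Qed.

Theorem level_homology : aug_onto lv_rowaug ->
  forall n, zmod_iso (homology SY n) (homology BB n).
Proof.
move=> onto; apply: (double_complex_iso lv_rows_exact onto lv_cols_exact) => p b.
exists (zmap (@level_pt p) b); rewrite [LHS]zmap_comp -[RHS]zmap_id.
by apply: eq_zmap => y; exact: layer_of_pt.
Qed.

End LevelledSimplices.

Lemma supported_additive (K L : choiceType) (f : {additive {freeg K / int} -> {freeg L / int}})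
    (P : K -> Prop) (Q : L -> Prop) z :
  (forall x, P x -> supported Q (f << x >>)) -> supported P z -> supported Q (f z).
Proof.
move=> PQ Pz; rewrite [z]freeg_sumMz raddf_sum big_seq; apply: supported_sum => x xz.
by rewrite raddfMz; apply: supportedMz; apply: PQ; apply: Pz; rewrite -mem_dom.
Qed.

(** * Barycentric subdivision *)

Section TupleSet.
Variable E : choiceType.

Definition tuple_act k n (f : delta_map k n) (v : n.+1.-tuple E) : k.+1.-tuple E :=
  [tuple tnth v (f j) | j < k.+1].

Lemma tuple_act_id n (v : n.+1.-tuple E) : tuple_act (delta_id n) v = v.
Proof. by apply: eq_from_tnth => j; rewrite tnth_mktuple. Qed.

Lemma tuple_act_comp k l n (f : delta_map l n) (g : delta_map k l) (v : n.+1.-tuple E) :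
  tuple_act (delta_comp f g) v = tuple_act g (tuple_act f v).
Proof. by apply: eq_from_tnth => j; rewrite !tnth_mktuple. Qed.

(** Simplices are plain vertex lists, which makes subdivision formal; geometry enters through
    barycentres and affine maps. *)
Definition tuple_set : simplicial_set :=
  @SimplicialSet (fun n => n.+1.-tuple E) tuple_act tuple_act_id tuple_act_comp.

Definition tuple_cone (b : E) n (v : tuple_set n) : tuple_set n.+1 := [tuple of b :: v].

Lemma tuple_cone0 b n (v : n.+1.-tuple E) :
  tuple_act (coface ord0) (tuple_cone b v) = v.
Proof. by apply: eq_from_tnth => j; rewrite tnth_mktuple /= tnthS. Qed.

Lemma tuple_coneS b n (v : n.+2.-tuple E) (i : 'I_n.+2) :
  tuple_act (coface (fintype.lift ord0 i)) (tuple_cone b v) =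
  tuple_cone b (tuple_act (coface i) v : tuple_set n).
Proof.
apply: eq_from_tnth => j; rewrite tnth_mktuple.
case: (unliftP ord0 j) => [l ->|->].
  have -> : coface (fintype.lift ord0 i) (fintype.lift ord0 l) = fintype.lift ord0 (coface i l).
    by apply: val_inj; rewrite /= /bump; lia.
  by rewrite !tnthS tnth_mktuple.
have -> : coface (fintype.lift ord0 i) ord0 = ord0 by exact: val_inj.
by rewrite !tnth0.
Qed.

Lemma tuple_cone_vertex b (v : 1.-tuple E) :
  tuple_act (coface ord_max) (tuple_cone b v) = [tuple b].
Proof.
by apply: eq_from_tnth => j; rewrite tnth_mktuple !(tnth_nth b) /= ord1.
Qed.

End TupleSet.

Section Subdivision.
Variables (E : choiceType) (bary : forall n, n.+1.-tuple E -> E).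
Local Notation L n := {freeg (n.+1.-tuple E) / int}.
Local Notation diff := (@simplicial_diff (tuple_set E) _).
Local Notation cone b := (zmap (@tuple_cone E b _)).

(** The subdivided boundary is coned off from the barycentre; the chain identities hold for any
    choice of apex. *)
Fixpoint subdiv n : L n -> L n :=
  if n is n'.+1 return L n -> L n then
    zlin (fun v => cone (bary v) (subdiv (diff << v >>)))
  else id.

Lemma subdiv_is_additive n : zmod_morphism (@subdiv n).
Proof. by case: n => [//|n]; exact: zlin_is_zmod_morphism. Qed.

HB.instance Definition _ n :=
  GRing.isZmodMorphism.Build (L n) (L n) (@subdiv n) (@subdiv_is_additive n).

Lemma subdivU n (v : n.+2.-tuple E) :
  subdiv << v >> = cone (bary v) (subdiv (diff << v >>)).
Proof. exact: zlinU. Qed.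

Fixpoint sd_htpy n : L n -> L n.+1 :=
  if n is n'.+1 return L n -> L n.+1 then
    zlin (fun v => cone (bary v) (<< v >> - sd_htpy (diff << v >>)))
  else fun=> 0.

Lemma sd_htpy_is_additive n : zmod_morphism (@sd_htpy n).
Proof.
case: n => [|n]; last exact: zlin_is_zmod_morphism.
by move=> x y; rewrite /= subr0.
Qed.

HB.instance Definition _ n :=
  GRing.isZmodMorphism.Build (L n) (L n.+1) (@sd_htpy n) (@sd_htpy_is_additive n).

Lemma sd_htpyU n (v : n.+2.-tuple E) :
  sd_htpy << v >> = cone (bary v) (<< v >> - sd_htpy (diff << v >>)).
Proof. exact: zlinU. Qed.

Lemma cone_diffS n b (z : L n.+1) : diff (cone b z) = z - cone b (diff z).
Proof.
apply: (@cone_first_exact (tuple_set E) (@tuple_cone E b) n (fun=> True)) => // v _.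
by split=> [|i]; [exact: tuple_cone0|exact: tuple_coneS].
Qed.

(** In degree 0 the boundary of a cone also contains the apex, which cancels on boundaries. *)
Lemma cone_diff0_boundary b (z : L 1) : diff (cone b (diff z)) = diff z.
Proof.
pose f : {additive L 1 -> L 0} := diff \o cone b \o diff.
apply: (zlin_ext (f := f) (g := diff)) => v; rewrite /f /=.
rewrite -[zlin _ _]/(diff << v >>) !simplicial_diffU !big_ord_recl !big_ord0 addr0 !(raddfD, raddfMz) /=.
rewrite !zmapU !cone_diff0; try exact: tuple_cone0.
rewrite /= !tuple_cone_vertex /bump /= expr1 expr0 !mulrNz !mulr1z.
by rewrite opprB addrA subrK addrC.
Qed.

Lemma subdiv_diff n (z : L n.+1) : diff (subdiv z) = subdiv (diff z).
Proof.
pose f k : {additive L k.+1 -> L k} := @simplicial_diff (tuple_set E) k \o @subdiv k.+1.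
pose g k : {additive L k.+1 -> L k} := @subdiv k \o @simplicial_diff (tuple_set E) k.
elim: n z => [|n IHn] z; apply: (zlin_ext (f := f _) (g := g _)) => v; rewrite /f /g /= zlinU.
  exact: cone_diff0_boundary.
rewrite cone_diffS IHn simplicial_diffK (raddf0 (@subdiv n)).
by rewrite (raddf0 (cone (bary v))) subr0.
Qed.

Lemma sd_htpy_diff n (z : L n.+1) :
  diff (sd_htpy z) = z - subdiv z - sd_htpy (diff z).
Proof.
pose f k : {additive L k.+1 -> L k.+1} := @simplicial_diff (tuple_set E) k.+1 \o @sd_htpy k.+1.
pose g k : {additive L k.+1 -> L k.+1} :=
  idfun \- @subdiv k.+1 \- (@sd_htpy k \o @simplicial_diff (tuple_set E) k).
elim: n z => [|n IHn] z; apply: (zlin_ext (f := f _) (g := g _)) => v.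
  by rewrite /f /g /= zlinU !subr0 cone_diffS zlinU.
rewrite -[LHS]/(diff (sd_htpy << v >>)).
rewrite -[RHS]/(<< v >> - subdiv << v >> - sd_htpy (diff << v >>)).
have dE : diff (<< v >> - sd_htpy (diff << v >>)) = subdiv (diff << v >>).
  rewrite raddfB [X in _ - X]IHn simplicial_diffK (raddf0 (@sd_htpy n)) subr0.
  by rewrite opprB addrC subrK.
by rewrite [in LHS]sd_htpyU cone_diffS dE subdivU addrAC.
Qed.

Lemma diff_supported n (P : n.+1.-tuple E -> Prop) (v : n.+2.-tuple E) :
  (forall i, P (tuple_act (coface i) v)) -> supported P (diff << v >>).
Proof.
move=> Pv; rewrite simplicial_diffU; apply: supported_sum => i _.
by apply: supportedMz; apply: supportedU; exact: Pv.
Qed.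

Lemma subdiv_hull (P : E -> Prop) n (v : n.+1.-tuple E) :
  (forall k (w : k.+1.-tuple E), (forall i, P (tnth w i)) -> P (bary w)) ->
  (forall i, P (tnth v i)) ->
  supported (fun w : n.+1.-tuple E => forall i, P (tnth w i)) (subdiv << v >>).
Proof.
move=> Pb; elim: n v => [|n IHn] v Pv; first exact: supportedU.
rewrite subdivU; apply: (@supported_zlin _ _ (fun w : n.+1.-tuple E => forall i, P (tnth w i))).
  move=> w Pw; apply: supportedU => i; case: (unliftP ord0 i) => [j ->|->].
    by rewrite tnthS.
  by rewrite tnth0; exact: Pb.
apply: (supported_additive (f := @subdiv n)) (IHn) _; apply: diff_supported => i j.
by rewrite tnth_mktuple.
Qed.

End Subdivision.

Section Naturality.
Variables (E F : choiceType) (bE : forall n, n.+1.-tuple E -> E)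
          (bF : forall n, n.+1.-tuple F -> F) (f : E -> F).
Hypothesis fb : forall n (v : n.+1.-tuple E), bF [tuple of map f v] = f (bE v).
Local Notation fmap n := (zmap (fun v : n.+1.-tuple E => [tuple of map f v])).

Lemma tuple_map_diff n (z : {freeg (n.+2.-tuple E) / int}) :
  fmap n (@simplicial_diff (tuple_set E) n z) =
  @simplicial_diff (tuple_set F) n (fmap n.+1 z).
Proof.
pose h1 : {additive {freeg (n.+2.-tuple E) / int} -> {freeg (n.+1.-tuple F) / int}} :=
  fmap n \o @simplicial_diff (tuple_set E) n.
pose h2 : {additive {freeg (n.+2.-tuple E) / int} -> {freeg (n.+1.-tuple F) / int}} :=
  @simplicial_diff (tuple_set F) n \o fmap n.+1.
apply: (zlin_ext (f := h1) (g := h2)) => v; rewrite /h1 /h2 /= zmapU zlinU simplicial_diffU.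
rewrite /face_sum raddf_sum; apply: eq_bigr => i _; rewrite raddfMz /= zmapU; congr (<< _ >> *~ _).
by apply: eq_from_tnth => j; rewrite !(tnth_map, tnth_mktuple).
Qed.

Lemma tuple_map_cone b n (z : {freeg (n.+1.-tuple E) / int}) :
  fmap n.+1 (zmap (@tuple_cone E b n) z) = zmap (@tuple_cone F (f b) n) (fmap n z).
Proof.
pose h1 : {additive {freeg (n.+1.-tuple E) / int} -> {freeg (n.+2.-tuple F) / int}} :=
  fmap n.+1 \o zmap (@tuple_cone E b n).
pose h2 : {additive {freeg (n.+1.-tuple E) / int} -> {freeg (n.+2.-tuple F) / int}} :=
  zmap (@tuple_cone F (f b) n) \o fmap n.
apply: (zlin_ext (f := h1) (g := h2)) => v; rewrite /h1 /h2 /= !zmapU; congr << _ >>.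
exact: val_inj.
Qed.

Lemma subdiv_map n (z : {freeg (n.+1.-tuple E) / int}) :
  fmap n (subdiv bE z) = subdiv bF (fmap n z).
Proof.
elim: n z => [//|n IHn] z.
pose h1 : {additive {freeg (n.+2.-tuple E) / int} -> {freeg (n.+2.-tuple F) / int}} :=
  fmap n.+1 \o @subdiv _ bE n.+1.
pose h2 : {additive {freeg (n.+2.-tuple E) / int} -> {freeg (n.+2.-tuple F) / int}} :=
  @subdiv _ bF n.+1 \o fmap n.+1.
apply: (zlin_ext (f := h1) (g := h2)) => v.
rewrite -[LHS]/(fmap n.+1 (subdiv bE << v >>)) -[RHS]/(subdiv bF (fmap n.+1 << v >>)).
by rewrite zmapU !subdivU tuple_map_cone -fb IHn tuple_map_diff zmapU.
Qed.

Lemma sd_htpy_map n (z : {freeg (n.+1.-tuple E) / int}) :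
  fmap n.+1 (sd_htpy bE z) = sd_htpy bF (fmap n z).
Proof.
elim: n z => [z|n IHn z]; first exact: raddf0.
pose h1 : {additive {freeg (n.+2.-tuple E) / int} -> {freeg (n.+3.-tuple F) / int}} :=
  fmap n.+2 \o @sd_htpy _ bE n.+1.
pose h2 : {additive {freeg (n.+2.-tuple E) / int} -> {freeg (n.+3.-tuple F) / int}} :=
  @sd_htpy _ bF n.+1 \o fmap n.+1.
apply: (zlin_ext (f := h1) (g := h2)) => v.
rewrite -[LHS]/(fmap n.+2 (sd_htpy bE << v >>)) -[RHS]/(sd_htpy bF (fmap n.+1 << v >>)).
by rewrite zmapU !sd_htpyU tuple_map_cone -fb raddfB [X in X - _]zmapU [X in _ - X]IHn tuple_map_diff zmapU.
Qed.

End Naturality.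

Section AffineSimplices.
Variable R : realType.
Local Notation Delta n := (std_simplex R n : topologicalType).

Lemma fun_cont_sum (T : topologicalType) n (F : 'I_n -> T -> R) :
  (forall i, continuous (F i)) -> continuous (fun x => \sum_i F i x).
Proof.
move=> Fc; apply: (continuous_big (op := fun x y : R => x + y)) => [|i _].
  exact: add_continuous.
exact: Fc.
Qed.

Section Affine.
Variables (n q : nat) (v : q.+1.-tuple (Delta n)).

Definition affine_row (t : Delta q) : 'rV[R]_n.+1 :=
  \sum_i (val t) 0 i *: val (tnth v i).

Lemma affine_coord t j : affine_row t 0 j = \sum_i (val t) 0 i * (val (tnth v i)) 0 j.
Proof. by rewrite summxE; apply: eq_bigr => i _; rewrite mxE. Qed.

Lemma affine_simplex t : affine_row t \in std_simplex R n.
Proof.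
apply/mem_set; split=> [j|].
  by rewrite affine_coord sumr_ge0 // => i _; rewrite mulr_ge0 ?simplex_ge0.
under eq_bigr do rewrite affine_coord; rewrite exchange_big /=.
have [_ <-] := set_mem (valP t); apply: eq_bigr => i _.
by rewrite -mulr_sumr; have [_ ->] := set_mem (valP (tnth v i)); rewrite mulr1.
Qed.

Definition affine (t : Delta q) : Delta n :=
  exist (fun u => u \in std_simplex R n) _ (affine_simplex t).

Lemma affine_continuous : continuous affine.
Proof.
apply: simplex_continuous => j; rewrite (_ : (fun t => _) = fun t : Delta q =>
  \sum_i (val t) 0 i * (val (tnth v i)) 0 j); last first.
  by apply/funext => t; exact: affine_coord.
apply: (@fun_cont_sum (Delta q)) => i.
apply: (@fun_contM R (Delta q)); first exact: simplex_coord_continuous.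
exact: cst_continuous.
Qed.

HB.instance Definition _ := @isContinuous.Build (Delta q) (Delta n) affine affine_continuous.

End Affine.

Lemma simplexP n (t u : Delta n) : (forall j, (val t) 0 j = (val u) 0 j) -> t = u.
Proof. by move=> tu; apply/val_inj/rowP. Qed.

Lemma affineE n q (v : q.+1.-tuple (Delta n)) t j :
  (val (affine v t)) 0 j = \sum_i (val t) 0 i * (val (tnth v i)) 0 j.
Proof. exact: affine_coord. Qed.

Lemma affine_affine n q k (u : q.+1.-tuple (Delta n)) (v : k.+1.-tuple (Delta q)) t :
  affine [tuple of map (affine u) v] t = affine u (affine v t).
Proof.
apply: simplexP => j; rewrite !affineE.
under [RHS]eq_bigr do rewrite affineE mulr_suml.
rewrite exchange_big /=; apply: eq_bigr => i _; rewrite tnth_map affineE mulr_sumr.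
by apply: eq_bigr => l _; rewrite mulrA.
Qed.

Lemma affine_act n k q (f : delta_map k q) (v : q.+1.-tuple (Delta n)) t :
  affine (tuple_act f v) t = affine v (simplex_map f t).
Proof.
apply: simplexP => j; rewrite !affineE (partition_big f xpredT) //=.
apply: eq_bigr => l _; rewrite mxE mulr_suml; apply: eq_bigr => i /eqP <-.
by rewrite tnth_mktuple.
Qed.

Definition vertex_row n (i : 'I_n.+1) : 'rV[R]_n.+1 := \row_j (j == i)%:R.

Lemma vertex_simplex n i : vertex_row i \in std_simplex R n.
Proof.
apply/mem_set; split=> [j|]; first by rewrite mxE ler0n.
by rewrite (bigD1 i) //= mxE eqxx big1 ?addr0 // => j /negbTE ji; rewrite mxE ji.
Qed.

Definition vertex n i : Delta n := exist (fun u => u \in std_simplex R n) _ (vertex_simplex i).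

Definition vertices n : n.+1.-tuple (Delta n) := [tuple vertex i | i < n.+1].

Lemma affine_vertices n t : affine (vertices n) t = t.
Proof.
apply: simplexP => j; rewrite affineE (bigD1 j) //= tnth_mktuple mxE eqxx mulr1.
rewrite big1 ?addr0 // => i ij; rewrite tnth_mktuple mxE eq_sym (negbTE ij).
by rewrite mulr0.
Qed.

Lemma affine_vertex n q (v : q.+1.-tuple (Delta n)) i : affine v (vertex i) = tnth v i.
Proof.
apply: simplexP => j; rewrite affineE (bigD1 i) //= mxE eqxx mul1r.
by rewrite big1 ?addr0 // => l li; rewrite mxE (negbTE li) mul0r.
Qed.

Lemma map_affine_vertices n q (v : q.+1.-tuple (Delta n)) :
  [tuple of map (affine v) (vertices q)] = v.
Proof. by apply: eq_from_tnth => i; rewrite tnth_map tnth_mktuple affine_vertex. Qed.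

Definition center_row n : 'rV[R]_n.+1 := const_mx n.+1%:R^-1.

Lemma center_simplex n : center_row n \in std_simplex R n.
Proof.
apply/mem_set; split=> [j|]; first by rewrite mxE invr_ge0 ler0n.
under eq_bigr do rewrite mxE; rewrite sumr_const card_ord -[LHS]mulr_natl divff //.
by rewrite pnatr_eq0.
Qed.

Definition center n : Delta n := exist (fun u => u \in std_simplex R n) _ (center_simplex n).

Definition barycenter n q (v : q.+1.-tuple (Delta n)) : Delta n := affine v (center q).

Lemma affine_barycenter n q k (u : q.+1.-tuple (Delta n)) (v : k.+1.-tuple (Delta q)) :
  barycenter [tuple of map (affine u) v] = affine u (barycenter v).
Proof. exact: affine_affine. Qed.

Section Mesh.
Variable n : nat.
Definition simplex_dist (x y : Delta n) : R := `|val x - val y|.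
Local Notation dist := simplex_dist.

Lemma affine_dist q (v : q.+1.-tuple (Delta n)) x t r :
  (forall i, dist x (tnth v i) <= r) -> dist x (affine v t) <= r.
Proof.
move=> xr; have [t0 t1] := set_mem (valP t).
have -> : dist x (affine v t) = `|\sum_i (val t) 0 i *: (val x - val (tnth v i))|.
  congr `| _ |; under eq_bigr do rewrite scalerBr; rewrite sumrB -scaler_suml t1.
  by rewrite scale1r.
apply: le_trans (ler_norm_sum _ _ _) _; rewrite -[leRHS]mul1r -t1 mulr_suml.
by apply: ler_sum => i _; rewrite normrZ ger0_norm // ler_wpM2l // xr.
Qed.

Definition mesh_le q d (v : q.+1.-tuple (Delta n)) : Prop :=
  forall i j, dist (tnth v i) (tnth v j) <= d.

(** One of the q+1 equal terms of the average vanishes, whence the ratio q/(q+1), bounded by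
    N/(N+1). *)
Lemma barycenter_dist N q d (v : q.+1.-tuple (Delta n)) i : (q <= N)%N ->
  mesh_le d v -> dist (tnth v i) (barycenter v) <= (1 - N.+1%:R^-1) * d.
Proof.
move=> qN vd; have d0 : 0 <= d by apply: le_trans (vd i i); exact: normr_ge0.
have s1 : \sum_(j < q.+1) q.+1%:R^-1 = 1 :> R.
  by rewrite sumr_const card_ord -[LHS]mulr_natl divff // pnatr_eq0.
have -> : dist (tnth v i) (barycenter v) =
    `|\sum_(j < q.+1) q.+1%:R^-1 *: (val (tnth v i) - val (tnth v j))|.
  congr `| _ |; under eq_bigr do rewrite scalerBr; rewrite sumrB -scaler_suml s1.
  by rewrite scale1r; congr (_ - _); apply: eq_bigr => j _; rewrite mxE.
apply: le_trans (ler_norm_sum _ _ _) _.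
rewrite (bigD1 i) //= subrr scaler0 normr0 add0r.
have -> : (1 - N.+1%:R^-1) * d = \sum_(j < q.+1) q.+1%:R^-1 * d - N.+1%:R^-1 * d.
  by rewrite -mulr_suml s1 mulrBl.
rewrite [X in _ <= X - _](bigD1 i) //=.
have qN' : N.+1%:R^-1 * d <= q.+1%:R^-1 * d.
  by rewrite ler_wpM2r // lef_pV2 ?posrE ?ltr0n // ler_nat.
apply: (@le_trans _ _ (\sum_(j < q.+1 | j != i) q.+1%:R^-1 * d)); last by rewrite addrAC lerDr subr_ge0.
by apply: ler_sum => j _; rewrite normrZ ger0_norm ?invr_ge0 // ler_wpM2l ?invr_ge0 ?vd.
Qed.

(** Edges at the barycentre are bounded by [barycenter_dist], as distance balls are convex, and the
    others by induction on the face. A fixed N keeps the ratio uniform over all faces. *)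
Lemma subdiv_mesh N q d (v : q.+1.-tuple (Delta n)) : (q <= N)%N -> mesh_le d v ->
  supported (mesh_le ((1 - N.+1%:R^-1) * d)) (subdiv (@barycenter n) << v >>).
Proof.
move=> + vd; have d0 : 0 <= d by apply: le_trans (vd ord0 ord0); exact: normr_ge0.
have c0 : 0 <= 1 - N.+1%:R^-1 :> R.
  by rewrite subr_ge0 invf_le1 ?ltr0n // ler1n.
elim: q v vd => [|q IHq] v vd qN.
  apply: supportedU => i j; rewrite !ord1 /dist subrr normr0.
  exact: mulr_ge0.
rewrite subdivU; apply: (@supported_zlin _ _ (fun w : q.+1.-tuple (Delta n) =>
  mesh_le ((1 - N.+1%:R^-1) * d) w /\
  forall i, dist (barycenter v) (tnth w i) <= (1 - N.+1%:R^-1) * d)).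
  move=> w [wd bw]; apply: supportedU => i j.
  have distC x y : dist x y = dist y x by exact: distrC.
  case: (unliftP ord0 i) => [k ->|->]; case: (unliftP ord0 j) => [l ->|->];
    rewrite ?tnthS ?tnth0 //; last by rewrite /dist subrr normr0 mulr_ge0.
  by rewrite distC.
apply: (supported_additive (f := @subdiv _ _ q) (P := fun w : q.+1.-tuple (Delta n) =>
  mesh_le d w /\ forall i, dist (barycenter v) (tnth w i) <= (1 - N.+1%:R^-1) * d)).
  move=> w [wd bw] u uw; split; first by apply: IHq uw => //; exact: ltnW.
  apply: (@subdiv_hull _ (@barycenter n)
    (fun x => dist (barycenter v) x <= (1 - N.+1%:R^-1) * d) q w) uw => // k x xb.
  exact: affine_dist.
apply: diff_supported => i; split=> [j k|j]; rewrite !tnth_mktuple //.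
by rewrite /dist distrC; exact: barycenter_dist.
Qed.

End Mesh.

End AffineSimplices.

(** * Subdivision of singular chains *)

Section SingularSubdivision.
Variables (R : realType) (Y : topologicalType).
Local Notation Delta n := (std_simplex R n : topologicalType).
Local Notation Sing n := (singular_simplex R Y n).
Local Notation SY := (singular_complex R Y).
Local Notation sdiff := (@simplicial_diff (singular_set R Y) _).
Local Notation tdiff := (@simplicial_diff (tuple_set _) _).
Local Notation bary n := (fun q => @barycenter R n q).

Definition sing_affine n q (s : Sing n) (v : q.+1.-tuple (Delta n)) : Sing q :=
  (s : continuousType _ _) \o affine v.

Lemma sing_affine_act n k q (s : Sing n) (f : delta_map k q) (v : q.+1.-tuple (Delta n)) :
  singular_act f (sing_affine s v) = sing_affine s (tuple_act f v).
Proof. by apply/continuousEP => t /=; rewrite affine_act. Qed.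

Lemma sing_affine_comp n q k (s : Sing n) (u : q.+1.-tuple (Delta n)) (v : k.+1.-tuple (Delta q)) :
  sing_affine (sing_affine s u) v = sing_affine s [tuple of map (affine u) v].
Proof. by apply/continuousEP => t /=; rewrite affine_affine. Qed.

Lemma sing_affine_vertices n (s : Sing n) : sing_affine s (vertices R n) = s.
Proof. by apply/continuousEP => t /=; rewrite affine_vertices. Qed.

Definition sing_map n q (s : Sing n) : {freeg (q.+1.-tuple (Delta n)) / int} -> SY q :=
  zmap (sing_affine s).
HB.instance Definition _ n q s := GRing.Additive.on (@sing_map n q s).

Lemma sing_mapU n q (s : Sing n) (v : q.+1.-tuple (Delta n)) :
  sing_map s << v >> = << sing_affine s v >>.
Proof. exact: zmapU. Qed.

Lemma sing_map_vertices n (s : Sing n) : sing_map s << vertices R n >> = << s >>.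
Proof. by rewrite sing_mapU sing_affine_vertices. Qed.

Lemma sing_map_diff n q (s : Sing n) (z : {freeg (q.+2.-tuple (Delta n)) / int}) :
  sdiff (sing_map s z) = sing_map s (tdiff z).
Proof.
pose f : {additive {freeg (q.+2.-tuple (Delta n)) / int} -> SY q} :=
  @simplicial_diff (singular_set R Y) q \o @sing_map n q.+1 s.
pose g : {additive {freeg (q.+2.-tuple (Delta n)) / int} -> SY q} :=
  @sing_map n q s \o @simplicial_diff (tuple_set _) q.
apply: (zlin_ext (f := f) (g := g)) => v.
rewrite -[LHS]/(sdiff (sing_map s << v >>)) -[RHS]/(sing_map s (tdiff << v >>)).
rewrite sing_mapU !simplicial_diffU raddf_sum; apply: eq_bigr => i _.
by rewrite raddfMz /= sing_mapU sing_affine_act.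
Qed.

(** The subdivision of the model simplex, pushed forward by s; it is a chain map because affine maps
    commute with [subdiv]. *)
Definition sing_sd n : SY n -> SY n :=
  zlin (fun s : Sing n => sing_map s (subdiv (bary n) << vertices R n >>)).
HB.instance Definition _ n := GRing.Additive.on (@sing_sd n).

Definition sing_htpy n : SY n -> SY n.+1 :=
  zlin (fun s : Sing n => sing_map s (sd_htpy (bary n) << vertices R n >>)).
HB.instance Definition _ n := GRing.Additive.on (@sing_htpy n).

Lemma sing_sdU n (s : Sing n) :
  sing_sd << s >> = sing_map s (subdiv (bary n) << vertices R n >>).
Proof. exact: zlinU. Qed.

Lemma sing_htpyU n (s : Sing n) :
  sing_htpy << s >> = sing_map s (sd_htpy (bary n) << vertices R n >>).
Proof. exact: zlinU. Qed.

Lemma sing_map_map n q k (s : Sing n) (v : q.+1.-tuple (Delta n))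
    (z : {freeg (k.+1.-tuple (Delta q)) / int}) :
  sing_map (sing_affine s v) z =
  sing_map s (zmap (fun u : k.+1.-tuple (Delta q) => [tuple of map (affine v) u]) z).
Proof.
pose h : {additive {freeg (k.+1.-tuple (Delta q)) / int} -> SY k} :=
  @sing_map n k s \o zmap (fun u : k.+1.-tuple (Delta q) => [tuple of map (affine v) u]).
apply: (zlin_ext (f := sing_map (sing_affine s v)) (g := h)) => u.
by rewrite /h /= sing_mapU zmapU sing_mapU sing_affine_comp.
Qed.

Lemma sing_sd_map n q (s : Sing n) (z : {freeg (q.+1.-tuple (Delta n)) / int}) :
  sing_sd (sing_map s z) = sing_map s (subdiv (bary n) z).
Proof.
pose f : {additive {freeg (q.+1.-tuple (Delta n)) / int} -> SY q} :=
  @sing_sd q \o @sing_map n q s.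
pose g : {additive {freeg (q.+1.-tuple (Delta n)) / int} -> SY q} :=
  @sing_map n q s \o @subdiv _ (bary n) q.
apply: (zlin_ext (f := f) (g := g)) => v.
rewrite -[LHS]/(sing_sd (sing_map s << v >>)) -[RHS]/(sing_map s (subdiv (bary n) << v >>)).
rewrite sing_mapU sing_sdU sing_map_map.
rewrite (@subdiv_map _ _ (bary q) (bary n)) ?zmapU ?map_affine_vertices //.
by move=> k u; exact: affine_barycenter.
Qed.

Lemma sing_htpy_map n q (s : Sing n) (z : {freeg (q.+1.-tuple (Delta n)) / int}) :
  sing_htpy (sing_map s z) = sing_map s (sd_htpy (bary n) z).
Proof.
pose f : {additive {freeg (q.+1.-tuple (Delta n)) / int} -> SY q.+1} :=
  @sing_htpy q \o @sing_map n q s.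
pose g : {additive {freeg (q.+1.-tuple (Delta n)) / int} -> SY q.+1} :=
  @sing_map n q.+1 s \o @sd_htpy _ (bary n) q.
apply: (zlin_ext (f := f) (g := g)) => v.
rewrite -[LHS]/(sing_htpy (sing_map s << v >>)) -[RHS]/(sing_map s (sd_htpy (bary n) << v >>)).
rewrite sing_mapU sing_htpyU sing_map_map.
rewrite (@sd_htpy_map _ _ (bary q) (bary n)) ?zmapU ?map_affine_vertices //.
by move=> k u; exact: affine_barycenter.
Qed.

Lemma sing_sd_diff n (z : SY n.+1) : sdiff (sing_sd z) = sing_sd (sdiff z).
Proof.
pose f : {additive SY n.+1 -> SY n} := @simplicial_diff (singular_set R Y) n \o @sing_sd n.+1.
pose g : {additive SY n.+1 -> SY n} := @sing_sd n \o @simplicial_diff (singular_set R Y) n.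
apply: (zlin_ext (f := f) (g := g)) => s.
rewrite -[LHS]/(sdiff (sing_sd << s >>)) -[RHS]/(sing_sd (sdiff << s >>)).
rewrite -[in RHS](sing_map_vertices s) sing_map_diff sing_sd_map sing_sdU sing_map_diff.
by rewrite subdiv_diff.
Qed.

Lemma sing_htpy_diff n (z : SY n.+1) :
  sdiff (sing_htpy z) = z - sing_sd z - sing_htpy (sdiff z).
Proof.
pose f : {additive SY n.+1 -> SY n.+1} :=
  @simplicial_diff (singular_set R Y) n.+1 \o @sing_htpy n.+1.
pose g : {additive SY n.+1 -> SY n.+1} :=
  idfun \- @sing_sd n.+1 \- (@sing_htpy n \o @simplicial_diff (singular_set R Y) n).
apply: (zlin_ext (f := f) (g := g)) => s.
rewrite -[LHS]/(sdiff (sing_htpy << s >>)).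
rewrite -[RHS]/(<< s >> - sing_sd << s >> - sing_htpy (sdiff << s >>)).
rewrite -(sing_map_vertices s) sing_sd_map !sing_htpy_map !sing_map_diff sing_htpy_map.
by rewrite sd_htpy_diff !raddfB.
Qed.

Section Small.
Variable V : nat -> set Y.
Hypothesis V_open : forall k, open (V k).
Hypothesis V_cover : forall y, exists k, V k y.

Definition small n (s : Sing n) : Prop := exists k, forall t, V k (s t).

Lemma sing_map_small n q (s : Sing n) (z : {freeg (q.+1.-tuple (Delta n)) / int}) :
  small s -> supported (@small q) (sing_map s z).
Proof.
move=> [k sk]; apply: (@supported_zlin _ _ (fun=> True)) => // v _.
by apply: supportedU; exists k => t; exact: sk.
Qed.

Lemma sing_sd_small n z : supported (@small n) z -> supported (@small n) (sing_sd z).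
Proof. by apply: supported_zlin => s sk; exact: sing_map_small. Qed.

Lemma sing_htpy_small n z : supported (@small n) z -> supported (@small n.+1) (sing_htpy z).
Proof. by apply: supported_zlin => s sk; exact: sing_map_small. Qed.

Lemma std_simplex_compact n : compact (std_simplex R n).
Proof.
apply: bounded_closed_compact.
  exists 1; split; first exact: num_real.
  move=> M M1 t [t0 t1]; change (mx_norm t <= M); rewrite mx_normrE; apply: bigmax_le => [|[i j] _].
    by apply: le_trans (ltW M1).
  rewrite /= ord1 ger0_norm //; apply: le_trans (ltW M1); rewrite -t1.
  by rewrite (bigD1 j) //= lerDl sumr_ge0.
have -> : std_simplex R n = (\bigcap_(i in [set: 'I_n.+1]) [set t : 'rV[R]_n.+1 | 0 <= t 0 i])
    `&` [set t | \sum_i t 0 i = 1].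
  apply/seteqP; split=> [t [t0 t1]|t [t0 t1]]; first by split=> // i _; exact: t0.
  by split=> // i; exact: t0.
apply: closedI.
  apply: closed_bigI => i _.
  have /continuous_closedP/(_ _ (@closed_ge R 0)) := @coord_continuous R 1 n.+1 0 i.
  by [].
have sum_cont : continuous (fun t : 'rV[R]_n.+1 => \sum_i t 0 i).
  by apply: fun_cont_sum => i; exact: coord_continuous.
by have /continuous_closedP/(_ _ (@closed_eq R 1)) := sum_cont.
Qed.

Lemma lebesgue_number n (s : Sing n) : exists2 d : R, 0 < d &
  forall x : Delta n, exists k, forall u : Delta n, simplex_dist x u < d -> V k (s u).
Proof.
pose P (d : R) (x : 'rV[R]_n.+1) := exists k, forall u : Delta n, `|x - val u| < d -> V k (s u).
have loc (x : Delta n) : exists k, exists2 e : R, 0 < e &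
    forall u : Delta n, simplex_dist x u < e -> V k (s u).
  have [k ksx] := V_cover (s x); exists k.
  have : nbhs x (s @^-1` V k) by exact: (@cts_fun _ _ s x _ (open_nbhs_nbhs (conj (V_open k) ksx))).
  rewrite nbhsE => -[B [[C oC CB] Bx] BV]; rewrite -CB in Bx BV.
  have /nbhs_ballP[e /= e0 eC] : nbhs (val x) C by exact: (open_nbhs_nbhs (conj oC Bx)).
  exists e => // u xu; apply: BV; apply: eC; rewrite mx_norm_ball.
  exact: xu.
have /compact_near_coveringP cov := @std_simplex_compact n.
have near0 : \forall d \near 0^'+, std_simplex R n `<=` P d.
  apply: cov => x xD; have [k [e e0 kV]] := loc (exist _ x (mem_set xD)).
  exists (ball x (e / 2), [set d | d < e / 2]) => /=.
    split; first by apply: nbhsx_ballx; rewrite divr_gt0.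
    by apply: nbhs_right_lt; rewrite divr_gt0.
  move=> [x' d] [/= xx' de]; exists k => u x'u; apply: kV.
  rewrite mx_norm_ball /ball_ /= in xx'.
  have := ler_distD x' x (val u); rewrite /simplex_dist /= => h.
  apply: le_lt_trans h _; rewrite [e]splitr ltrD //; exact: lt_trans x'u de.
have [d [d0 dP]] : exists d : R, 0 < d /\ (std_simplex R n `<=` P d).
  apply: (@filter_ex _ (0^'+ : set_system R)); apply: filterI near0.
  exact: nbhs_right_gt.
by exists d => // x; apply: dP; exact: set_mem (valP x).
Qed.

Lemma iter_sd_small n (s : Sing n) : exists m, supported (@small n) (iter m (@sing_sd n) << s >>).
Proof.
have [d d0 leb] := lebesgue_number s.
pose c : R := 1 - n.+1%:R^-1.
pose D : R := \sum_i \sum_j simplex_dist (tnth (vertices R n) i) (tnth (vertices R n) j).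
have dist0 x y : 0 <= @simplex_dist R n x y by exact: normr_ge0.
have D0 : 0 <= D by apply: sumr_ge0 => i _; apply: sumr_ge0.
have mesh0 : mesh_le D (vertices R n).
  move=> i j; rewrite /D (bigD1 i) //= (bigD1 j) //= -addrA lerDl addr_ge0 //.
    exact: sumr_ge0.
  by apply: sumr_ge0 => k _; apply: sumr_ge0.
have mesh m : supported (mesh_le (c ^+ m * D)) (iter m (@subdiv _ (bary n) n) << vertices R n >>).
  elim: m => [|m IHm]; first by apply: supportedU; rewrite expr0 mul1r.
  rewrite iterS; apply: (supported_additive (f := @subdiv _ (bary n) n)) IHm => v vm.
  by rewrite exprS -mulrA; exact: subdiv_mesh.
have [m mD] : exists m, c ^+ m * D < d.
  have c1 : `|c| < 1.
    have n0 : 0 < n.+1%:R^-1 :> R by rewrite invr_gt0 ltr0n.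
    have n1 : n.+1%:R^-1 <= 1 :> R by rewrite invf_le1 ?ltr0n // ler1n.
    by move: n0 n1; rewrite /c; move: n.+1%:R^-1 => x x0 x1; rewrite ger0_norm; lra.
  (* The bound uses D + 1 in place of D, which may be 0. *)
  have := cvg_expr c1; move=> /cvgrPdist_lt /(_ (d / (D + 1))) [].
    by rewrite divr_gt0 // ltr_wpDl.
  move=> m _ /(_ m (leqnn m)) /=; rewrite sub0r normrN => cm; exists m.
  apply: (@le_lt_trans _ _ (`|c ^+ m| * (D + 1))).
    apply: (@le_trans _ _ (`|c ^+ m| * D)); first by rewrite ler_wpM2r // ler_norm.
    by rewrite ler_wpM2l // lerDl.
  by rewrite -ltr_pdivlMr // ltr_wpDl.
exists m.
have -> : iter m (@sing_sd n) << s >> =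
    sing_map s (iter m (@subdiv _ (bary n) n) << vertices R n >>).
  elim: m {mD} => [|m IHm]; first by rewrite sing_map_vertices.
  by rewrite !iterS IHm sing_sd_map.
apply: (supported_zlin _ (mesh m)) => v vm; apply: supportedU.
have [k sk] := leb (tnth v ord0); exists k => t; apply: sk.
by apply: le_lt_trans mD; apply: affine_dist => i; exact: vm.
Qed.

(** By [sing_htpy_diff], z differs from its subdivision by a boundary and by the homotopy applied to
    its own boundary, which is small. Finitely many subdivisions make z itself small. *)
Lemma small_onto n (z : SY n.+1) : supported (@small n) (sdiff z) ->
  exists x b, supported (@small n.+1) x /\ z = x + sdiff b.
Proof.
move=> dz.
have step m : supported (@small n) (sdiff (iter m (@sing_sd n.+1) z)) /\ exists x b,
    supported (@small n.+1) x /\ z = iter m (@sing_sd n.+1) z + x + sdiff b.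
  elim: m => [|m [IHd [x [b [xs zE]]]]].
    split=> //; exists 0, 0; split; first exact: supported0.
    by rewrite raddf0 !addr0.
  set w := iter m _ z in IHd zE; rewrite iterS -/w; split.
    by rewrite sing_sd_diff; exact: sing_sd_small.
  exists (sing_htpy (sdiff w) + x), (sing_htpy w + b); split.
    by apply: supportedD => //; exact: sing_htpy_small.
  rewrite raddfD /= sing_htpy_diff {1}zE.
  move: (sing_sd w) (sing_htpy _) (simplicial_diff b) => A B c.
  rewrite [A + _]addrA [RHS]addrACA -[w - A - B]addrA -opprD [A + B + _]addrC subrK.
  by rewrite addrA.
have [M Ms] : exists M, supported (@small n.+1) (iter M (@sing_sd n.+1) z).
  have [m ms] := choice (@iter_sd_small n.+1).
  exists (\max_(s <- dom z) m s).
  have it k : exists f : {additive SY n.+1 -> SY n.+1}, iter k (@sing_sd n.+1) =1 f.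
    elim: k => [|k [f kf]]; first by exists idfun.
    by exists (@sing_sd n.+1 \o f) => w /=; rewrite kf.
  have [f fE] := it (\max_(s <- dom z) m s); rewrite fE.
  apply: (supported_additive (P := fun s => s \in dom z)) (@supported_dom _ z) => s sz.
  rewrite -fE; have /subnK <- : (m s <= \max_(s <- dom z) m s)%N.
    exact: (leq_bigmax_seq (F := m)).
  rewrite iterD; elim: (_ - _)%N => [|k IHk]; first exact: ms.
  by rewrite iterS; exact: sing_sd_small.
have [_ [x [b [xs zE]]]] := step M; exists (iter M (@sing_sd n.+1) z + x), b.
by split=> //; exact: supportedD.
Qed.

End Small.
End SingularSubdivision.

(** * The cover by particle-free intervals *)

Section LevelledCover.
Variables (R : realType) (M : monoidType).
Hypothesis conical : forall x y : M, (x * y = 1 -> x = 1 /\ y = 1)%g.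
Local Notation Delta := (std_simplex R).
Local Notation Y := (classifying_space R M).
Local Notation Sing q := (singular_simplex R Y q).
Local Notation avoid := (@avoid R M).

(** A point has finitely many particles; some interval lies left of all those at positive positions,
    and no interval contains 0. *)
Lemma avoid_cover (y : Y) : exists k, avoid k y.
Proof.
have [n [x [t ->]]] := bpt_ex y.
have [e e0 eP] : exists2 e : R, 0 < e & forall i, (i < n)%N ->
    0 < psum (val t) i.+1 -> e <= psum (val t) i.+1.
  suff gen m : exists2 e : R, 0 < e & forall i, (i < m)%N ->
      0 < psum (val t) i.+1 -> e <= psum (val t) i.+1 by exact: gen.
  elim: m => [|j [e e0 eP]]; first by exists 1.
  have [pj|pj] := ltP 0 (psum (val t) j.+1); last first.
    exists e => // i; rewrite ltnS leq_eqVlt => /predU1P[->|/eP//].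
    by rewrite ltNge pj.
  exists (Num.min e (psum (val t) j.+1)); first by rewrite lt_min e0.
  move=> i; rewrite ltnS leq_eqVlt => /predU1P[->|ij] pi; rewrite ge_min ?lexx ?orbT //.
  by rewrite eP.
have [k ke] := jhi_small e0; exists k; apply/(avoidE conical) => i lt_in /andP[h1 h2].
have lo0 : 0 < jlo R k by exact: ilevel_gt0.
by have := le_lt_trans (le_trans (eP i lt_in (lt_le_trans lo0 h1)) h2) ke; rewrite ltxx.
Qed.

Lemma avoid_open k : open (avoid k).
Proof. exact/(open_avoids conical)/jlo_jhi. Qed.

Lemma lv_augA_onto q (z : singular_complex R Y q) : supported (@small _ _ avoid q) z ->
  exists x, @lv_augA R M q x = z.
Proof.
move=> zs; have lift (s : Sing q) : exists c : {freeg (levelled R M 0 q) / int},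
    small avoid s -> lv_augA c = << s >>.
  have [[k sk]|no] := pselect (small avoid s); last by exists 0.
  have sL : is_levelled ([tuple k], s).
    apply/asboolP; split=> [i j /andP[ij]|l]; rewrite leqn0 => /eqP e.
      by move: ij; rewrite e leqn0 => /eqP->.
    by rewrite e => t; exact: sk.
  exists << exist (fun x => @is_levelled R M 0 q x) _ sL >> => _.
  by rewrite [LHS]zmapU.
have [c cE] := choice lift; exists (zlin c z).
pose f : {additive {freeg (Sing q) / int} -> {freeg (Sing q) / int}} := @lv_augA R M q \o zlin c.
apply: (supported_ext (f := f) (g := idfun)) zs => s ss.
by rewrite /f /= zlinU cE.
Qed.

Lemma lv_augA_small q x : supported (@small _ _ avoid q) (@lv_augA R M q x).
Proof.
apply: (@supported_zlin _ _ (fun=> True)) => // y _; apply: supportedU.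
by exists (nth 0%N (val y).1 0) => t; exact: levelled_avoid.
Qed.

Lemma simplex0_eq (t u : Delta 0) : t = u.
Proof.
apply/val_inj/rowP => i; rewrite !ord1.
have [_] := set_mem (valP t); have [_] := set_mem (valP u).
by rewrite !big_ord1 => -> ->.
Qed.

Lemma lv_aug_onto : aug_onto (lv_rowaug R M).
Proof.
split=> [a|q a [x ax]].
  have [|x xa] := @lv_augA_onto 0 a; last by exists 0, x; rewrite raddf0 addr0 [RHS]xa.
  move=> s _; have [k sk] := avoid_cover (s (simplex0 R)).
  by exists k => t; rewrite (simplex0_eq t (simplex0 R)).
have [|x' [b [x's aE]]] := small_onto avoid_open avoid_cover (z := a).
  by rewrite [simplicial_diff a]ax; exact: lv_augA_small.
have [y yx'] := lv_augA_onto x's; exists b, y.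
by rewrite [aug _ _ _]yx'.
Qed.

Theorem classifying_space_homology n : zmod_iso
  (homology (simplicial_chains (layered_nerve M)) n) (monoid_homology R M n).
Proof. exact/zmod_iso_sym/(level_homology conical lv_aug_onto). Qed.

End LevelledCover.

(** * The Artin monoid *)

Section ArtinMonoid.
Variables (R : realType) (S : choiceType) (m : coxeter_matrix S).
Local Notation M := (artin_monoid m).
Local Notation acls := (acls m).

Definition letter (s : S) : M := acls [:: s].
Definition artin_length (x : M) : nat := size (repr x).

Lemma artin_lengthE w : artin_length (acls w) = size w.
Proof. by apply/(@acls_size _ m); exact: acls_repr. Qed.

Lemma mdvd_letter s w : mdvd (letter s) (acls w) <-> wdvd m [:: s] w.
Proof.
split=> [[z wE]|[z wE]]; last by exists (acls z); rewrite wE acls_cat.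
by exists (repr z); rewrite wE acls_cat acls_repr.
Qed.

Lemma artin_garside_like : garside_like letter artin_length.
Proof.
split.
- move=> x y; rewrite -[x in LHS]acls_repr -[y in LHS]acls_repr -acls_cat.
  by rewrite artin_lengthE size_cat.
- by move=> s; rewrite artin_lengthE.
- move=> x; rewrite -[x]acls_repr; case: (repr x) => [//|s w] _.
  by exists s, (acls w); rewrite -acls_cat.
- move=> x y z; rewrite -[x]acls_repr -[y]acls_repr -[z]acls_repr -!acls_cat.
  exact: acls_cancel.
- move=> A x; rewrite -[x]acls_repr => Ax.
  have [|z [zA zmin _]] := @letter_lcm_exists R S m (enum_fset A) (repr x).
    by move=> s sA; exact/mdvd_letter/Ax.
  exists (acls z); split=> [s sA|y]; first exact/mdvd_letter/zA.
  rewrite -[y]acls_repr => Ay; have [|c yE] := zmin (repr y).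
    by move=> s sA; exact/mdvd_letter/Ay.
  by exists (acls c); rewrite yE acls_cat.
Qed.

Lemma artin_conical (x y : M) : (x * y = 1 -> x = 1 /\ y = 1)%g.
Proof.
rewrite -[x]acls_repr -[y]acls_repr -acls_cat.
rewrite -[1%g]/(acls [::]) => /acls_size; rewrite size_cat.
by case: (repr x) => [|? ?] //; case: (repr y) => [|? ?].
Qed.

Lemma has_multiple_finite_type (A : {fset S}) :
  has_multiple letter A <-> finite_type_subsets m [set` A].
Proof.
have AE s : [set` A]%classic s <-> s \in enum_fset A by [].
rewrite (finite_type_common_multiple R m AE); split=> [[x Ax]|[w Aw]].
  by exists (repr x) => s sA; apply/mdvd_letter; rewrite acls_repr; exact: Ax.
by exists (acls w) => s sA; exact/mdvd_letter/Aw.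
Qed.

Lemma gcell_subset_subproof k (c : gcell letter k) :
  [set` val c]%classic \in finite_type_ksubsets m k.
Proof.
have /andP[/eqP ck /asboolP cA] := valP c; apply/mem_set; split.
  by apply/fcard_eq; rewrite ?set_fsetK //; last by rewrite (@card_fset_set _ `I_k k) ?ck.
exact/has_multiple_finite_type.
Qed.

Definition gcell_subset k (c : gcell letter k) : finite_type_ksubsets m k :=
  exist (fun I => I \in finite_type_ksubsets m k) _ (gcell_subset_subproof c).

Lemma subset_gcell_subproof k (I : finite_type_ksubsets m k) :
  (#|` fset_set (val I)| == k) && `[< has_multiple letter (fset_set (val I)) >].
Proof.
have [Ik If] := set_mem (valP I); rewrite (card_fset_set Ik) eqxx /=.
apply/asboolP/has_multiple_finite_type; rewrite fset_setK //.
by apply/finite_setP; exists k.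
Qed.

Definition subset_gcell k (I : finite_type_ksubsets m k) : gcell letter k :=
  exist (fun A => (#|` A| == k) && `[< has_multiple letter A >]) _
    (subset_gcell_subproof I).

Lemma subset_gcellK k : cancel (@subset_gcell k) (@gcell_subset k).
Proof.
move=> I; apply: val_inj; rewrite /= fset_setK //; apply/finite_setP; exists k.
by have [] := set_mem (valP I).
Qed.

Lemma gcell_subsetK k : cancel (@gcell_subset k) (@subset_gcell k).
Proof. by move=> c; apply: val_inj; rewrite /= set_fsetK. Qed.

End ArtinMonoid.

Lemma bij_Zbasis (B B' : choiceType) (f : B -> B') : bijective f ->
  is_Zbasis (fun x => << f x >> : {freeg B' / int}).
Proof.
move=> [g fK gK]; exists (zmap g) => z; rewrite -[zlin _ _]/(zmap f _) zmap_comp.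
  by rewrite -[RHS]zmap_id; apply: eq_zmap.
by rewrite -[RHS]zmap_id; apply: eq_zmap.
Qed.

(** The order serves to define the Koszul signs; it comes from a well-ordering. *)
Lemma strict_order_exists (T : eqType) : exists lt : rel T,
  irreflexive lt /\ forall s t, s != t -> lt t s = ~~ lt s t.
Proof.
have [le le_wo] := well_ordering_principle T.
have wo : wo_chain le predT by move=> A _; exact: le_wo.
exists (fun s t => (s != t) && le s t); split=> [s|s t st]; first by rewrite eqxx.
rewrite eq_sym st /=; apply/idP/idP => [ts|].
  apply: contra st => ls; apply/eqP.
  by apply: (wo_chain_antisymmetric wo) => //; rewrite ls ts.
by have /orP[->|] := wo_chainW wo isT isT (x := s) (y := t).
Qed.

Theorem proposition7p5 (R : realType) (S : choiceType) (m : coxeter_matrix S) :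
  exists C : chain_complex,
    (forall k : nat,
       exists b : finite_type_ksubsets m k -> C k, is_Zbasis b) /\
    (forall n : nat,
       zmod_iso (homology C n) (monoid_homology R (artin_monoid m) n)).
Proof.
have gl := artin_garside_like R m.
have [lt [ltss lt_flip]] := strict_order_exists S.
have [d [d_act dK daug ex0 exS]] := resolution_exists gl ltss lt_flip.
exists (gen_complex gl d_act dK); split=> [k|n].
  exists (fun I => << subset_gcell R I >>); apply: bij_Zbasis.
  by exists (@gcell_subset R S m k); [exact: subset_gcellK|exact: gcell_subsetK].
apply: zmod_iso_trans (classifying_space_homology R (@artin_conical S m) n).
exact/zmod_iso_sym/gen_complex_homology.
Qed.
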